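(* Let $\mathcal K(t)\subset\Omega$, $t\ge0$, be a family of measurable sets with $X(t;s,\mathcal K(s))\subset\mathcal K(t)$ for all $0\le s\le t$. Let $\Phi\in C^1(\mathbb R_{\ge0}\times\overline\Omega)$ and $a_d\in\mathbb R$ be such that $V_d(t):=\{x\in\Omega:\Phi(t,x)\le a_d\}$ is nonempty for all $t\ge0$, and write $D_u\Phi:=\partial_t\Phi+u\cdot\nabla\Phi$. Assume that there exist constants $\gamma>0$, $\Phi_{\min}\in\mathbb R$, $\Phi_{\max}>a_d$, $\sigma_{\min}>0$ and representatives of $u$ and $\sigma$ such that, for every $t\ge0$, $$\Phi_{\min}\le\Phi(t,x)\le\Phi_{\max},\quad x\in\mathcal K(t),$$ $$D_u\Phi(t,x)\le-\gamma,\quad x\in\mathcal K(t)\setminus V_d(t),$$ $$\sigma(t,x)\ge\sigma_{\min},\quad x\in V_d(t)\cap\mathcal K(t).$$ Put $$M^-_{\mathcal K}:=\operatorname*{ess\,sup}_{t\ge0,\ x\in\mathcal K(t)}(\nabla\cdot u(t,x))_-,\qquad L_{\mathcal K}:=\operatorname*{ess\,sup}_{t\ge0,\ x\in\mathcal K(t)\cap V_d(t)}(D_u\Phi(t,x))_+,$$ and assume $L_{\mathcal K}<+\infty$. Let $\ell>0$ satisfy $$\ell\gamma>M^-_{\mathcal K},$$ and let the feedback gain $\kappa>0$ satisfy $$2\kappa\sigma_{\min}>\ell L_{\mathcal K}+M^-_{\mathcal K}.$$ Then the closed-loop error equation $\partial_te+\nabla\cdot(ue)=-\kappa\sigma e$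 is exponentially stable in $L^2(\Omega)$ for all initial errors supported in $\mathcal K(0)$. More precisely, for every $$0<\alpha<\tfrac12\min\bigl\{\ell\gamma-M^-_{\mathcal K},\ 2\kappa\sigma_{\min}-\ell L_{\mathcal K}-M^-_{\mathcal K}\bigr\}$$ there exists $C_\ell>0$ such that every solution with initial datum $e_0\in L^2(\Omega)$, $\operatorname{ess\,supp}e_0\subset\mathcal K(0)$, satisfies $$\|e(t)\|_{L^2(\Omega)}^2\le C_\ell e^{-2\alpha t}\|e_0\|_{L^2(\Omega)}^2,\qquad t\ge0.$$
   Context: Setting. $\Omega\subset\mathbb R^m$ ($m\ge1$) is a bounded domain with $C^2$ boundary and outward unit normal $n$; $\mathbb R_{\ge0}=[0,+\infty)$; $f_+:=\max\{f,0\}$, $f_-:=\max\{-f,0\}$. The velocity field satisfies $u\in L^\infty_{\mathrm{loc}}(\mathbb R_{\ge0};W^{1,\infty}(\Omega;\mathbb R^m))$, $\nabla\cdot u\in L^\infty(\mathbb R_{\ge0}\times\Omega)$ and $u(t,\cdot)\cdot n=0$ on $\partial\Omega$ (trace sense) for a.e. $t\ge0$. The localization function satisfies $\sigma\in L^\infty(\mathbb R_{\ge0}\times\Omega)$, $\sigma\ge0$ a.e. (In the source, $e=\rho-\rho^\star$ is the error of a density $\rho$ relative to a reference profile $\rho^\star\in L^2(\Omega)$ with $\nabla\cdot(\rho^\star u)\in L^2_{\mathrm{loc}}(\mathbb R_{\ge0};L^2(\Omega))$; $\rho^\star$ does not enter the error equation.) Flow. $X(s;t,x)$ is the (unique, Carathéodory)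 characteristic flow: $\frac{d}{ds}X(s;t,x)=u(s,X(s;t,x))$, $X(t;t,x)=x$; each $X(s;t,\cdot)$ is a Lipschitz homeomorphism of $\overline\Omega$ onto itself with Lipschitz inverse $X(t;s,\cdot)$ and maps $\Omega$ onto $\Omega$. Solution. Put $E(t,s;x):=\exp\bigl(-\int_s^t(\nabla\cdot u+\kappa\sigma)(\tau,X(\tau;s,x))\,d\tau\bigr)$ and $(U(t,s)\phi)(X(t;s,x))=\phi(x)E(t,s;x)$ for $0\le s\le t$, $\phi\in L^2(\Omega)$. The solution with initial datum $e_0\in L^2(\Omega)$ is the unique mild solution $e(t)=U(t,0)e_0\in C([0,\infty);L^2(\Omega))$. Essential support. $\operatorname{ess\,supp}f$ is the complement in $\Omega$ of the largest open set on which $f=0$ a.e. *)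

(* Defs.v *)
From HB Require Import structures.
From mathcomp Require Import all_boot all_order all_algebra.
From mathcomp Require Import all_classical all_reals all_analysis.
From mathcomp Require Import ess_sup_inf.
Set Implicit Arguments.
Unset Strict Implicit.
Unset Printing Implicit Defensive.
Import Order.TTheory GRing.Theory Num.Theory.
Import numFieldNormedType.Exports.
Local Open Scope classical_set_scope.
Local Open Scope ring_scope.

(* The Borel sigma-algebra of R^n, generated by the coordinates; same
   construction as the library's for n-tuples. *)
Definition measure_rV_display : measure_display -> measure_display.
Proof. exact. Qed.

Section measurable_rV.
Context {d} {T : measurableType d}.
Variable n : nat.

Let coors : 'I_n -> 'rV[T]_n -> T := fun i v => v ord0 i.

Let rV_set0 : g_sigma_preimage coors set0.
Proof. exact: sigma_algebra0. Qed.

Let rV_setC A : g_sigma_preimage coors A -> g_sigma_preimage coors (~` A).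
Proof. exact: sigma_algebraC. Qed.

Let rV_bigcup (F : _^nat) : (forall i, g_sigma_preimage coors (F i)) ->
  g_sigma_preimage coors (\bigcup_i (F i)).
Proof. exact: sigma_algebra_bigcup. Qed.

HB.instance Definition _ := @isMeasurable.Build (measure_rV_display d)
  'rV[T]_n (g_sigma_preimage coors) rV_set0 rV_setC rV_bigcup.

End measurable_rV.

Lemma measurable_coord d (T : measurableType d) n (i : 'I_n) :
  measurable_fun [set: 'rV[T]_n] (fun v : 'rV[T]_n => v ord0 i).
Proof.
move=> _ Y mY; rewrite setTI; apply: sub_sigma_algebra => /=.
rewrite -bigcup_seq/=; exists i => /=; first by rewrite mem_index_enum.
by exists Y => //; rewrite setTI.
Qed.

Lemma measurable_fun_coordP d1 d2 (T1 : measurableType d1)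
    (T2 : measurableType d2) n (f : T1 -> 'rV[T2]_n) :
  measurable_fun [set: T1] f <->
  forall i, measurable_fun [set: T1] (fun x => f x ord0 i).
Proof.
split=> [mf i|mf]; first exact: measurableT_comp (@measurable_coord _ _ _ i) mf.
have : preimage_set_system [set: T1] f
    (g_sigma_preimage (fun i (v : 'rV[T2]_n) => v ord0 i)) `<=` measurable.
  rewrite -g_sigma_preimage_comp; apply: smallest_sub.
    exact: sigma_algebra_measurable.
  case: n => [|n] in f mf *; first by rewrite big_ord0.
  rewrite -bigcup_mkord_ord; apply: bigcup_sub => i Ii A [B mB <-].
  exact: mf.
by move=> sub _ A mA; apply: sub; exists A.
Qed.

Section lebesgue_rV.
Context {R : realType}.

Definition cons_rV n (p : measurableTypeR R * 'rV[R]_n) : 'rV[R]_n.+1 :=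
  \row_i (if unlift ord0 i is Some j then p.2 ord0 j else p.1).

Definition split_rV n (v : 'rV[R]_n.+1) : measurableTypeR R * 'rV[R]_n :=
  (v ord0 ord0, \row_j v ord0 (lift ord0 j)).

Lemma cons_rVK n : cancel (@cons_rV n) (@split_rV n).
Proof.
move=> [a v]; rewrite /split_rV /cons_rV mxE unlift_none; congr pair.
by apply/rowP => j; rewrite !mxE liftK.
Qed.

Lemma measurable_cons_rV n : measurable_fun setT (@cons_rV n).
Proof.
apply/measurable_fun_coordP => i.
under eq_fun do rewrite mxE.
case: unliftP => [j _|_]; last exact: measurable_fst.
exact: measurableT_comp (@measurable_coord _ _ _ j) measurable_snd.
Qed.

Lemma measurable_split_rV n : measurable_fun setT (@split_rV n).
Proof.
apply/measurable_fun_pairP; split.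
  exact: (@measurable_coord _ R n.+1 ord0).
apply/measurable_fun_coordP => i.
rewrite [X in measurable_fun _ X](_ : _ =
    fun v : 'rV[R]_n.+1 => v ord0 (lift ord0 i)).
  exact: (@measurable_coord _ R n.+1 (lift ord0 i)).
by apply/funext => v; rewrite /= mxE.
Qed.

Section step.
Variables (n : nat) (mu : {sigma_finite_measure set 'rV[R]_n -> \bar R}).
Local Open Scope ereal_scope.

Definition lebesgue_rV_step : set 'rV[R]_n.+1 -> \bar R :=
  pushforward (@lebesgue_measure R \x mu) (@cons_rV n).

Let step0 : lebesgue_rV_step set0 = 0.
Proof. by rewrite /lebesgue_rV_step /pushforward preimage_set0 measure0. Qed.

Let step_ge0 A : 0 <= lebesgue_rV_step A.
Proof.
exact: (@measure_ge0 _ _ _ (@lebesgue_measure R \x mu)).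
Qed.

Let step_sigma_additive : semi_sigma_additive lebesgue_rV_step.
Proof.
move=> F mF tF mUF; rewrite /lebesgue_rV_step /pushforward preimage_bigcup.
have mcons A : measurable A -> measurable (@cons_rV n @^-1` A).
  by move=> mA; rewrite -[X in measurable X]setTI; exact: measurable_cons_rV.
apply: measure_semi_sigma_additive.
- by move=> k; exact: mcons.
- apply/trivIsetP => /= i j _ _ ij; rewrite -preimage_setI.
  by move/trivIsetP : tF => /(_ _ _ _ _ ij) ->//; rewrite preimage_set0.
- by rewrite -preimage_bigcup; exact: mcons.
Qed.

HB.instance Definition _ := isMeasure.Build _ _ _ lebesgue_rV_step
  step0 step_ge0 step_sigma_additive.

Let step_sigma_finite : sigma_finite setT lebesgue_rV_step.
Proof.
have /sigma_finiteP[F [TF ndF Foo]] := sigma_finiteT (@lebesgue_measure R).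
have /sigma_finiteP[G [TG ndG Goo]] := sigma_finiteT mu.
exists (fun k => @split_rV n @^-1` (F k `*` G k)) => [|k].
  rewrite -preimage_bigcup (_ : \bigcup_i _ = setT) ?preimage_setT//.
  apply/seteqP; split=> // -[x y] _.
  have [k _ Fkx] : (\bigcup_i F i) x by rewrite -TF.
  have [l _ Gly] : (\bigcup_i G i) y by rewrite -TG.
  exists (maxn k l) => //; split.
  - by move: x Fkx; exact/subsetPset/ndF/leq_maxl.
  - by move: y Gly; exact/subsetPset/ndG/leq_maxr.
have [mF Fk] := Foo k; have [mG Gk] := Goo k; split.
  rewrite -[X in measurable X]setTI.
  by apply: measurable_split_rV => //; exact: measurableX.
rewrite /lebesgue_rV_step /pushforward -comp_preimage.
rewrite (_ : _ \o _ = id); last by apply/funext => p /=; exact: cons_rVK.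
by rewrite preimage_id product_measure1E// lte_mul_pinfty// ge0_fin_numE.
Qed.

HB.instance Definition _ := Measure_isSigmaFinite.Build _ _ _
  lebesgue_rV_step step_sigma_finite.

End step.

(* Lebesgue measure on R^n, as the n-fold product of the one on R. *)
Fixpoint lebesgue_rV n : {sigma_finite_measure set 'rV[R]_n -> \bar R} :=
  if n is n'.+1 then lebesgue_rV_step (lebesgue_rV n')
  else @dirac _ 'rV[R]_0 0 R.

End lebesgue_rV.

Lemma lebesgue_rV_box (R : realType) n (A : 'I_n -> set (measurableTypeR R)) :
  (forall i, measurable (A i)) ->
  lebesgue_rV n [set v : 'rV[R]_n | forall i, A i (v ord0 i)] =
  (\prod_(i < n) lebesgue_measure (A i))%E.
Proof.
elim: n A => [A _|n ih A mA].
  rewrite big_ord0 /= diracE mem_set//.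
  by case.
rewrite big_ord_recl -ih => [|i]; last exact: mA.
rewrite -product_measure1E//=; last first.
  rewrite (_ : mkset _ =
    \bigcap_(i in [set: 'I_n]) (fun v : 'rV[R]_n => v ord0 i) @^-1`
      A (lift ord0 i)).
  apply: fin_bigcap_measurable => [|i _]; first exact: finite_finset.
  rewrite -[X in measurable X]setTI.
  exact: (@measurable_coord _ R n i measurableT _ (mA (lift ord0 i))).
  by apply/seteqP; split=> v /= Av i; [move=> _|]; exact: Av.
rewrite /lebesgue_rV_step /pushforward; congr product_measure1.
apply/seteqP; split=> [[a v] /= Aav|[a v] [/= Aa Av] i]; last first.
  by rewrite mxE; case: unliftP => [j ->|->]; [exact: Av|].
split=> [|i]/=; first by have := Aav ord0; rewrite mxE unlift_none.
by have := Aav (lift ord0 i); rewrite mxE liftK.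
Qed.

Section almost_everywhere.
Context d (T : measurableType d) (R : realType).
Variable mu : {measure set T -> \bar R}.

(* Lebesgue measurability, i.e. measurability for the completion of mu: the
   sigma-algebras above are the Borel ones. *)
Definition ae_measurable (A : set T) :=
  exists2 B, measurable B & mu.-negligible ((A `\` B) `|` (B `\` A)).

Definition ae_measurable_fun d' (U : measurableType d') (D : set T)
    (f : T -> U) :=
  exists2 g : T -> U, measurable_fun setT g & ae_eq mu D f g.

End almost_everywhere.

Section euclidean.
Context {R : realType} {m : nat}.
Implicit Types (x v w : 'rV[R]_m) (f : 'rV[R]_m -> R).

Definition dot v w : R := \sum_i v ord0 i * w ord0 i.

Definition norm2 v : R := Num.sqrt (dot v v).

Definition partial (i : 'I_m) f x : R := 'D_(delta_mx ord0 i) f x.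

Definition grad f x : 'rV[R]_m := \row_i partial i f x.

(* C^k on an open set U, in the sense that all the partial derivatives of order
   at most k exist and are continuous on U. *)
Fixpoint Ck_on (U : set 'rV[R]_m) (k : nat) f : Prop :=
  {in U, continuous f} /\
  if k is k'.+1 then
    forall i, (forall x, U x -> derivable f x (delta_mx ord0 i)) /\
              Ck_on U k' (partial i f)
  else True.

Definition test_function (Omega : set 'rV[R]_m) f :=
  [/\ forall k, Ck_on setT k f,
      compact (closure [set x | f x != 0]) &
      closure [set x | f x != 0] `<=` Omega].

End euclidean.

Section domain.
Context {R : realType} {m : nat}.
Implicit Types (Omega U : set 'rV[R]_m) (psi : 'rV[R]_m -> R).

Definition boundary Omega := closure Omega `\` interior Omega.

(* Near p, Omega is the side psi < 0 of the C^2 hypersurface psi = 0, hence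
   grad psi points outwards. *)
Definition C2_defining_function Omega p U psi :=
  [/\ open U, U p, Ck_on U 2 psi,
      (forall x, U x -> grad psi x != 0) &
      Omega `&` U = [set x | psi x < 0] `&` U].

Definition bounded_C2_domain Omega :=
  [/\ open Omega, connected Omega, Omega !=set0, bounded_set Omega &
      forall p, boundary Omega p ->
        exists U psi, C2_defining_function Omega p U psi].

Definition outward_unit_normal Omega p (v : 'rV[R]_m) :=
  exists U psi, C2_defining_function Omega p U psi /\
    v = (norm2 (grad psi p))^-1 *: grad psi p.

End domain.

Section data.
Context {R : realType} {m : nat}.
Variable Omega : set 'rV[R]_m.
Notation leb := (@lebesgue_measure R).
Notation lebm := (lebesgue_rV m).
Notation cylinder := [set p : measurableTypeR R * 'rV[R]_m |
  (0 : R) <= p.1 /\ Omega p.2].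
Implicit Types (u : R -> 'rV[R]_m -> 'rV[R]_m)
  (Du : R -> 'rV[R]_m -> 'M[R]_m) (f sigma : R -> 'rV[R]_m -> R)
  (X : R -> R -> 'rV[R]_m -> 'rV[R]_m).

Definition spacetime_ae_eq V (f g : R -> 'rV[R]_m -> V) :=
  ae_eq (leb \x lebm)%E cylinder (fun p => f p.1 p.2) (fun p => g p.1 p.2).

Definition spacetime_measurable f :=
  ae_measurable_fun (leb \x lebm)%E cylinder (fun p => f p.1 p.2).

Definition spacetime_Linfty f := spacetime_measurable f /\
  exists M : R, {ae (leb \x lebm)%E, forall p, cylinder p -> `|f p.1 p.2| <= M}.

(* G is the weak Jacobian matrix of v on Omega: G i j is d_j v_i. *)
Definition weak_gradient (v : 'rV[R]_m -> 'rV[R]_m)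
    (G : 'rV[R]_m -> 'M[R]_m) :=
  forall phi, test_function Omega phi -> forall i j,
    \int[lebm]_(x in Omega) (v x ord0 i * partial j phi x) =
    - \int[lebm]_(x in Omega) (G x i j * phi x).

Definition div Du (t : R) x : R := \tr (Du t x).

(* u is in L^oo_loc(R_+; W^{1,oo}(Omega; R^m)) with weak gradient Du, div u is
   in L^oo(R_+ x Omega), and u . n = 0 on the boundary. As usual, u(t, .) is the
   representative that is continuous on the closure of Omega; the trace is its
   restriction to the boundary. *)
Record velocity_field (n : 'rV[R]_m -> 'rV[R]_m) u Du : Prop := {
  velocity_measurable : forall i, spacetime_measurable (fun t x => u t x ord0 i);
  velocity_grad_measurable :
    forall i j, spacetime_measurable (fun t x => Du t x i j);
  velocity_loc_bounded : forall T : R, exists M : R,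
    {ae leb, forall t : R, 0 <= t <= T ->
      {ae lebm, forall x, Omega x -> `|u t x| <= M /\ `|Du t x| <= M}};
  velocity_continuous :
    {ae leb, forall t : R, 0 <= t -> {within closure Omega, continuous (u t)}};
  velocity_weak_gradient :
    {ae leb, forall t : R, 0 <= t -> weak_gradient (u t) (Du t)};
  velocity_div_bounded : spacetime_Linfty (div Du);
  velocity_tangent : {ae leb, forall t : R, 0 <= t ->
    forall p, boundary Omega p -> dot (u t p) (n p) = 0}
}.

Definition localization sigma := spacetime_Linfty sigma /\
  {ae (leb \x lebm)%E, forall p, cylinder p -> 0 <= sigma p.1 p.2}.

(* X s t x stands for X(s; t, x). The differential equation is in the sense of
   Caratheodory, i.e. in integral form. *)
Record flow u (X : R -> R -> 'rV[R]_m -> 'rV[R]_m) : Prop := {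
  flow_init : forall (t : R) x, 0 <= t -> closure Omega x -> X t t x = x;
  flow_ode : forall (t : R) x (a b : R), 0 <= t -> closure Omega x -> 0 <= a <= b ->
    forall i, X b t x ord0 i - X a t x ord0 i =
      \int[leb]_(r in `[a, b]) u r (X r t x) ord0 i;
  flow_lipschitz : forall s t : R, 0 <= s -> 0 <= t ->
    [lipschitz X s t x | x in closure Omega];
  flow_closure : forall s t : R, 0 <= s -> 0 <= t ->
    X s t @` closure Omega = closure Omega;
  flow_domain : forall s t : R, 0 <= s -> 0 <= t -> X s t @` Omega = Omega;
  flow_inverse : forall (s t : R) x, 0 <= s -> 0 <= t -> closure Omega x ->
    X t s (X s t x) = x
}.

Definition L2norm (f : 'rV[R]_m -> R) : \bar R :=
  'N[lebm]_(2%:E)[EFin \o (f \_ Omega)].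

Definition L2 (f : 'rV[R]_m -> R) :=
  ae_measurable_fun lebm Omega f /\ (L2norm f < +oo)%E.

Definition ess_supp (f : 'rV[R]_m -> R) : set 'rV[R]_m :=
  Omega `\` \bigcup_(V in [set V : set 'rV[R]_m | [/\ open V, V `<=` Omega &
    {ae lebm, forall x, V x -> f x = 0}]]) V.

(* E(t, s; x) and the evolution operator U(t, s). Since X(s; t, .) is the inverse
   of X(t; s, .), U is given by (U(t, s) phi)(X(t; s, x)) = phi(x) E(t, s; x). *)
Definition growth Du sigma (kappa : R) X (t s : R) (x : 'rV[R]_m) : R :=
  expR (- \int[leb]_(r in `[s, t])
    (div Du r (X r s x) + kappa * sigma r (X r s x))).

Definition evolution Du sigma kappa X (t s : R) (phi : 'rV[R]_m -> R) :
    'rV[R]_m -> R :=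
  fun y => phi (X s t y) * growth Du sigma kappa X t s (X s t y).

(* e is the mild solution, in C([0, +oo[; L^2(Omega)), of
   d_t e + div (u e) = - kappa sigma e with initial datum e0. *)
Record mild_solution Du sigma kappa X (e0 : 'rV[R]_m -> R)
    (e : R -> 'rV[R]_m -> R) : Prop := {
  mild_L2 : forall t : R, 0 <= t -> L2 (e t);
  mild_evolution : forall t : R, 0 <= t ->
    ae_eq lebm Omega (e t) (evolution Du sigma kappa X t 0 e0);
  mild_continuous : forall t : R, 0 <= t ->
    L2norm (e s \- e t) @[s --> within `[0, +oo[ (nbhs t)] --> 0%E
}.

(* Phi is in C^1(R_+ x closure Omega), Phit and gradPhi being the continuous
   extensions of its time derivative and of its spatial gradient. *)
Record C1_closure (Phi Phit : R -> 'rV[R]_m -> R)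
    (gradPhi : R -> 'rV[R]_m -> 'rV[R]_m) : Prop := {
  C1_fun : {within [set p : R * 'rV[R]_m | 0 <= p.1 /\ closure Omega p.2],
    continuous (fun p => Phi p.1 p.2)};
  C1_dt : {within [set p : R * 'rV[R]_m | 0 <= p.1 /\ closure Omega p.2],
    continuous (fun p => Phit p.1 p.2)};
  C1_dx : {within [set p : R * 'rV[R]_m | 0 <= p.1 /\ closure Omega p.2],
    continuous (fun p => gradPhi p.1 p.2)};
  C1_is_dt : forall (t : R) x, 0 < t -> Omega x ->
    is_derive t (1 : R) (Phi ^~ x) (Phit t x);
  C1_is_dx : forall (t : R) x i, 0 < t -> Omega x ->
    is_derive x (delta_mx ord0 i) (Phi t) (gradPhi t x ord0 i)
}.

Definition material_derivative u Phit gradPhi (t : R) (x : 'rV[R]_m) : R :=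
  Phit t x + dot (u t x) (gradPhi t x).

Definition sublevel (Phi : R -> 'rV[R]_m -> R) (a t : R) : set 'rV[R]_m :=
  [set x | Omega x /\ Phi t x <= a].

(* Essential supremum of a nonnegative f over {(t, x) : t >= 0, x in A t}; it is
   0 if this set is negligible. *)
Definition ess_sup_on (A : R -> set 'rV[R]_m) f : \bar R :=
  ess_sup (leb \x lebm)%E
    ((fun p => (f p.1 p.2)%:E) \_
      [set p : measurableTypeR R * 'rV[R]_m | (0 : R) <= p.1 /\ A p.1 p.2]).

End data.

(* Main.v *)
(* Along the characteristic through x, the square of the solution, multiplied by
   the Jacobian of the flow, is e0 x ^+ 2 times the exponential of
   - \int_0^t (div u + 2 kappa sigma). Off V_d, Phi decreases at rate gamma and
   ell gamma exceeds (div u)_-; on V_d, the damping 2 kappa sigma_min exceeds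
   ell L_K + (div u)_-. In both cases the integrand is at least
   2 alpha + ell D_u Phi, so the exponential is at most
   exp (ell (Phi_max - Phi_min) - 2 alpha t).
   The rest is the change of variables y = X(t; 0, x), whose Jacobian is
   exp (\int_0^t div u). As div u is only a weak divergence, it is obtained by
   showing that s |-> \int phi (X(0; s, y)) dy is differentiable in the sense of
   Liouville's equation for Lipschitz phi (mollify phi, and expand to first order
   the volume distortion of the flow over a short time), and then passing to Borel
   functions by cutoffs and a monotone class argument. *)
Require Import Defs.
From mathcomp Require Import all_boot all_order all_algebra.
From mathcomp Require Import all_classical all_reals all_analysis.
From mathcomp Require Import measurable_realfun ess_sup_inf zify ring lra.
Set Implicit Arguments.
Unset Strict Implicit.
Unset Printing Implicit Defensive.
Import Order.TTheory GRing.Theory Num.Theory.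
Import numFieldNormedType.Exports.
Local Open Scope classical_set_scope.
Local Open Scope ring_scope.

(** * Integration of bounded Borel functions *)

(** The flow is only Lipschitz in space and the velocity only measurable in time, so no determinant
    of [X(t; s, .)] is formed: the Jacobian is known through its action on integrals. Derivatives
    are put on a smooth mollifier [eta]. Writing the integral of [g (y - V y)] as a double integral
    of [eta (x - y + V y) * g x], up to a small error, and expanding [eta] in [V y] leaves a
    first-order term to which the weak divergence of [V] applies. For a time step [h] the
    displacement has size and Lipschitz constant of order [h], so the errors are of order [e * h]
    and [C(e) * h^2], where the Taylor constant [C(e)] of [eta] may explode with its radius [e];
    hence [e] is chosen before [h]. Null sets are of two kinds. The velocity may be changed only on
    a null set of times, else the trajectories would change. Its divergence and [sigma] are known
    only almost everywhere in space-time; they can be read along trajectories because the flow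
    carries null sets to null sets, itself a consequence of the change of variables for a Borel
    version of the divergence. *)

Section bounded_measurable.
Context d (T : measurableType d) (R : realType).
Implicit Types f g : T -> R.

(** Boundedness is asked on the whole type, not on the domain of integration: the class is then an
    algebra, stable under Borel substitutions and partial integration, and integrability on sets of
    finite measure is automatic. *)
Definition bmf f := measurable_fun setT f /\ exists C : R, forall x, `|f x| <= C.

Lemma bmf_cst (c : R) : bmf (fun _ => c).
Proof. by split; [exact: measurable_cst|exists `|c|]. Qed.

Lemma bmfD f g : bmf f -> bmf g -> bmf (fun x => f x + g x).
Proof.
move=> [mf [C hC]] [mg [E hE]]; split; first exact: measurable_funD.
by exists (C + E) => x; apply: le_trans (ler_normD _ _) _; exact: lerD.
Qed.

Lemma bmfN f : bmf f -> bmf (fun x => - f x).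
Proof.
move=> [mf [C hC]]; split; first exact: measurableT_comp.
by exists C => x; rewrite normrN.
Qed.

Lemma bmfB f g : bmf f -> bmf g -> bmf (fun x => f x - g x).
Proof. by move=> bf bg; apply: bmfD => //; exact: bmfN. Qed.

Lemma bmfM f g : bmf f -> bmf g -> bmf (fun x => f x * g x).
Proof.
move=> [mf [C hC]] [mg [E hE]]; split; first exact: measurable_funM.
by exists (C * E) => x; rewrite normrM ler_pM.
Qed.

Lemma bmfZ (c : R) f : bmf f -> bmf (fun x => c * f x).
Proof. by move=> bf; apply: bmfM => //; exact: bmf_cst. Qed.

Lemma bmf_norm f : bmf f -> bmf (fun x => `|f x|).
Proof.
move=> [mf [C hC]]; split; first exact: measurableT_comp.
by exists C => x; rewrite normr_id.
Qed.

Lemma bmf_sum (I : eqType) (s : seq I) (F : I -> T -> R) :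
  (forall i, i \in s -> bmf (F i)) -> bmf (fun x => \sum_(i <- s) F i x).
Proof.
elim: s => [_|i s ih h].
  by under eq_fun do rewrite big_nil; exact: bmf_cst.
under eq_fun do rewrite big_cons.
apply: bmfD; first by apply: h; rewrite mem_head.
by apply: ih => j js; apply: h; rewrite in_cons js orbT.
Qed.

Lemma bmf_indic (A : set T) : measurable A -> bmf (\1_A : T -> R).
Proof.
move=> mA; split; first exact: measurable_indic.
by exists 1 => x; rewrite indicE; case: (_ \in _); rewrite ?normr1 ?normr0.
Qed.

End bounded_measurable.

Lemma bmf_comp d1 d2 (T1 : measurableType d1) (T2 : measurableType d2)
    (R : realType) (f : T2 -> R) (h : T1 -> T2) :
  bmf f -> measurable_fun setT h -> bmf (fun x => f (h x)).
Proof.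
move=> [mf [C hC]] mh; split; first exact: measurableT_comp.
by exists C.
Qed.

Section bounded_integral.
Context d (T : measurableType d) (R : realType).
Variable mu : {measure set T -> \bar R}.
Variables (D : set T) (mD : measurable D) (finD : (mu D < +oo)%E).
Implicit Types f g : T -> R.

Lemma bmf_integrable f : bmf f -> mu.-integrable D (EFin \o f).
Proof.
move=> [mf [C hC]]; apply: measurable_bounded_integrable => //.
  exact: measurable_funTS.
exists C; split; first exact: num_real.
by move=> M CM x _ /=; exact: le_trans (hC x) (ltW CM).
Qed.

Lemma bmf_EFin_int f : bmf f ->
  (\int[mu]_(x in D) (f x)%:E = (\int[mu]_(x in D) f x)%:E)%E.
Proof.
by move=> bf; rewrite /Rintegral fineK//; exact: integrable_fin_num (bmf_integrable bf).
Qed.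

Lemma bint_cst (c : R) : \int[mu]_(x in D) c = c * fine (mu D).
Proof. exact: Rintegral_cst. Qed.

Lemma bintD f g : bmf f -> bmf g ->
  \int[mu]_(x in D) (f x + g x) = \int[mu]_(x in D) f x + \int[mu]_(x in D) g x.
Proof. by move=> bf bg; apply: RintegralD => //; exact: bmf_integrable. Qed.

Lemma bintB f g : bmf f -> bmf g ->
  \int[mu]_(x in D) (f x - g x) = \int[mu]_(x in D) f x - \int[mu]_(x in D) g x.
Proof. by move=> bf bg; apply: RintegralB => //; exact: bmf_integrable. Qed.

Lemma bintZ (c : R) f : bmf f ->
  \int[mu]_(x in D) (c * f x) = c * \int[mu]_(x in D) f x.
Proof. by move=> bf; apply: RintegralZl => //; exact: bmf_integrable. Qed.

Lemma bintZr (c : R) f : bmf f ->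
  \int[mu]_(x in D) (f x * c) = (\int[mu]_(x in D) f x) * c.
Proof. by move=> bf; apply: RintegralZr => //; exact: bmf_integrable. Qed.

Lemma bintN f : bmf f -> \int[mu]_(x in D) (- f x) = - \int[mu]_(x in D) f x.
Proof.
move=> bf; rewrite -[RHS]mulN1r -bintZ//.
by apply: eq_Rintegral => x _; rewrite mulN1r.
Qed.

Lemma bint_le f g : bmf f -> bmf g -> (forall x, D x -> f x <= g x) ->
  \int[mu]_(x in D) f x <= \int[mu]_(x in D) g x.
Proof. by move=> bf bg fg; apply: le_Rintegral => //; exact: bmf_integrable. Qed.

Lemma bint_sum (I : eqType) (s : seq I) (F : I -> T -> R) :
  (forall i, i \in s -> bmf (F i)) ->
  \int[mu]_(x in D) (\sum_(i <- s) F i x) = \sum_(i <- s) \int[mu]_(x in D) F i x.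
Proof.
elim: s => [_|i s ih h].
  rewrite big_nil; under eq_Rintegral do rewrite big_nil.
  by rewrite bint_cst mul0r.
rewrite big_cons -ih => [|j js]; last by apply: h; rewrite in_cons js orbT.
rewrite -bintD; first by apply: eq_Rintegral => x _; rewrite big_cons.
  by apply: h; rewrite mem_head.
by apply: bmf_sum => j js; apply: h; rewrite in_cons js orbT.
Qed.

Lemma bint_norm_le f (C : R) : bmf f -> (forall x, D x -> `|f x| <= C) ->
  `|\int[mu]_(x in D) f x| <= C * fine (mu D).
Proof.
move=> bf fC; apply: le_trans (le_normr_Rintegral _ (bmf_integrable bf)) _ => //.
by rewrite -bint_cst; apply: bint_le => //; [exact: bmf_norm|exact: bmf_cst].
Qed.

Lemma bint_dist_le f g (C : R) : bmf f -> bmf g ->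
  (forall x, D x -> `|f x - g x| <= C) ->
  `|\int[mu]_(x in D) f x - \int[mu]_(x in D) g x| <= C * fine (mu D).
Proof. by move=> bf bg h; rewrite -bintB//; apply: bint_norm_le => //; exact: bmfB. Qed.

End bounded_integral.

Section bounded_fubini.
Context d1 d2 (T1 : measurableType d1) (T2 : measurableType d2) (R : realType).
Variable m1 : {sigma_finite_measure set T1 -> \bar R}.
Variable m2 : {sigma_finite_measure set T2 -> \bar R}.
Variables (D1 : set T1) (D2 : set T2).
Hypotheses (mD1 : measurable D1) (mD2 : measurable D2).
Hypotheses (finD1 : (m1 D1 < +oo)%E) (finD2 : (m2 D2 < +oo)%E).

Lemma bmf_sec1 (f : T1 * T2 -> R) x : bmf f -> bmf (fun y => f (x, y)).
Proof. by move=> bf; apply: (bmf_comp (h := fun y => (x, y)) bf); exact: pair1_measurable. Qed.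

Lemma bmf_sec2 (f : T1 * T2 -> R) y : bmf f -> bmf (fun x => f (x, y)).
Proof. by move=> bf; apply: (bmf_comp (h := fun x => (x, y)) bf); exact: pair2_measurable. Qed.

(** [Fubini] integrates over the full product; the two indicators bring integrals over [D1] and [D2]
    to that form. *)
Let restr (f : T1 * T2 -> R) := fun p => (\1_D1 p.1 * \1_D2 p.2 * f p).

Let restr_integrable f : bmf f ->
  (m1 \x m2)%E.-integrable setT (EFin \o restr f).
Proof.
move=> bf; have mD : measurable (D1 `*` D2) by exact: measurableX.
have fD : ((m1 \x m2)%E (D1 `*` D2) < +oo)%E.
  by rewrite product_measure1E// lte_mul_pinfty// ge0_fin_numE.
have /(integrable_mkcond _ mD) := bmf_integrable (mu := (m1 \x m2)%E) mD fD bf.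
apply: eq_integrable => // -[x y] _; rewrite patchE /restr /= !indicE in_setX/=.
by case: (x \in D1); case: (y \in D2); rewrite /= ?mul0r ?mulr0 ?mul1r ?mul0r.
Qed.

Let restrF f x : \int[m2]_(y in D2) f (x, y) * \1_D1 x = \int[m2]_y restr f (x, y).
Proof.
rewrite (Rintegral_mkcond m2 D2) /restr /=.
have [xD|xD] := boolP (x \in D1); rewrite indicE ?xD ?(negbTE xD) /=.
  rewrite mulr1; apply: eq_Rintegral => y _; rewrite patchE indicE.
  by case: ifPn => yD; rewrite ?mul1r ?mul0r.
rewrite mulr0; under eq_Rintegral do rewrite !mul0r.
by rewrite /Rintegral integral0.
Qed.

Let restrG f y : \int[m1]_(x in D1) f (x, y) * \1_D2 y = \int[m1]_x restr f (x, y).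
Proof.
rewrite (Rintegral_mkcond m1 D1) /restr /=.
have [yD|yD] := boolP (y \in D2); rewrite indicE ?yD ?(negbTE yD) /=.
  rewrite mulr1; apply: eq_Rintegral => x _; rewrite patchE indicE.
  by case: ifPn => xD; rewrite ?mul1r ?mul0r ?mulr1.
rewrite mulr0; under eq_Rintegral do rewrite mulr0 !mul0r.
by rewrite /Rintegral integral0.
Qed.

(** Tonelli gives the measurability of partial integrals of nonnegative functions; it is applied to
    the positive and negative parts separately. *)
Lemma bmf_int2 (f : T1 * T2 -> R) : bmf f -> bmf (fun x => \int[m2]_(y in D2) f (x, y)).
Proof.
move=> bf; have [mf [C hC]] := bf; split.
  have mf' : measurable_fun setT (fun p : T1 * T2 => f p * \1_D2 p.2).
    apply: measurable_funM => //.
    by apply: measurableT_comp; [exact: measurable_indic|exact: measurable_snd].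
  have -> : (fun x => \int[m2]_(y in D2) f (x, y)) =
    (fun x => fine (\int[m2]_y (fun p : T1 * T2 => (f p * \1_D2 p.2)%:E)^\+ (x, y)
      - \int[m2]_y (fun p : T1 * T2 => (f p * \1_D2 p.2)%:E)^\- (x, y))%E).
    apply/funext => x; rewrite Rintegral_mkcond /Rintegral.
    congr fine; rewrite integralE; congr (_ - _)%E.
      apply: eq_integral => y _; rewrite !funeposE; congr maxe.
      by rewrite patchE/= indicE; case: ifPn => _; rewrite ?mulr1 ?mulr0.
    apply: eq_integral => y _; rewrite !funenegE; congr (maxe (- _)%E _).
    by rewrite patchE/= indicE; case: ifPn => _; rewrite ?mulr1 ?mulr0.
  apply: measurableT_comp => //; apply: emeasurable_funB.
    by apply: measurable_fun_fubini_tonelli_F => //; apply: measurable_funepos;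
      exact/measurable_EFinP.
  by apply: measurable_fun_fubini_tonelli_F => //; apply: measurable_funeneg;
    exact/measurable_EFinP.
exists (C * fine (m2 D2)) => x; apply: bint_norm_le => //.
exact: bmf_sec1.
Qed.

Lemma bmf_int1 (f : T1 * T2 -> R) : bmf f -> bmf (fun y => \int[m1]_(x in D1) f (x, y)).
Proof.
move=> bf; have [mf [C hC]] := bf; split.
  have mf' : measurable_fun setT (fun p : T1 * T2 => f p * \1_D1 p.1).
    apply: measurable_funM => //.
    by apply: measurableT_comp; [exact: measurable_indic|exact: measurable_fst].
  have -> : (fun y => \int[m1]_(x in D1) f (x, y)) =
    (fun y => fine (\int[m1]_x (fun p : T1 * T2 => (f p * \1_D1 p.1)%:E)^\+ (x, y)
      - \int[m1]_x (fun p : T1 * T2 => (f p * \1_D1 p.1)%:E)^\- (x, y))%E).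
    apply/funext => y; rewrite Rintegral_mkcond /Rintegral.
    congr fine; rewrite integralE; congr (_ - _)%E.
      apply: eq_integral => x _; rewrite !funeposE; congr maxe.
      by rewrite patchE/= indicE; case: ifPn => _; rewrite ?mulr1 ?mulr0.
    apply: eq_integral => x _; rewrite !funenegE; congr (maxe (- _)%E _).
    by rewrite patchE/= indicE; case: ifPn => _; rewrite ?mulr1 ?mulr0.
  apply: measurableT_comp => //; apply: emeasurable_funB.
    by apply: measurable_fun_fubini_tonelli_G => //; apply: measurable_funepos;
      exact/measurable_EFinP.
  by apply: measurable_fun_fubini_tonelli_G => //; apply: measurable_funeneg;
    exact/measurable_EFinP.
exists (C * fine (m1 D1)) => x; apply: bint_norm_le => //.
exact: bmf_sec2.
Qed.

Lemma bfubini (f : T1 * T2 -> R) : bmf f ->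
  \int[m1]_(x in D1) \int[m2]_(y in D2) f (x, y) =
  \int[m2]_(y in D2) \int[m1]_(x in D1) f (x, y).
Proof.
move=> bf.
have -> : \int[m1]_(x in D1) \int[m2]_(y in D2) f (x, y) =
          \int[m1]_x \int[m2]_y restr f (x, y).
  rewrite Rintegral_mkcond; apply: eq_Rintegral => x _; rewrite -restrF patchE indicE.
  by case: ifPn => _; rewrite ?mulr1 ?mulr0.
have -> : \int[m2]_(y in D2) \int[m1]_(x in D1) f (x, y) =
          \int[m2]_y \int[m1]_x restr f (x, y).
  rewrite Rintegral_mkcond; apply: eq_Rintegral => y _; rewrite -restrG patchE indicE.
  by case: ifPn => _; rewrite ?mulr1 ?mulr0.
(* [Fubini] equates extended reals while the inner integrals here are real: each must be seen to be
   finite before [fine] can move outside. *)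
have E1 x : (\int[m2]_y restr f (x, y))%:E = (\int[m2]_y (restr f (x, y))%:E)%E.
  rewrite -restrF EFinM -bmf_EFin_int//; last exact: bmf_sec1.
  rewrite (integral_mkcond D2) /restr /=.
  have [xD|xD] := boolP (x \in D1); rewrite indicE ?xD ?(negbTE xD) /=.
    rewrite mule1; apply: eq_integral => y _; rewrite patchE indicE.
    by case: ifPn => yD; rewrite ?mul1r ?mul0r.
  by rewrite mule0; under eq_integral do rewrite !mul0r; rewrite integral0.
have E2 y : (\int[m1]_x restr f (x, y))%:E = (\int[m1]_x (restr f (x, y))%:E)%E.
  rewrite -restrG EFinM -bmf_EFin_int//; last exact: bmf_sec2.
  rewrite (integral_mkcond D1) /restr /=.
  have [yD|yD] := boolP (y \in D2); rewrite indicE ?yD ?(negbTE yD) /=.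
    rewrite mule1; apply: eq_integral => x _; rewrite patchE indicE.
    by case: ifPn => xD; rewrite ?mul1r ?mul0r ?mulr1.
  by rewrite mule0; under eq_integral do rewrite !(mulr0, mul0r); rewrite integral0.
rewrite /Rintegral; congr fine.
under eq_integral do rewrite E1.
under [RHS]eq_integral do rewrite E2.
exact: (Fubini (restr_integrable bf)).
Qed.

End bounded_fubini.

(** * Comparison of integrals without measurability, and null sets of products *)

Section inner_integral.
Context d (T : measurableType d) (R : realType).
Variable mu : {measure set T -> \bar R}.
Local Open Scope ereal_scope.
Import HBNNSimple.

(* The integral of a nonnegative function is the supremum of the integrals of the
   simple functions below it, so its monotonicity needs no measurability. *)
Lemma ae_le_ge0_integralT (f g : T -> \bar R) :
  (forall x, 0 <= f x) -> (forall x, 0 <= g x) ->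
  {ae mu, forall x, f x <= g x} -> \int[mu]_x f x <= \int[mu]_x g x.
Proof.
move=> f0 g0 [N [mN N0 hN]]; rewrite ge0_integralTE// ge0_integralTE//.
apply: ge_ereal_sup => _ [h hf <-].
have mNC : measurable (~` N) by exact: measurableC.
apply: (@le_trans _ _ (sintegral mu (proj_nnsfun h mNC))).
  have neg (k : {nnsfun T >-> R}) :
      \int[mu]_x (k x)%:E = \int[mu]_(x in setT `\` N) (k x)%:E.
    apply: ge0_negligible_integral => //.
      by apply/measurable_EFinP; exact: measurable_funPT.
    by move=> x _; rewrite lee_fin.
  rewrite -!integralT_nnsfun !neg.
  rewrite le_eqVlt; apply/orP; left; apply/eqP; apply: eq_integral => x.
  by rewrite setTD inE => xN; rewrite -[in RHS]mrestrict patchE (mem_set xN).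
suff H x : ((proj_nnsfun h mNC x)%:E <= g x)%E.
  by apply: ereal_sup_ubound; exists (proj_nnsfun h mNC).
rewrite -mrestrict patchE.
case: ifPn => [|_]; last exact: g0.
rewrite inE => xN; apply: le_trans (hf x) _.
by apply: contrapT => nfg; apply: xN; apply: hN.
Qed.

Lemma ae_le_ge0_integral (D : set T) (f g : T -> \bar R) :
  (forall x, D x -> 0 <= f x) -> (forall x, D x -> 0 <= g x) ->
  {ae mu, forall x, D x -> f x <= g x} ->
  \int[mu]_(x in D) f x <= \int[mu]_(x in D) g x.
Proof.
move=> f0 g0 fg.
rewrite [leLHS]integral_mkcond [leRHS]integral_mkcond.
apply: ae_le_ge0_integralT => [x|x|].
- by rewrite patchE; case: ifPn => // /set_mem; exact: f0.
- by rewrite patchE; case: ifPn => // /set_mem; exact: g0.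
by apply: filterS fg => x h; rewrite !patchE; case: ifPn => // /set_mem.
Qed.

Lemma ae_eq_ge0_integral (D : set T) (f g : T -> \bar R) :
  (forall x, D x -> 0 <= f x) -> (forall x, D x -> 0 <= g x) ->
  {ae mu, forall x, D x -> f x = g x} ->
  \int[mu]_(x in D) f x = \int[mu]_(x in D) g x.
Proof.
move=> f0 g0 fg; apply/eqP; rewrite eq_le; apply/andP; split.
  by apply: ae_le_ge0_integral => //; apply: filterS fg => x h /h ->.
by apply: ae_le_ge0_integral => //; apply: filterS fg => x h /h ->.
Qed.

(** Meant for integrands whose measurability is unknown, such as the velocity, its divergence or the
    damping read along a trajectory: these equal Borel functions only for almost every time. *)
Lemma ae_eq_integral_any (D : set T) (f g : T -> \bar R) :
  {ae mu, forall x, D x -> f x = g x} ->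
  \int[mu]_(x in D) f x = \int[mu]_(x in D) g x.
Proof.
move=> fg; rewrite integralE [RHS]integralE.
congr (_ - _); apply: ae_eq_ge0_integral => //.
- by apply: filterS fg => x h /h e; rewrite !funeposE e.
- by apply: filterS fg => x h /h e; rewrite !funenegE e.
Qed.

Lemma ae_eq_Rintegral (D : set T) (f g : T -> R) :
  {ae mu, forall x, D x -> f x = g x} ->
  (\int[mu]_(x in D) f x = \int[mu]_(x in D) g x)%R.
Proof.
move=> fg; congr fine; apply: ae_eq_integral_any.
by apply: filterS fg => x h /h ->.
Qed.

End inner_integral.

Section product_null_sets.
Context d1 d2 (T1 : measurableType d1) (T2 : measurableType d2) (R : realType).
Variable m1 : {sigma_finite_measure set T1 -> \bar R}.
Variable m2 : {sigma_finite_measure set T2 -> \bar R}.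
Local Open Scope ereal_scope.

Lemma ae_prod1 (P : T1 * T2 -> Prop) : {ae m1 \x m2, forall p, P p} ->
  {ae m1, forall x, {ae m2, forall y, P (x, y)}}.
Proof.
move=> [N [mN N0 hN]].
have [+ _] := ae_eq_integral_abs m1 measurableT
  (measurable_fun_xsection m2 mN).
have <- : (m1 \x m2) N = \int[m1]_x `|(m2 \o xsection N) x|.
  by apply: eq_integral => x _; rewrite gee0_abs.
move=> /(_ N0) h.
apply: filterS h => x /(_ Logic.I) h.
exists (xsection N x); split => //; first exact: measurable_xsection.
by move=> y /= nP; rewrite /xsection /= inE; apply: hN.
Qed.

Lemma ae_prod2 (P : T1 * T2 -> Prop) : {ae m1 \x m2, forall p, P p} ->
  {ae m2, forall y, {ae m1, forall x, P (x, y)}}.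
Proof.
move=> [N [mN N0 hN]].
have [+ _] := ae_eq_integral_abs m2 measurableT
  (measurable_fun_ysection m1 mN).
have <- : (m1 \x m2) N = \int[m2]_x `|(m1 \o ysection N) x|.
  (* [m1 \x m2] integrates the measures of the x-sections; Tonelli for the indicator of [N]
     exchanges them with the y-sections. *)
  transitivity ((m1 \x^ m2) N); last first.
    by apply: eq_integral => x _; rewrite gee0_abs.
  have := indic_fubini_tonelli m1 m2 mN.
  rewrite (_ : fubini_F _ _ = m2 \o xsection N); last exact: indic_fubini_tonelli_FE.
  rewrite (_ : fubini_G _ _ = m1 \o ysection N); last exact: indic_fubini_tonelli_GE.
  by move=> e; rewrite /product_measure1 /product_measure2.
move=> /(_ N0) h.
apply: filterS h => y /(_ Logic.I) h.
exists (ysection N y); split => //; first exact: measurable_ysection.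
by move=> x /= nP; rewrite /ysection /= inE; apply: hN.
Qed.

Lemma prod_null (N : set (T1 * T2)) : measurable N ->
  {ae m1, forall x, m2 (xsection N x) = 0} -> (m1 \x m2) N = 0.
Proof.
move=> mN h; rewrite /product_measure1 /=.
rewrite (@ae_eq_ge0_integral _ _ _ m1 _ _ (cst 0))// ?integral0//.
by apply: filterS h => x h _.
Qed.

End product_null_sets.

Section glue.
Context d1 d2 (T1 : measurableType d1) (T2 : measurableType d2).

Lemma measurable_fun_glue (C : nat -> set T1) (h : nat -> T1 -> T2) (f : T1 -> T2) :
  (forall k, measurable (C k)) -> \bigcup_k C k = setT ->
  (forall k, measurable_fun setT (h k)) ->
  (forall k x, C k x -> f x = h k x) -> measurable_fun setT f.
Proof.
move=> mC CT mh fh _ B mB; rewrite setTI.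
rewrite (_ : f @^-1` B = \bigcup_k (C k `&` h k @^-1` B)).
  apply: bigcupT_measurable => k; apply: measurableI => //.
  by rewrite -[X in measurable X]setTI; exact: mh.
apply/seteqP; split => [x Bx|x [k _ [Cx hB]]]; last by rewrite /preimage/= (fh _ _ Cx).
have [k _ Ckx] : (\bigcup_k C k) x by rewrite CT.
by exists k => //; split => //; rewrite /preimage /= -(fh _ _ Ckx).
Qed.

End glue.

(** * Lebesgue measure and measurability on R^n *)

Section rV_topology.
Context {R : realType} {m : nat}.
Implicit Types (x y v : 'rV[R]_m) (U : set 'rV[R]_m).

Lemma rV_coord_le x i : `|x ord0 i| <= `|x|.
Proof. by rewrite [leRHS]/Num.Def.normr /= mx_normrE; apply: (le_bigmax _ (fun ij => `|x ij.1 ij.2|) (ord0, i)). Qed.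

Lemma rV_norm_le x (c : R) : 0 <= c -> (forall i, `|x ord0 i| <= c) -> `|x| <= c.
Proof.
move=> c0 h; rewrite [leLHS]/Num.Def.normr /= mx_normrE; apply: bigmax_le => // -[i j] _ /=.
by rewrite (ord1 i).
Qed.

Lemma rV_norm_lt x (c : R) : 0 < c -> (forall i, `|x ord0 i| < c) -> `|x| < c.
Proof.
move=> c0 h; rewrite [ltLHS]/Num.Def.normr /= mx_normrE; apply: bigmax_lt => // -[i j] _ /=.
by rewrite (ord1 i).
Qed.

Lemma open_ballP U : open U <->
  forall x, U x -> exists2 e : R, 0 < e & forall y, `|y - x| < e -> U y.
Proof.
split=> [oU x Ux|h].
  have /nbhs_ballP[e /= e0 he] : nbhs x U by exact: open_nbhs_nbhs.
  exists e => // y yx; apply: he.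
  by rewrite mx_norm_ball /ball_ /= distrC.
rewrite openE => x Ux; have [e e0 he] := h x Ux.
apply/nbhs_ballP; exists e => //= y; rewrite mx_norm_ball /ball_ /= distrC; exact: he.
Qed.

Lemma measurable_rVball x (r : R) : measurable [set y : 'rV[R]_m | `|y - x| < r].
Proof.
have [r0|r0] := ltP 0 r; last first.
  rewrite (_ : [set y | _] = set0)//; apply/seteqP; split=> // y /= yr.
  by have := lt_le_trans yr r0; rewrite normr_lt0.
rewrite (_ : [set y | _] =
  \bigcap_(i in [set: 'I_m]) (fun v : 'rV[R]_m => v ord0 i) @^-1` [set z | `|z - x ord0 i| < r]).
  apply: fin_bigcap_measurable => [|i _]; first exact: finite_finset.
  rewrite -[X in measurable X]setTI; apply: (@measurable_coord _ R m i measurableT).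
  apply: open_measurable; rewrite (_ : [set z | _] = ball (x ord0 i) r).
    exact: ball_open.
  by apply/seteqP; split => z /=; rewrite /ball /= distrC.
apply/seteqP; split=> y /= h.
  move=> i _ /=; apply: le_lt_trans h.
  by have := rV_coord_le (y - x) i; rewrite !mxE.
by apply: rV_norm_lt => // i; rewrite !mxE; exact: h.
Qed.

Definition rat_rV (q : 'rV[rat]_m) : 'rV[R]_m := map_mx ratr q.

Lemma rat_rV_dense x (e : R) : 0 < e -> exists q, `|x - rat_rV q| < e.
Proof.
move=> e0.
have h i : exists q : rat, `|x ord0 i - ratr q| < e.
  have xe : x ord0 i - e < x ord0 i + e by lra.
  have [q] := rat_in_itvoo xe.
  rewrite in_itv /= => /andP[h1 h2]; exists q.
  by rewrite ltr_norml; apply/andP; split; lra.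
have /choice[q hq] := h; exists (\row_i q i).
by apply: rV_norm_lt => // i; rewrite !mxE.
Qed.

(** A countable base of the topology. It makes open sets measurable for the sigma-algebra generated
    by the coordinates, and later replaces uncountable unions of open sets by countable ones. *)
Lemma open_rat_balls U : open U -> U = \bigcup_(p in [set p : 'rV[rat]_m * nat |
     [set y | `|y - rat_rV p.1| < p.2.+1%:R^-1] `<=` U])
   [set y | `|y - rat_rV p.1| < p.2.+1%:R^-1].
Proof.
move=> /open_ballP oU; apply/seteqP; split=> [x Ux|x [p pU px]]; last exact: pU.
have [e e0 he] := oU x Ux.
have e20 : 0 < e / 2 by rewrite divr_gt0.
have [k hk] : exists k : nat, k.+1%:R^-1 < e / 2.
  exists (Num.truncn (e / 2)^-1).
  rewrite invf_plt ?posrE//; exact: truncnS_gt.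
have k0 : 0 < k.+1%:R^-1 :> R by rewrite invr_gt0.
have [q hq] := rat_rV_dense x k0.
exists (q, k) => //= y /= yq; apply: he.
have -> : y - x = (y - rat_rV q) - (x - rat_rV q) by rewrite opprB addrA subrK.
apply: le_lt_trans (ler_normB _ _) _.
by rewrite (splitr e) ltrD// (lt_trans _ hk).
Qed.

Lemma open_measurable_rV U : open U -> measurable U.
Proof.
move=> oU; rewrite (open_rat_balls oU); rewrite bigcup_mkcond.
apply: countable_bigcupT_measurable => [|p]; first exact: countableP.
by case: ifPn => _ //; exact: measurable_rVball.
Qed.

End rV_topology.

Section image_measure.
Context d d' (T1 : measurableType d) (T2 : measurableType d') (R : realType).
Variables (mu : {measure set T1 -> \bar R}) (f : T1 -> T2).
Hypothesis mf : measurable_fun [set: T1] f.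

(** Bundled as a measure, and closed with [Defined] so that [image_measureE] holds by
    computation. *)
Definition image_measure : {measure set T2 -> \bar R}.
Proof. by refine (pushforward mu f : {measure set T2 -> \bar R}); exact: mf. Defined.

Lemma image_measureE A : image_measure A = mu (f @^-1` A).
Proof. by []. Qed.

Lemma ge0_integral_image (g : T2 -> \bar R) : measurable_fun setT g ->
  (forall y, (0 <= g y)%E) -> (\int[image_measure]_y g y = \int[mu]_x g (f x))%E.
Proof.
move=> mg g0; rewrite (_ : (\int[mu]_x g (f x) = \int[mu]_(x in f @^-1` setT) (g \o f) x)%E);
  last by rewrite preimage_setT.
by apply: ge0_integral_pushforward.
Qed.

End image_measure.

Section lebesgue_translation.
Context {R : realType}.
Local Open Scope ereal_scope.

(** Lebesgue measure is the only measure giving each half-open interval its length, and the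
    translated measure does so. *)
Lemma lebesgue_translate (a : R) (A : set (measurableTypeR R)) : measurable A ->
  lebesgue_measure ((fun x : measurableTypeR R => (x + a)%R : measurableTypeR R) @^-1` A)
    = lebesgue_measure A.
Proof.
move=> mA.
have mf : measurable_fun setT (fun x : measurableTypeR R => (x + a)%R : measurableTypeR R).
  by apply: measurable_funD => //; exact: measurable_cst.
rewrite -(image_measureE lebesgue_measure mf); apply/esym.
apply: lebesgue_measure_unique => // _ [[b c]] _ <-.
rewrite image_measureE /=.
have -> : (fun x : R => (x + a)%R) @^-1` `]b, c]%classic = `]b - a, c - a]%classic%R.
  by apply/seteqP; split=> x /=; rewrite !in_itv /= ltrBlDr lerBrDr.
rewrite !lebesgue_measure_itv /= !lte_fin ltrD2r.
by rewrite -!EFinB opprB addrA subrK.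
Qed.

Lemma measurable_translate_rV n (z : 'rV[R]_n) :
  measurable_fun setT (fun y : 'rV[R]_n => (y + z)%R).
Proof.
apply/measurable_fun_coordP => i; under eq_fun do rewrite mxE.
by apply: measurable_funD; [exact: measurable_coord|exact: measurable_cst].
Qed.

Lemma lebesgue_rV_translate n (z : 'rV[R]_n) A : measurable A ->
  lebesgue_rV n ((fun y : 'rV[R]_n => (y + z)%R) @^-1` A) = lebesgue_rV n A.
Proof.
elim: n z A => [|n ih] z A mA.
  by rewrite (_ : (fun y => _) = id) ?preimage_id//; apply/funext => y; apply/rowP; case.
rewrite /= /lebesgue_rV_step /pushforward.
pose a := z ord0 ord0; pose w : 'rV[R]_n := (\row_j z ord0 (lift ord0 j))%R.
pose f (p : measurableTypeR R * 'rV[R]_n) : measurableTypeR R * 'rV[R]_n :=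
  ((p.1 + a)%R, (p.2 + w)%R).
have mf : measurable_fun setT f.
  apply/measurable_fun_pairP; split.
    by apply: measurable_funD; [exact: measurable_fst|exact: measurable_cst].
  by apply: (measurableT_comp (measurable_translate_rV w)); exact: measurable_snd.
have -> : @cons_rV R n @^-1` ((fun y : 'rV[R]_n.+1 => (y + z)%R) @^-1` A) =
          f @^-1` (@cons_rV R n @^-1` A).
  suff e p : (@cons_rV R n p + z)%R = cons_rV (f p).
    by apply/seteqP; split=> p /=; rewrite /preimage /= e.
  apply/rowP => i; rewrite !mxE.
  by case: unliftP => [j ->|->]; rewrite /f /w /a /= ?mxE.
(* On (first coordinate, remaining ones) the translation acts on each factor, so it suffices to
   compare rectangles, where dimension 1 and the induction hypothesis apply. *)
rewrite -(image_measureE _ mf); apply/esym; apply: product_measure_unique; last first.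
  by rewrite -[X in measurable X]setTI; exact: measurable_cons_rV.
move=> B C mB mC; rewrite image_measureE.
rewrite (_ : f @^-1` (B `*` C) =
  ((fun x : measurableTypeR R => (x + a)%R : measurableTypeR R) @^-1` B) `*`
  ((fun y : 'rV[R]_n => (y + w)%R) @^-1` C)); last by apply/seteqP; split => -[].
have mB' : measurable ((fun x : measurableTypeR R => (x + a)%R : measurableTypeR R) @^-1` B).
  rewrite -[X in measurable X]setTI.
  by apply: measurable_funD => //; exact: measurable_cst.
have mC' : measurable ((fun y : 'rV[R]_n => (y + w)%R) @^-1` C).
  by rewrite -[X in measurable X]setTI; exact: measurable_translate_rV.
apply: etrans (product_measure1E _ _ mB' mC') _.
by congr (_ * _); [exact: lebesgue_translate|exact: ih].
Qed.

Lemma rVballE n (x : 'rV[R]_n) (r : R) : (0 < r)%R ->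
  [set y | (`|y - x| < r)%R] =
  [set v : 'rV[R]_n | forall i, `](x ord0 i - r)%R, (x ord0 i + r)%R[%classic (v ord0 i)].
Proof.
move=> r0; apply/seteqP; split=> y /= h.
  move=> i; rewrite /= in_itv /= -ltr_distl.
  by apply: le_lt_trans h; have := rV_coord_le (y - x) i; rewrite !mxE.
apply: rV_norm_lt => // i; rewrite !mxE.
by have := h i; rewrite /= in_itv /= -ltr_distl.
Qed.

Lemma lebesgue_rVball n (x : 'rV[R]_n) (r : R) : (0 < r)%R ->
  lebesgue_rV n [set y | (`|y - x| < r)%R] = (((2 * r) ^+ n)%R)%:E.
Proof.
move=> r0; rewrite rVballE//.
rewrite (@lebesgue_rV_box R n (fun i => `](x ord0 i - r)%R, (x ord0 i + r)%R[%classic)).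
  rewrite (eq_bigr (fun=> ((2 * r)%R)%:E)) => [|i _].
    by rewrite prodEFin prodr_const card_ord.
  rewrite lebesgue_measure_itv /= lte_fin ifT; last by lra.
  by rewrite -EFinB; congr EFin; ring.
by move=> i; exact: measurable_itv.
Qed.

Lemma lebesgue_rV_bounded n (A : set 'rV[R]_n) : measurable A -> bounded_set A ->
  lebesgue_rV n A < +oo.
Proof.
move=> mA [M [Mr hM]].
pose r := (`|M| + 2)%R.
have r0 : (0 < r)%R by rewrite /r ltr_wpDl.
apply: (@le_lt_trans _ _ (lebesgue_rV n [set y | (`|y - 0| < r)%R])).
  apply: le_measure; rewrite ?inE//; first exact: measurable_rVball.
  move=> y Ay /=; rewrite subr0; apply: (@le_lt_trans _ _ (`|M| + 1)%R).
    by apply: hM => //; rewrite ltr_pwDr// ler_norm.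
  by rewrite /r ltrD2l ltr1n.
by rewrite lebesgue_rVball// ltry.
Qed.

(** [D1] and [D2] only have to contain the supports of the two integrands, so both integrals extend
    to the whole space. This lets a mollified integral move between [Omega] and the ball of the
    mollifier. *)
Lemma bint_translate n (F : 'rV[R]_n -> R) (D1 D2 : set 'rV[R]_n) (z : 'rV[R]_n) :
  measurable_fun setT F ->
  (forall y, F y != 0%R -> D1 y) -> (forall y, F (y + z)%R != 0%R -> D2 y) ->
  (\int[lebesgue_rV n]_(y in D2) F (y + z) = \int[lebesgue_rV n]_(y in D1) F y)%R.
Proof.
move=> mF h1 h2; rewrite Rintegral_mkcond [RHS]Rintegral_mkcond.
have -> : F \_ D1 = F.
  apply/funext => y; rewrite patchE; case: ifPn => // /negP yD.
  by apply/eqP; rewrite eq_sym; apply: contra_notT yD => /h1/mem_set.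
have -> : (fun y => F (y + z)%R) \_ D2 = (fun y => F (y + z)%R).
  apply/funext => y; rewrite patchE; case: ifPn => // /negP yD.
  by apply/eqP; rewrite eq_sym; apply: contra_notT yD => /h2/mem_set.
have key (G : 'rV[R]_n -> \bar R) : measurable_fun setT G -> (forall y, 0 <= G y) ->
    \int[lebesgue_rV n]_y G (y + z)%R = \int[lebesgue_rV n]_y G y.
  move=> mG G0; rewrite -(ge0_integral_image _ (measurable_translate_rV z) mG G0).
  apply: eq_measure_integral => A mA _.
  exact: lebesgue_rV_translate.
rewrite /Rintegral; congr fine; rewrite integralE [RHS]integralE.
congr (_ - _).
  rewrite -(key (fun y => (F y)%:E)^\+)//.
    by apply: eq_integral => y _; rewrite !funeposE.
  by apply: measurable_funepos; exact/measurable_EFinP.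
rewrite -(key (fun y => (F y)%:E)^\-)//.
  by apply: eq_integral => y _; rewrite !funenegE.
by apply: measurable_funeneg; exact/measurable_EFinP.
Qed.

End lebesgue_translation.

Section rV_measurability.
Context {R : realType} {m : nat}.

(** The sigma-algebra is generated by coordinates; the monotone class argument needs it generated by
    a family stable under intersection, here the open sets. *)
Lemma measurable_rVE : @measurable _ 'rV[R]_m = <<s [set U : set 'rV[R]_m | open U] >>.
Proof.
apply/seteqP; split; last first.
  by apply: smallest_sub; [exact: sigma_algebra_measurable|exact: open_measurable_rV].
pose T' := g_sigma_algebraType [set U : set 'rV[R]_m | open U].
have mid : measurable_fun setT (fun x : T' => (x : 'rV[R]_m)).
  apply/(@measurable_fun_coordP _ _ T' R m (fun x : T' => (x : 'rV[R]_m))) => i.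
  apply: (measurability _ (RGenOInfty.measurableE R)).
  move=> _ [_ [a ->] <-]; rewrite setTI; apply: sub_sigma_algebra => /=.
  apply/open_ballP => x /=; rewrite in_itv /= andbT => ax.
  exists (x ord0 i - a); first by rewrite subr_gt0.
  move=> y yx; rewrite in_itv /= andbT.
  have := le_lt_trans (rV_coord_le (y - x) i) yx.
  by rewrite !mxE ltr_distl => /andP[]; lra.
by move=> A mA; have := mid measurableT A mA; rewrite setTI.
Qed.

Lemma measurable_fun_continuous_on (Omega : set 'rV[R]_m) (f : 'rV[R]_m -> R) :
  open Omega -> {in Omega, continuous f} -> measurable_fun Omega f.
Proof.
move=> oO cf; apply: (measurability _ (RGenOInfty.measurableE R)).
move=> _ [_ [a ->] <-]; apply: open_measurable_rV.
rewrite openE => x [Ox /= fx].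
have /cf cfx : x \in Omega by rewrite inE.
apply: filterI; first exact: open_nbhs_nbhs.
by apply: cfx; apply: open_nbhs_nbhs; split.
Qed.

End rV_measurability.

Section epsilon_delta.
Context {R : realType} {V W : normedModType R}.
Implicit Types (f : V -> W) (A : set V).

Lemma cvg_withinP f A x : f @ within A (nbhs x) --> f x <->
  forall e, 0 < e -> exists2 d : R, 0 < d &
    forall y, A y -> `|y - x| < d -> `|f y - f x| < e.
Proof.
split=> [/cvgrPdist_lt cf e e0|h].
  have := cf _ e0; rewrite near_withinE => /nbhs_ballP[d /= d0 hd]; exists d => // y Ay yx.
  rewrite distrC; apply: hd => //.
  by rewrite -ball_normE /= distrC.
apply/cvgrPdist_lt => e e0; rewrite near_withinE.
have [d d0 hd] := h e e0; apply/nbhs_ballP; exists d => //= y yx Ay.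
by rewrite distrC; apply: hd => //; move: yx; rewrite -ball_normE /= distrC.
Qed.

Lemma cvg_distP f x : f @ x --> f x <->
  forall e, 0 < e -> exists2 d : R, 0 < d &
    forall y, `|y - x| < d -> `|f y - f x| < e.
Proof.
split=> [/cvgrPdist_lt cf e e0|h].
  have /nbhs_ballP[d /= d0 hd] := cf _ e0; exists d => // y yx.
  rewrite distrC; apply: hd => //.
  by rewrite -ball_normE /= distrC.
apply/cvgrPdist_lt => e e0.
have [d d0 hd] := h e e0; apply/nbhs_ballP; exists d => //= y yx.
by rewrite distrC; apply: hd => //; move: yx; rewrite -ball_normE /= distrC.
Qed.

Lemma within_continuous_distP f A : {within A, continuous f} <->
  forall x, A x -> forall e, 0 < e -> exists2 d : R, 0 < d &
    forall y, A y -> `|y - x| < d -> `|f y - f x| < e.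
Proof.
rewrite subspace_continuousP; split => h x Ax; first exact/cvg_withinP/h.
exact/cvg_withinP/h.
Qed.

End epsilon_delta.

Section caratheodory.
Context d (T : measurableType d) {R : realType} {m : nat}.
Variables (Omega : set 'rV[R]_m) (oO : open Omega) (q : nat -> 'rV[R]_m).
Hypothesis q_dense : forall x, Omega x -> forall e : R, 0 < e -> exists k, `|x - q k| < e.

(** Slot 0 is the complement of [Omega], where the product with the indicator is 0; slot k+1 holds
    the points of [Omega] within [e] of [q k]. Passing to [seqDU] makes the slots disjoint, so that
    each point has one index. *)
Let B (e : R) (k : nat) : set 'rV[R]_m :=
  if k is k'.+1 then Omega `&` [set x | `|x - q k'| < e] else ~` Omega.

Let mB e k : measurable (B e k).
Proof.
case: k => [|k] /=; first by apply: measurableC; exact: open_measurable_rV.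
by apply: measurableI; [exact: open_measurable_rV|exact: measurable_rVball].
Qed.

Let coverB e : 0 < e -> forall x, exists k, seqDU (B e) k x.
Proof.
move=> e0 x; suff : (\bigcup_k seqDU (B e) k) x by move=> [k _ h]; exists k.
rewrite -seqDU_bigcup_eq; have [Ox|nOx] := pselect (Omega x); last by exists 0%N.
by have [k hk] := q_dense Ox e0; exists k.+1.
Qed.

(* f is approximated by its values at the points of a dense sequence. *)
Lemma measurable_fun_caratheodory (f : T -> 'rV[R]_m -> R) :
  (forall k, measurable_fun setT (f ^~ (q k))) ->
  (forall s, {in Omega, continuous (f s)}) ->
  measurable_fun setT (fun p : T * 'rV[R]_m => f p.1 p.2 * \1_Omega p.2).
Proof.
move=> mf cf; have e0 n : 0 < n.+1%:R^-1 :> R by rewrite invr_gt0.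
pose idx n x : nat := sval (cid (coverB (e0 n) x)).
have idxP n x : seqDU (B n.+1%:R^-1) (idx n x) x by rewrite /idx; case: cid.
pose h k (p : T * 'rV[R]_m) := if k is k'.+1 then f p.1 (q k') else 0.
apply: (@measurable_fun_cvg _ _ R setT (fun n p => h (idx n p.2) p)).
  move=> n; apply: (@measurable_fun_glue _ _ _ _
      (fun k => snd @^-1` seqDU (B n.+1%:R^-1) k) h).
  - move=> k; rewrite -[X in measurable X]setTI.
    by apply: measurable_snd => //; exact: seqDU_measurable.
  - rewrite -preimage_bigcup; apply/seteqP; split=> // -[s x] _ /=.
    by have [k hk] := coverB (e0 n) x; exists k.
  - case=> [|k] /=; first exact: measurable_cst.
    exact: (measurableT_comp (mf k) measurable_fst).
  - move=> k [s x] /= kx; congr (h _ _).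
    have /trivIsetP tB := @trivIset_seqDU _ (B n.+1%:R^-1).
    apply: contrapT => /eqP nk; have := tB _ _ Logic.I Logic.I nk.
    by rewrite -subset0; apply; split; [exact: idxP|exact: kx].
move=> [s x] _ /=; rewrite indicE.
have [Ox|nOx] := pselect (Omega x); last first.
  rewrite memNset// mulr0; apply: cvg_near_cst; apply: nearW => n.
  by have [] := idxP n x; case: (idx n x) => //= k [].
rewrite mem_set// mulr1.
have /cvg_distP cfx := cf s x (mem_set Ox).
apply/cvgrPdist_lt => e /cfx[r r0 hr].
near=> n.
have [] := idxP n x; case: (idx n x) => //= k [_ xk] _.
rewrite distrC; apply: hr; rewrite distrC; apply: lt_trans xk _.
by near: n; exact: near_infty_natSinv_lt (PosNum r0).
Unshelve. all: by end_near. Qed.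

End caratheodory.

(** * Mollifiers *)

Section derivative_epsilon_delta.
Context {R : realType} {V W : normedModType R}.

Lemma is_derive_distP (f : V -> W) (x v : V) (df : W) : is_derive x v f df <->
  forall e : R, 0 < e -> exists2 d : R, 0 < d &
    forall h : R, `|h| < d -> `|f (x + h *: v) - f x - h *: df| <= e * `|h|.
Proof.
split=> [[df1 df2] e e0|h].
  have : h^-1 *: (f (h *: v + x) - f x) @[h --> 0^'] --> df.
    by rewrite -df2; exact: df1.
  move=> /cvgrPdist_le /(_ _ e0); rewrite near_withinE => /nbhs_ballP[d /= d0 hd].
  exists d => // h hd'; have [->|h0] := eqVneq h 0.
    by rewrite !scale0r addr0 !subrr ?subr0 !normr0 mulr0.
  have := hd h; rewrite -ball_normE /= sub0r normrN => /(_ hd' h0).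
  rewrite distrC [h *: v + x]addrC -(ler_pM2l (x := `|h|)) ?normr_gt0//.
  by rewrite -normrZ scalerBr scalerA divff// scale1r mulrC.
have c : h^-1 *: (f (h *: v + x) - f x) @[h --> 0^'] --> df.
  apply/cvgrPdist_le => e e0; rewrite near_withinE; have [d d0 hd] := h e e0.
  apply/nbhs_ballP; exists d => //= k; rewrite -ball_normE /= sub0r normrN => kd k0.
  rewrite distrC [k *: v + x]addrC -(ler_pM2l (x := `|k|)) ?normr_gt0//.
  by rewrite -normrZ scalerBr scalerA divff// scale1r mulrC; exact: hd.
split; first by apply/cvg_ex; exists df.
exact: cvg_lim c.
Qed.

End derivative_epsilon_delta.

Lemma is_derive1_distP {R : realType} (f : R -> R) (x df : R) :
  is_derive x (1 : R) f df <->
  forall e : R, 0 < e -> exists2 d : R, 0 < d &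
    forall h : R, `|h| < d -> `|f (x + h) - f x - h * df| <= e * `|h|.
Proof.
rewrite is_derive_distP; split=> H e /H[d d0 hd]; exists d => // h /hd.
  by rewrite -[h *: 1]/(h * 1) mulr1.
by rewrite -[h *: 1]/(h * 1) mulr1.
Qed.

Section smooth.
Context {R : realType}.
Implicit Types (f g : R -> R) (k : nat).

(** Each derivative is given by a witness function rather than by an iterated operator; closure
    under sums, products and affine substitutions is then a plain induction. *)
Fixpoint smoothk k f : Prop :=
  if k is k'.+1 then exists2 g, (forall x, is_derive x (1 : R) f (g x)) & smoothk k' g
  else continuous f.

Definition smooth f := forall k, smoothk k f.

Lemma is_derive_continuous f (g : R -> R) :
  (forall x, is_derive x (1 : R) f (g x)) -> continuous f.
Proof. by move=> h x; apply/differentiable_continuous/derivable1_diffP. Qed.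

Lemma smoothkS k f : smoothk k.+1 f -> smoothk k f.
Proof.
elim: k f => [|k ih] f [g fg sg]; first exact: is_derive_continuous fg.
by exists g => //; exact: ih.
Qed.

Lemma smoothkD k f g : smoothk k f -> smoothk k g -> smoothk k (fun x => f x + g x).
Proof.
elim: k f g => [|k ih] f g /=; first by move=> cf cg x; apply: cvgD; [exact: cf|exact: cg].
move=> [f' ff' sf] [g' gg' sg]; exists (fun x => f' x + g' x); last exact: ih.
by move=> x; exact: is_deriveD.
Qed.

Lemma smoothkM k f g : smoothk k f -> smoothk k g -> smoothk k (fun x => f x * g x).
Proof.
elim: k f g => [|k ih] f g; first by move=> cf cg x; apply: cvgM; [exact: cf|exact: cg].
move=> sf sg; have sf1 := smoothkS sf; have sg1 := smoothkS sg.
move: sf sg => [f' ff' sf] [g' gg' sg].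
exists (fun x => f x * g' x + g x * f' x); last by apply: smoothkD; exact: ih.
by move=> x; apply: is_deriveM.
Qed.

Lemma smoothk_cst k (c : R) : smoothk k (fun _ => c).
Proof.
elim: k c => [|k ih] c; first by move=> x; exact: cvg_cst.
by exists (fun=> 0) => // x; exact: is_derive_cst.
Qed.

Lemma smoothk_affine k f (a c : R) : smoothk k f -> smoothk k (fun x => f (a * x + c)).
Proof.
elim: k f => [|k ih] f.
  move=> cf x; apply: (@continuous_comp _ _ _ (fun x => a * x + c) f); last exact: cf.
  by apply: cvgD; [apply: cvgM; [exact: cvg_cst|exact: cvg_id]|exact: cvg_cst].
move=> [g fg sg]; exists (fun x => a * g (a * x + c)); last first.
  by apply: smoothkM; [exact: smoothk_cst|exact: ih].
move=> x.
have d1 : is_derive x (1 : R) (fun x => a * x + c) a.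
  apply/is_derive1_distP => e e0; exists 1 => // h _ /=.
  have -> : a * (x + h) + c - (a * x + c) - h * a = 0 by ring.
  by rewrite normr0 mulr_ge0// ltW.
rewrite (_ : a * _ = g (a * x + c) * a); last by rewrite mulrC.
exact: (@is_derive1_comp _ f (fun x => a * x + c)).
Qed.

Lemma smooth_derive f : smooth f ->
  exists2 g, (forall x, is_derive x (1 : R) f (g x)) & smooth g.
Proof.
move=> sf; have [g fg _] := sf 1%N; exists g => // k.
have [g' fg' sg'] := sf k.+1; rewrite (_ : g = g')//.
by apply/funext => x; rewrite -(@derive_val _ _ _ _ _ _ _ (fg x)) -(@derive_val _ _ _ _ _ _ _ (fg' x)).
Qed.

(** The function p(1/x) exp(-1/x), extended by 0. The polynomial is carried along because
    differentiating exp(-1/x) produces such factors; with it the class is closed under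
    derivation. *)
Definition flat (p : {poly R}) (x : R) : R :=
  if 0 < x then p.[x^-1] * expR (- x^-1) else 0.

Lemma monomial_le_expR k (y : R) : 0 <= y -> y ^+ k * expR (- y) <= k`!%:R.
Proof.
move=> y0; rewrite expRN ler_pdivrMr ?expR_gt0//.
case: k => [|k]; first by rewrite fact0 mul1r expr0; have := expR_ge1Dx y; lra.
have := expR_ge1Dxn k y0; set E := expR y; set F := k.+1`!%:R.
have F0 : 0 < F by rewrite ltr0n fact_gt0.
move=> h; rewrite mulrC -ler_pdivrMr//; lra.
Qed.

Lemma poly_le_expR (p : {poly R}) :
  exists2 C : R, 0 <= C & forall y, 1 <= y -> `|p.[y] * expR (- y)| <= C / y.
Proof.
exists (\sum_(i < size p) `|p`_i| * i.+1`!%:R); first by apply: sumr_ge0.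
move=> y y1; have y0 : 0 < y by lra.
rewrite horner_coef mulr_suml mulr_suml; apply: le_trans (ler_norm_sum _ _ _) _.
apply: ler_sum => i _; rewrite -mulrA normrM -mulrA ler_wpM2l//.
rewrite ger0_norm; last by rewrite mulr_ge0 ?expR_ge0// exprn_ge0// ltW.
rewrite ler_pdivlMr// mulrAC -exprSr; apply: monomial_le_expR; exact: ltW.
Qed.

Lemma flat_small p : exists2 C : R, 0 <= C & forall x, `|x| <= 1 -> `|flat p x| <= C * `|x|.
Proof.
have [C C0 hC] := poly_le_expR p; exists C => // x x1; rewrite /flat.
case: ifPn => x0; last by rewrite normr0 mulr_ge0.
rewrite gtr0_norm// in x1 *; rewrite -{3}[x]invrK; apply: hC.
by rewrite invf_ge1.
Qed.

(** For x > 0 this is the chain rule with y = 1/x and dy/dx = -y^2; for x < 0 the function is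
    locally 0. At 0, [flat p h] equals [h * flat (p * 'X) h], whose second factor is O(|h|), so the
    derivative is 0. *)
Lemma is_derive_flat p x : is_derive x (1 : R) (flat p) (flat ('X^2 * (p - p^`())) x).
Proof.
have [x0|x0|<-] := ltgtP 0 x.
- have d1 : is_derive x (1 : R) (fun y => y^-1 : R) (- (x ^- 2)).
    have -> : - x ^- 2 = - x ^- 2 * 1 :> R by rewrite mulr1.
    exact: (@is_deriveV _ id x 1 1 (lt0r_neq0 x0)).
  have d2 : is_derive x (1 : R) (fun y => p.[y^-1]) (p^`().[x^-1] * (- (x ^- 2))).
    exact: (@is_derive1_comp _ (horner p) (fun y => y^-1)).
  have d3 : is_derive x (1 : R) (fun y => expR (- y^-1)) (expR (- x^-1) * (- - (x ^- 2))).
    apply: (@is_derive1_comp _ expR (fun y => - y^-1)).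
  have d4 := is_deriveM d2 d3.
  have H : \near x, p.[x^-1] * expR (- x^-1) = flat p x.
    by near=> y; rewrite /flat ifT//; near: y; exact: lt_nbhsr.
  apply: (near_eq_is_derive H); apply: is_derive_eq d4 _.
  rewrite /flat x0 !hornerE /GRing.scale /=.
  by rewrite exprVn; ring.
- have H : \near x, cst 0 x = flat p x.
    near=> y; rewrite /flat ifF//; apply/negbTE; rewrite -leNgt; apply: ltW.
    by near: y; exact: lt_nbhsl.
  apply: (near_eq_is_derive H); rewrite /flat ltNge (ltW x0) /=; exact: is_derive_cst.
- have [C C0 hC] := flat_small (p * 'X).
  rewrite /flat ltxx; apply/is_derive1_distP => e e0.
  exists (Num.min 1 (e / (C + 1))) => [|h].
    by rewrite lt_min ltr01 divr_gt0//; lra.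
  rewrite lt_min => /andP[h1 h2]; rewrite add0r ltxx subr0 mulr0 subr0.
  have -> : (if 0 < h then p.[h^-1] * expR (- h^-1) else 0) = h * flat (p * 'X) h.
    rewrite /flat; case: ifPn => h0; last by rewrite mulr0.
    rewrite hornerM hornerX; set P := p.[_]; set E := expR _.
    have hh : h * h^-1 = 1 by rewrite divff// gt_eqF.
    by rewrite -[LHS]mul1r -hh; ring.
  rewrite normrM mulrC ler_wpM2r//; apply: le_trans (hC h (ltW h1)) _.
  move: h2; rewrite ltr_pdivlMr; last lra.
  by move=> h2; have := normr_ge0 h; nra.
Unshelve. all: by end_near. Qed.

Lemma smooth_flat p : smooth (flat p).
Proof.
move=> k; elim: k p => [|k ih] p.
  by apply: is_derive_continuous => x; exact: is_derive_flat.
by exists (flat ('X^2 * (p - p^`()))) => //; exact: is_derive_flat.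
Qed.

(** Positive exactly on ]-e, e[. The coefficients 1 and -1 are spelled out so that both factors have
    the shape of [smoothk_affine]. *)
Definition bump1 (e x : R) : R := flat 1 (1 * x + e) * flat 1 (- 1 * x + e).

Lemma smooth_bump1 e : smooth (bump1 e).
Proof. by move=> k; apply: smoothkM; apply: smoothk_affine; exact: smooth_flat. Qed.

Lemma bump1_ge0 e x : 0 <= bump1 e x.
Proof.
rewrite /bump1 mulr_ge0// /flat; case: ifP => // _;
  by rewrite hornerE mulr_ge0// expR_ge0.
Qed.

Lemma bump1_even e x : bump1 e (- x) = bump1 e x.
Proof. by rewrite /bump1 mulrC !mulNr mulrN opprK. Qed.

Lemma bump1_supp e x : e <= `|x| -> bump1 e x = 0.
Proof.
rewrite /bump1 /flat !hornerE; case: ltrP => h1; case: ltrP => h2; rewrite ?mulr0 ?mul0r//.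
by rewrite leNgt ltr_norml; move=> /negP[]; apply/andP; split; lra.
Qed.

Lemma bump1_gt0 e x : `|x| < e -> 0 < bump1 e x.
Proof.
rewrite ltr_norml => /andP[h1 h2]; rewrite /bump1 /flat.
have c1 : 0 < 1 * x + e by lra.
have c2 : 0 < - 1 * x + e by lra.
rewrite c1 c2 !hornerC.
by rewrite ![1 * expR _]mul1r mulr_gt0// expR_gt0.
Qed.

(** The inequality becomes strict: [x] must be interior to the region where [f] vanishes. *)
Lemma derive_supp f (g : R -> R) e : (forall x, is_derive x (1 : R) f (g x)) ->
  (forall x, e <= `|x| -> f x = 0) -> forall x, e < `|x| -> g x = 0.
Proof.
move=> fg f0 x ex.
have : is_derive x (1 : R) f 0.
  apply/is_derive1_distP => c c0; exists (`|x| - e); first by rewrite subr_gt0.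
  move=> h hd; rewrite (f0 x (ltW ex)) (f0 (x + _)) ?subrr ?mulr0 ?subr0 ?normr0.
    by rewrite mulr_ge0// ltW.
  have := lerB_normD x h; lra.
by move=> h; rewrite -(@derive_val _ _ _ _ _ _ _ (fg x)) (@derive_val _ _ _ _ _ _ _ h).
Qed.

Lemma continuous_supp_bounded f (e : R) : continuous f ->
  (forall x, e < `|x| -> f x = 0) -> exists2 C : R, 0 <= C & forall x, `|f x| <= C.
Proof.
move=> cf f0.
have [ne|e0] := leP (- e) e; last first.
  exists 0 => // x; rewrite f0 ?normr0//.
  by apply: lt_le_trans (normr_ge0 x); lra.
have cn : {within `[- e, e], continuous (fun x => `|f x|)}.
  apply: continuous_subspaceT => x.
  by apply: (@continuous_comp _ _ _ f Num.Def.normr); [exact: cf|exact: norm_continuous].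
have [c _ hc] := EVT_max ne cn.
exists `|f c| => // x; have [h|h] := ltP e `|x|; first by rewrite f0// normr0.
by apply: hc; rewrite in_itv /= -ler_norml.
Qed.

Lemma is_derive_lipschitz f (g : R -> R) (C : R) :
  (forall x, is_derive x (1 : R) f (g x)) -> (forall x, `|g x| <= C) ->
  forall x y, `|f x - f y| <= C * `|x - y|.
Proof.
move=> fg gC x y; wlog xy : x y / y <= x.
  by move=> h; have [/h//|/ltW/h] := leP y x; rewrite distrC [`|y - _|]distrC.
have [|c _ ->] := MVT_segment xy (fun z _ => fg z).
  by apply: continuous_subspaceT; exact: is_derive_continuous fg.
by rewrite normrM ler_wpM2r.
Qed.

Lemma bump1_taylor e : exists g : R -> R, exists2 C : R, 0 <= C &
  [/\ (forall x, is_derive x (1 : R) (bump1 e) (g x)) /\ continuous g,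
      forall x, `|bump1 e x| <= C, forall x, `|g x| <= C,
      forall x h, `|bump1 e (x + h) - bump1 e x| <= C * `|h| &
      forall x h, `|bump1 e (x + h) - bump1 e x - g x * h| <= C * `|h| ^+ 2].
Proof.
have [g bg sg] := smooth_derive (smooth_bump1 e).
have [g2 gg2 sg2] := smooth_derive sg.
have b0 := @bump1_supp e.
have g0 := derive_supp bg b0.
(* [derive_supp] asks for vanishing on a closed region while [g0] gives an open one, hence the
   larger radius. *)
have g20 x : e + 1 < `|x| -> g2 x = 0.
  by apply: (derive_supp gg2) => y ey; apply: g0; lra.
have [C0 C00 hC0] := continuous_supp_bounded (is_derive_continuous bg)
  (fun x h => b0 x (ltW h)).
have [C1 C10 hC1] := continuous_supp_bounded (is_derive_continuous gg2) g0.
have [C2 C20 hC2] := continuous_supp_bounded (sg2 0%N) g20.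
exists g, (C0 + C1 + C2); first by lra.
split.
- by split => //; exact: (is_derive_continuous gg2).
- by move=> x; have := hC0 x; lra.
- by move=> x; have := hC1 x; lra.
- move=> x h; have := is_derive_lipschitz bg hC1 (x + h) x.
  by rewrite addrAC subrr add0r => H; apply: le_trans H _; rewrite ler_wpM2r//; lra.
move=> x h.
(* Subtracting the tangent turns the Taylor remainder into an increment of [F], whose derivative is
   an increment of [g]: the mean value theorem and the Lipschitz bound of [g] give the square. *)
pose F t := bump1 e (x + t) - t * g x.
have dF t : is_derive t (1 : R) F (g (x + t) - g x).
  apply/is_derive1_distP => c c0.
  have /is_derive1_distP/(_ _ c0)[d d0 hd] := bg (x + t).
  exists d => // k /hd; rewrite /F addrA => H.
  by apply: le_trans H; rewrite le_eqVlt; apply/orP; left; apply/eqP; congr `|_|; ring.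
have hl := is_derive_lipschitz gg2 hC2.
have -> : bump1 e (x + h) - bump1 e x - g x * h = F h - F 0.
  by rewrite /F addr0 mul0r; ring.
have cF := is_derive_continuous dF.
have key (a b c : R) : a <= c <= b -> `|a| <= `|h| -> `|b| <= `|h| -> `|c| <= `|h|.
  move=> /andP[ac cb]; rewrite !ler_norml => /andP[a1 a2] /andP[b1 b2].
  by apply/andP; split; lra.
suff [c ch ->] : exists2 c, `|c| <= `|h| & F h - F 0 = (g (x + c) - g x) * h.
  rewrite normrM expr2 mulrA ler_wpM2r//; apply: le_trans (hl _ _) _.
  rewrite addrAC subrr add0r; apply: le_trans (_ : C2 * `|h| <= _).
    by rewrite ler_wpM2l.
  by rewrite ler_wpM2r//; lra.
have [h0|/ltW h0] := leP 0 h.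
  have [|c + ->] := MVT_segment h0 (fun z _ => dF z); first exact: continuous_subspaceT.
  rewrite in_itv /= => cc; exists c; last by rewrite subr0.
  by apply: (key _ _ _ cc); rewrite ?normr0.
have [|c + e1] := MVT_segment h0 (fun z _ => dF z); first exact: continuous_subspaceT.
rewrite in_itv /= => cc; exists c; last by rewrite -[LHS]opprB e1; ring.
by apply: (key _ _ _ cc); rewrite ?normr0.
Qed.

End smooth.

Section dot_product.
Context {R : realType} {m : nat}.
Implicit Types v w : 'rV[R]_m.

Lemma dotDl v1 v2 w : dot (v1 + v2) w = dot v1 w + dot v2 w.
Proof. by rewrite /dot -big_split; apply: eq_bigr => i _; rewrite mxE mulrDl. Qed.

Lemma dotDr v w1 w2 : dot v (w1 + w2) = dot v w1 + dot v w2.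
Proof. by rewrite /dot -big_split; apply: eq_bigr => i _; rewrite mxE mulrDr. Qed.

Lemma dotZl (a : R) v w : dot (a *: v) w = a * dot v w.
Proof. by rewrite /dot big_distrr; apply: eq_bigr => i _; rewrite mxE /= mulrA. Qed.

Lemma dotNl v w : dot (- v) w = - dot v w.
Proof. by rewrite -scaleN1r dotZl mulN1r. Qed.

Lemma dotC v w : dot v w = dot w v.
Proof. by rewrite /dot; apply: eq_bigr => i _; rewrite mulrC. Qed.

Lemma dotZr (a : R) v w : dot v (a *: w) = a * dot v w.
Proof. by rewrite dotC dotZl dotC. Qed.

Lemma dotNr v w : dot v (- w) = - dot v w.
Proof. by rewrite dotC dotNl dotC. Qed.

Lemma dot_delta v i : dot v (delta_mx ord0 i) = v ord0 i.
Proof.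
rewrite /dot (bigD1 i)//= big1 => [|j ji]; last by rewrite !mxE (negbTE ji) andbF mulr0.
by rewrite !mxE !eqxx mulr1 addr0.
Qed.

Lemma dot_le v w (a b : R) : `|v| <= a -> `|w| <= b -> `|dot v w| <= m%:R * (a * b).
Proof.
move=> va wb; apply: le_trans (ler_norm_sum _ _ _) _.
rewrite mulr_natl -[X in _ *+ X]card_ord -sumr_const; apply: ler_sum => i _.
by rewrite normrM ler_pM//; [exact: le_trans (rV_coord_le v i) va|exact: le_trans (rV_coord_le w i) wb].
Qed.

End dot_product.

Section taylor_expansion.
Context {R : realType} {m : nat}.
Implicit Types (f g : 'rV[R]_m -> R) (D : 'rV[R]_m -> 'rV[R]_m).

(** A first-order expansion with one constant valid everywhere. It survives finite products by
    elementary inequalities, which is how one-variable bumps yield a bump on R^m. *)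
Record taylor2 f D (C : R) : Prop := {
  taylor2_ge0 : 0 <= C;
  taylor2_meas : measurable_fun setT f;
  taylor2_measD : forall i, measurable_fun setT (fun x => D x ord0 i);
  taylor2_bound : forall x, `|f x| <= C;
  taylor2_boundD : forall x, `|D x| <= C;
  taylor2_lip : forall x k, `|f (x + k) - f x| <= C * `|k|;
  taylor2_expand : forall x k, `|f (x + k) - f x - dot (D x) k| <= C * `|k| ^+ 2
}.

Lemma taylor2_cst (c : R) : taylor2 (fun=> c) (fun=> 0) `|c|.
Proof.
split=> //.
- by move=> x; rewrite normr0.
- by move=> x k; rewrite subrr normr0 mulr_ge0.
- move=> x k; rewrite subrr sub0r normrN /dot big1 ?normr0 ?mulr_ge0 ?exprn_ge0//.
  by move=> i _; rewrite mxE mul0r.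
Qed.

Lemma taylor2_coord (b g : R -> R) (C : R) i : 0 <= C -> continuous b -> continuous g ->
  (forall x, `|b x| <= C) -> (forall x, `|g x| <= C) ->
  (forall x h, `|b (x + h) - b x| <= C * `|h|) ->
  (forall x h, `|b (x + h) - b x - g x * h| <= C * `|h| ^+ 2) ->
  taylor2 (fun x => b (x ord0 i)) (fun x => g (x ord0 i) *: delta_mx ord0 i) C.
Proof.
move=> C0 cb cg bC gC bl bt; split => //.
- apply: (measurableT_comp (continuous_measurable_fun cb)); exact: measurable_coord.
- move=> j; under eq_fun do rewrite !mxE.
  apply: measurable_funM; last exact: measurable_cst.
  by apply: (measurableT_comp (continuous_measurable_fun cg)); exact: measurable_coord.
- move=> x; apply: rV_norm_le => // j; rewrite !mxE.
  by case: (_ && _); rewrite ?mulr1 ?mulr0 ?normr0.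
- move=> x k; rewrite mxE; apply: le_trans (bl _ _) _.
  by rewrite ler_wpM2l// rV_coord_le.
- move=> x k; rewrite mxE dotZl dotC dot_delta; apply: le_trans (bt _ _) _.
  by rewrite ler_wpM2l// lerXn2r ?nnegrE// rV_coord_le.
Qed.

Lemma taylor2M f g Df Dg (C E : R) : taylor2 f Df C -> taylor2 g Dg E ->
  taylor2 (fun x => f x * g x) (fun x => f x *: Dg x + g x *: Df x)
    (2 * C * E + m%:R * C * E).
Proof.
move=> [C0 mf mDf bf bDf lf tf] [E0 mg mDg bg bDg lg tg].
have mCE : 0 <= m%:R * C * E by rewrite !mulr_ge0.
have CE : 0 <= C * E by rewrite mulr_ge0.
split.
- by lra.
- exact: measurable_funM.
- move=> i; under eq_fun do rewrite !mxE.
  by apply: measurable_funD; exact: measurable_funM.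
- by move=> x; rewrite normrM; have := ler_pM (normr_ge0 _) (normr_ge0 _) (bf x) (bg x); lra.
- move=> x; apply: le_trans (ler_normD _ _) _; rewrite !normrZ.
  have := ler_pM (normr_ge0 _) (normr_ge0 _) (bf x) (bDg x).
  have := ler_pM (normr_ge0 _) (normr_ge0 _) (bg x) (bDf x).
  by lra.
- move=> x k.
  have -> : f (x + k) * g (x + k) - f x * g x =
    (f (x + k) - f x) * g (x + k) + f x * (g (x + k) - g x) by ring.
  apply: le_trans (ler_normD _ _) _; rewrite !normrM.
  have := ler_pM (normr_ge0 _) (normr_ge0 _) (lf x k) (bg (x + k)).
  have := ler_pM (normr_ge0 _) (normr_ge0 _) (bf x) (lg x k).
  have : 0 <= m%:R * C * E * `|k| by rewrite mulr_ge0.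
  by lra.
move=> x k; rewrite dotDl !dotZl.
(* The third term is a product of two first-order increments; the part [m%:R * C * E] of the
   constant comes from it. *)
have -> : f (x + k) * g (x + k) - f x * g x - (f x * dot (Dg x) k + g x * dot (Df x) k) =
  (f (x + k) - f x - dot (Df x) k) * g (x + k) + f x * (g (x + k) - g x - dot (Dg x) k)
  + dot (Df x) k * (g (x + k) - g x) by ring.
apply: le_trans (ler_normD _ _) _; apply: le_trans (lerD (ler_normD _ _) (lexx _)) _.
rewrite !normrM.
have := ler_pM (normr_ge0 _) (normr_ge0 _) (tf x k) (bg (x + k)).
have := ler_pM (normr_ge0 _) (normr_ge0 _) (bf x) (tg x k).
have := ler_pM (normr_ge0 _) (normr_ge0 _) (dot_le (bDf x) (lexx `|k|)) (lg x k).
rewrite expr2; lra.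
Qed.

Lemma taylor2_prod (I : Type) (s : seq I) (F : I -> 'rV[R]_m -> R) (C : R) :
  (forall i, exists D, taylor2 (F i) D C) ->
  exists D E, taylor2 (fun x => \prod_(i <- s) F i x) D E.
Proof.
move=> h; elim: s => [|i s [D [E ih]]].
  by exists (fun=> 0), `|1|; under eq_fun do rewrite big_nil; exact: taylor2_cst.
have [D' h'] := h i; eexists; eexists.
by under eq_fun do rewrite big_cons; exact: taylor2M h' ih.
Qed.

Lemma taylor2_partial f D C : taylor2 f D C ->
  forall x i, is_derive x (delta_mx ord0 i) f (D x ord0 i).
Proof.
move=> [C0 _ _ _ _ _ tf] x i; apply/is_derive_distP => e e0.
exists (e / (C + 1)); first by rewrite divr_gt0//; lra.
move=> h; rewrite ltr_pdivlMr; last lra.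
move=> hC.
have d1 : `|delta_mx ord0 i : 'rV[R]_m| <= 1.
  apply: rV_norm_le => // j; rewrite !mxE.
  by case: (_ && _); rewrite ?normr1 ?normr0.
rewrite -[h *: D x ord0 i]/(h * D x ord0 i) -dot_delta -dotZr.
apply: le_trans (tf _ _) _; rewrite normrZ.
have hd : `|h| * `|delta_mx ord0 i : 'rV[R]_m| <= `|h| by rewrite ler_piMr.
have h0 := normr_ge0 h.
apply: (@le_trans _ _ (C * `|h| ^+ 2)).
  by rewrite ler_wpM2l// lerXn2r ?nnegrE// mulr_ge0.
by rewrite expr2; nra.
Qed.

End taylor_expansion.

Section product_test_functions.
Context {R : realType} {m : nat}.

(** Scaled products of one-variable functions: the j-th partial derivative only replaces the j-th
    factor, so the class is closed under differentiation. The constant receives the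
    normalisation. *)
Let pf (c : R) (b : 'I_m -> R -> R) (x : 'rV[R]_m) := c * \prod_i b i (x ord0 i).

Let pf_continuous c b : (forall i, continuous (b i)) -> continuous (pf c b).
Proof.
move=> cb x.
change ((fun=> c) \* (fun y : 'rV[R]_m => \prod_i b i (y ord0 i)) @ x -->
  c * \prod_i b i (x ord0 i)).
apply: (@cvgM _ _ (nbhs x) (nbhs_filter x)); first exact: cst_continuous.
elim: (index_enum _) => [|i s ih].
  under eq_fun do rewrite big_nil; rewrite big_nil.
  exact: cst_continuous.
under eq_fun do rewrite big_cons; rewrite big_cons; apply: (@cvgM _ _ (nbhs x) (nbhs_filter x)) => //.
apply: (@continuous_comp _ _ _ (fun x : 'rV[R]_m => x ord0 i) (b i)); last exact: cb.
exact: coord_continuous.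
Qed.

Let pf_derive c b j (g : R -> R) : (forall x, is_derive x (1 : R) (b j) (g x)) ->
  forall x, is_derive x (delta_mx ord0 j) (pf c b)
    (pf c (fun i => if i == j then g else b i) x).
Proof.
move=> bg x; apply/is_derive_distP => e e0.
pose P := c * \prod_(i | i != j) b i (x ord0 i).
have e1 : 0 < e / (`|P| + 1) by rewrite divr_gt0// ltr_wpDl.
have /is_derive1_distP/(_ _ e1)[d d0 hd] := bg (x ord0 j).
exists d => // h /hd {}hd.
have -> : pf c (fun i => if i == j then g else b i) x = P * g (x ord0 j).
  rewrite /pf (bigD1 j)//= eqxx /P mulrCA [RHS]mulrC; congr (_ * _); congr (_ * _).
  by apply: eq_bigr => i /negbTE ->.
have -> : pf c b (x + h *: delta_mx ord0 j) = P * b j (x ord0 j + h).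
  rewrite /pf (bigD1 j)//= !mxE !eqxx mulr1 /P mulrCA [RHS]mulrC; congr (_ * _); congr (_ * _).
  by apply: eq_bigr => i /negbTE ij; rewrite !mxE ij andbF mulr0 addr0.
have -> : pf c b x = P * b j (x ord0 j).
  by rewrite /pf (bigD1 j)//= /P mulrCA [RHS]mulrC.
rewrite -[h *: (P * _)]/(h * (P * _)).
have -> : P * b j (x ord0 j + h) - P * b j (x ord0 j) - h * (P * g (x ord0 j)) =
  P * (b j (x ord0 j + h) - b j (x ord0 j) - h * g (x ord0 j)) by ring.
rewrite normrM; apply: (@le_trans _ _ ((`|P| + 1) * (e / (`|P| + 1) * `|h|))).
  by apply: ler_pM => //; rewrite lerDl.
by rewrite mulrA mulrCA divff ?mulr1// gt_eqF// ltr_wpDl.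
Qed.

Let pf_Ck c b k : (forall i, smooth (b i)) -> Ck_on setT k (pf c b).
Proof.
elim: k b => [|k ih] b sb /=.
  by split=> // x _; apply: pf_continuous => i; exact: (sb i 0%N).
split; first by move=> x _; apply: pf_continuous => i; exact: (sb i 0%N).
move=> j; have [g bg sg] := smooth_derive (sb j).
split=> [x _|]; first by have [] := pf_derive c bg x.
rewrite (_ : partial j _ = pf c (fun i => if i == j then g else b i)).
  by apply: ih => i; case: ifP.
apply/funext => x; rewrite /partial.
exact: (@derive_val _ _ _ _ _ _ _ (pf_derive c bg x)).
Qed.

Definition bump (e : R) (x : 'rV[R]_m) : R := \prod_i bump1 e (x ord0 i).

Lemma bump_Ck c e z k : Ck_on setT k (fun y => c * bump e (y - z)).
Proof.
rewrite (_ : (fun y => _) = pf c (fun i t => bump1 e (1 * t + (- z ord0 i)))).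
  by apply: pf_Ck => i l; apply: smoothk_affine; exact: smooth_bump1.
apply/funext => y; congr (_ * _); apply: eq_bigr => i _.
by rewrite !mxE mul1r.
Qed.

End product_test_functions.

Section mollifier.
Context {R : realType} {m : nat}.

(** A smooth even density on the sup-norm ball of radius [e]. [C] is the constant of its Taylor
    expansion; no bound of [C] in terms of [e] is recorded, which dictates the order of choices
    later. *)
Record mollifier (e : R) (eta : 'rV[R]_m -> R) (D : 'rV[R]_m -> 'rV[R]_m) (C : R) : Prop := {
  mol_taylor : taylor2 eta D C;
  mol_ge0 : forall z, 0 <= eta z;
  mol_even : forall z, eta (- z) = eta z;
  mol_supp : forall z, e <= `|z| -> eta z = 0;
  mol_int : \int[lebesgue_rV m]_(z in [set z | `|z| < e]) eta z = 1;
  mol_test : forall (Omega : set 'rV[R]_m) x, (forall y, `|y - x| <= e -> Omega y) ->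
    test_function Omega (fun y => eta (y - x));
  mol_partial : forall x y i, partial i (fun y => eta (y - x)) y = D (y - x) ord0 i
}.

Lemma measurable_ball0 (e : R) : measurable [set z : 'rV[R]_m | `|z| < e].
Proof.
by have := @measurable_rVball R m 0 e; under eq_fun do rewrite subr0.
Qed.

Lemma lebesgue_ball0 (e : R) : 0 < e ->
  lebesgue_rV m [set z : 'rV[R]_m | `|z| < e] = ((2 * e) ^+ m)%:E.
Proof.
move=> e0; rewrite -(lebesgue_rVball 0 e0); congr (lebesgue_rV m _).
by apply/seteqP; split => z /=; rewrite subr0.
Qed.

Lemma bump_supp (e : R) (z : 'rV[R]_m) : 0 < e -> e <= `|z| -> bump e z = 0.
Proof.
move=> e0 ez; rewrite /bump; have [i hi] : exists i, e <= `|z ord0 i|.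
  apply: contrapT => /forallNP h; have : `|z| < e.
    by apply: rV_norm_lt => // i; rewrite ltNge; exact/negP/h.
  by rewrite ltNge ez.
by rewrite (bigD1 i)//= bump1_supp// mul0r.
Qed.

Lemma ex_mollifier (e : R) : 0 < e -> exists eta D C, mollifier e eta D C.
Proof.
move=> e0.
have [D0 [C0 t0]] : exists D E, taylor2 (@bump R m e) D E.
  have [g [C C0 [[bg cg] b1 b2 b3 b4]]] := bump1_taylor e.
  apply: (taylor2_prod _ (C := C)) => i.
  exists (fun x => g (x ord0 i) *: delta_mx ord0 i).
  by apply: taylor2_coord => //; exact: (smooth_bump1 e 0%N).
pose B := [set z : 'rV[R]_m | `|z| < e].
have mB : measurable B by exact: measurable_ball0.
have fB : (lebesgue_rV m B < +oo)%E by rewrite lebesgue_ball0// ltry.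
have bb : bmf (@bump R m e).
  by case: t0 => _ mb _ hb _ _ _; split => //; exists C0.
pose I := \int[lebesgue_rV m]_(z in B) bump e z.
have bpos z : `|z| < e -> 0 < @bump R m e z.
  move=> ze; apply: prodr_gt0 => i _; apply: bump1_gt0.
  exact: le_lt_trans (rV_coord_le z i) ze.
have bge z : 0 <= @bump R m e z by apply: prodr_ge0 => i _; exact: bump1_ge0.
(* Needed to normalise. A zero integral would make the bump vanish almost everywhere on a ball of
   positive measure where it is positive. *)
have I0 : 0 < I.
  rewrite lt_neqAle Rintegral_ge0// andbT eq_sym; apply/eqP => I0.
  have := bmf_EFin_int mB fB bb; rewrite -/I I0 => i0.
  have [+ _] := @ae_eq_integral_abs _ _ R (lebesgue_rV m) B mB (EFin \o @bump R m e)
    (measurable_funTS (iffRL (measurable_EFinP _ _) bb.1)).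
  rewrite (_ : (\int[_]_(_ in B) _ = 0)%E); last first.
    by rewrite -[RHS]i0; apply: eq_integral => z _; rewrite /= ger0_norm.
  move=> /(_ erefl) /negligibleS nB.
  have /(measure_negligible mB) : (lebesgue_rV m).-negligible B.
    by apply: nB => z Bz /= /(_ Bz) /= [] /eqP; rewrite gt_eqF// bpos.
  move=> B0; have [] : (((2 * e) ^+ m)%:E = 0 :> \bar R)%E.
    by rewrite -(lebesgue_ball0 e0).
  move=> /eqP.
  by rewrite gt_eqF// exprn_gt0// mulr_gt0.
have Inz : I != 0 by rewrite gt_eqF.
pose eta z := I^-1 * @bump R m e z.
have te := taylor2M (taylor2_cst I^-1) t0.
exists eta; eexists; eexists; split.
- exact: te.
- by move=> z; rewrite /eta mulr_ge0// invr_ge0 ltW.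
- move=> z; rewrite /eta /bump; congr (_ * _); apply: eq_bigr => i _.
  by rewrite mxE bump1_even.
- by move=> z ez; rewrite /eta bump_supp// mulr0.
- by rewrite bintZ// mulVf.
- move=> Omega x hO.
  have sub : closure [set y | eta (y - x) != 0] `<=` [set y | `|y - x| <= e].
    apply: (@subset_trans _ (closure [set y | `|y - x| <= e])).
      apply: closure_subset => y /= hy; rewrite leNgt; apply/negP => ey.
      by move: hy; rewrite /eta bump_supp ?mulr0 ?eqxx// ltW.
    rewrite (_ : [set y | _] = closed_ball x e).
      by rewrite -(closure_id _).1//; exact: closed_ball_closed.
    rewrite closed_ballE//; apply/seteqP; split=> y /=; by rewrite /closed_ball_/= distrC.
  split.
  + by move=> k; exact: bump_Ck.
  + apply: bounded_closed_compact; last exact: closed_closure.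
    exists (`|x| + e); split; first exact: num_real.
    move=> M hM y /sub /= hy; apply: le_trans (ltW hM).
    by rewrite -[y](subrK x) addrC (le_trans (ler_normD _ _))// lerD2l.
  + by move=> y /sub; exact: hO.
- move=> x y i; rewrite /partial.
  suff dd : is_derive y (delta_mx ord0 i) (fun y => eta (y - x))
      ((fun z => cst I^-1 z *: D0 z + bump e z *: 0) (y - x) ord0 i).
    exact: (@derive_val _ _ _ _ _ _ _ dd).
  have /is_derive_distP h := taylor2_partial te (y - x) i.
  apply/is_derive_distP => c /h[d d0 hd]; exists d => // k /hd.
  by rewrite (_ : y + k *: delta_mx ord0 i - x = y - x + k *: delta_mx ord0 i)// addrAC.
Qed.

End mollifier.

Ltac rV_ring := apply/rowP => ?; rewrite !mxE; ring.

Section measurable_rV_operations.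
Context d (T : measurableType d) {R : realType} {m : nat}.
Implicit Types f g : T -> 'rV[R]_m.

Lemma measurable_rVD f g : measurable_fun setT f -> measurable_fun setT g ->
  measurable_fun setT (fun x => f x + g x).
Proof.
move=> /measurable_fun_coordP mf /measurable_fun_coordP mg.
apply/measurable_fun_coordP => i; under eq_fun do rewrite mxE.
exact: measurable_funD.
Qed.

Lemma measurable_rVN f : measurable_fun setT f -> measurable_fun setT (fun x => - f x).
Proof.
move=> /measurable_fun_coordP mf.
apply/measurable_fun_coordP => i; under eq_fun do rewrite mxE.
exact: measurableT_comp.
Qed.

Lemma measurable_rVB f g : measurable_fun setT f -> measurable_fun setT g ->
  measurable_fun setT (fun x => f x - g x).
Proof. by move=> mf mg; apply: measurable_rVD => //; exact: measurable_rVN. Qed.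

Lemma bmf_dot f g : (forall i, bmf (fun x => f x ord0 i)) ->
  (forall i, bmf (fun x => g x ord0 i)) -> bmf (fun x => dot (f x) (g x)).
Proof. by move=> bf bg; apply: bmf_sum => i _; apply: bmfM. Qed.

End measurable_rV_operations.

(** An average against a density of total mass 1: the bound does not pick up the measure of [D]. *)
Lemma bint_weight d (T : measurableType d) (R : realType)
    (mu : {measure set T -> \bar R}) (D : set T) (w h : T -> R) (K : R) :
  measurable D -> (mu D < +oo)%E -> bmf w -> bmf h -> (forall x, 0 <= w x) ->
  \int[mu]_(x in D) w x = 1 -> (forall x, D x -> `|h x| <= K) ->
  `|\int[mu]_(x in D) (w x * h x)| <= K.
Proof.
move=> mD fD bw bh w0 w1 hK.
apply: le_trans (le_normr_Rintegral mD _) _.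
  by apply: bmf_integrable => //; exact: bmfM.
have -> : K = \int[mu]_(x in D) (w x * K) by rewrite bintZr// w1 mul1r.
apply: bint_le => // [||x Dx].
- by apply: bmf_norm; exact: bmfM.
- by apply: bmfM => //; exact: bmf_cst.
- by rewrite normrM (ger0_norm (w0 x)) ler_wpM2l// hK.
Qed.

(** * Volume distortion of a small displacement *)

Section static_estimate.
Context {R : realType} {m : nat}.
Variables (Omega : set 'rV[R]_m) (mO : measurable Omega).
Hypothesis finO : (lebesgue_rV m Omega < +oo)%E.
Notation mu := (lebesgue_rV m).
Notation M := (fine (mu Omega)).
Variables (e : R) (eta : 'rV[R]_m -> R) (D : 'rV[R]_m -> 'rV[R]_m) (C : R).
Hypotheses (e0 : 0 < e) (mol : mollifier e eta D C).

Let bmf_eta : bmf eta.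
Proof. by have t := mol_taylor mol; split; [exact: taylor2_meas t|exists C; exact: taylor2_bound t]. Qed.

Let bmf_D i : bmf (fun x => D x ord0 i).
Proof.
have t := mol_taylor mol; split; first exact: taylor2_measD t i.
by exists C => x; exact: le_trans (rV_coord_le _ _) (taylor2_boundD t x).
Qed.

Let eta_neq0 z : eta z != 0 -> `|z| < e.
Proof. by move=> h; rewrite ltNge; apply/negP => /(mol_supp mol) ez; rewrite ez eqxx in h. Qed.

Notation Bz := [set z : 'rV[R]_m | `|z| < e].

Let mB : measurable Bz. Proof. exact: measurable_ball0. Qed.

Let fB : (mu Bz < +oo)%E. Proof. by rewrite lebesgue_ball0// ltry. Qed.

Section lipschitz_density.
Variables (S : set 'rV[R]_m) (de : R).
(** [S] contains the support of [g]. Points reached from it by combining displacements and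
    translations of size at most [de] must stay in [Omega]; the factor 4 leaves room for this. *)
Hypothesis hS : forall p y, S p -> `|y - p| <= 4 * de -> Omega y.
Variables (g : 'rV[R]_m -> R) (G Lg : R).
Hypotheses (bg : bmf g) (gG : forall x, `|g x| <= G).
Hypothesis gL : forall x y, `|g x - g y| <= Lg * `|x - y|.
Hypothesis gS : forall y, g y != 0 -> S y.
Hypothesis ede : e <= de.

Section displacement.
Variables (V : 'rV[R]_m -> 'rV[R]_m) (ka La : R).
Hypotheses (mV : measurable_fun setT V) (Vka : forall y, `|V y| <= ka).
Hypotheses (kade : ka <= de) (La0 : 0 <= La) (Lg_ge0 : 0 <= Lg).
Hypothesis VL : forall p x y, S p -> `|x - p| <= 4 * de -> `|y - p| <= 4 * de ->
  `|V x - V y| <= La * `|x - y|.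

(* Averaging over the translations z |-> y + z costs only O(Lg La e), because
   V varies by at most La e over the support of eta. *)
Lemma mollify_displacement :
  `|\int[mu]_(y in Omega) g (y - V y) -
    \int[mu]_(y in Omega) \int[mu]_(x in Omega) (eta (x - y + V y) * g x)|
  <= Lg * (La * e) * M.
Proof.
have [ha hb hc] := And3 e0 ede kade.
pose F y := g (y - V y).
have bF : bmf F by apply: (bmf_comp bg); exact: measurable_rVB.
have bF2 : bmf (fun p : 'rV[R]_m * 'rV[R]_m => F (p.2 + p.1)).
  by apply: (bmf_comp bF); exact: measurable_rVD.
have bH2 : bmf (fun p : 'rV[R]_m * 'rV[R]_m => g (p.2 + p.1 - V p.2)).
  apply: (bmf_comp bg); apply: measurable_rVB; first exact: measurable_rVD.
  exact: (measurableT_comp mV).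
have be2 : bmf (fun p : 'rV[R]_m * 'rV[R]_m => eta p.1) by exact: (bmf_comp bmf_eta).
(* All translates of [F] by vectors [z] of norm less than [e] have the same integral over [Omega],
   so averaging over [z] with weight [eta] changes nothing. *)
have E0 : \int[mu]_(y in Omega) g (y - V y) =
    \int[mu]_(z in Bz) (eta z * \int[mu]_(y in Omega) F (y + z)).
  rewrite -[LHS]mul1r -(mol_int mol) -(bintZr mB fB _ bmf_eta).
  apply: eq_Rintegral => z; rewrite inE /= => ze; congr (_ * _).
  apply/esym; apply: bint_translate => [|y|y]; first exact: bF.1.
    move=> /gS /hS; apply; rewrite opprB addrC subrK.
    by apply: le_trans (Vka y) _; lra.
  move=> /gS /hS; apply.
  rewrite (_ : y - _ = V (y + z) - z); last by rV_ring.
  by apply: le_trans (ler_normB _ _) _; have := Vka (y + z); lra.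
(* The substitution x = z + (y - V y) turns the kernel into [eta z]. Compared with [E0], [V] is now
   evaluated at [y] instead of [y + z]. *)
have E1 : \int[mu]_(y in Omega) \int[mu]_(x in Omega) (eta (x - y + V y) * g x) =
    \int[mu]_(z in Bz) (eta z * \int[mu]_(y in Omega) g (y + z - V y)).
  transitivity (\int[mu]_(z in Bz) \int[mu]_(y in Omega) (eta z * g (y + z - V y))).
    rewrite (@bfubini _ _ _ _ R mu mu Bz Omega mB mO fB finO (fun p => eta p.1 * g (p.2 + p.1 - V p.2)));
      last by exact: bmfM.
    apply: eq_Rintegral => y _ /=.
    rewrite -(@bint_translate R m (fun x => eta (x - y + V y) * g x) Omega Bz (y - V y)).
    - apply: eq_Rintegral => z _; congr (eta _ * g _); rV_ring.
    - apply: measurable_funM; last exact: bg.1.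
      apply: (measurableT_comp bmf_eta.1); apply: measurable_rVD; last exact: measurable_cst.
      by apply: measurable_rVB => //; exact: measurable_cst.
    - move=> x; rewrite mulf_eq0 negb_or => /andP[_ /gS /hS]; apply.
      by rewrite subrr normr0; lra.
    - move=> z; rewrite mulf_eq0 negb_or => /andP[+ _].
      rewrite (_ : z + (y - V y) - y + V y = z); first exact: eta_neq0.
      by rV_ring.
  apply: eq_Rintegral => z _; apply: bintZ => //.
  exact: (bmf_sec1 z bH2).
have bI1 : bmf (fun z => \int[mu]_(y in Omega) F (y + z)).
  exact: (bmf_int2 mO finO (f := fun p => F (p.2 + p.1)) bF2).
have bI2 : bmf (fun z => \int[mu]_(y in Omega) g (y + z - V y)).
  exact: (bmf_int2 mO finO (f := fun p => g (p.2 + p.1 - V p.2)) bH2).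
rewrite E0 E1 {E0 E1} -bintB//; try exact: bmfM.
under eq_Rintegral do rewrite -mulrBr.
apply: bint_weight => //; [exact: bmfB|exact: mol_ge0 mol|exact: mol_int mol|].
move=> z /= ze; apply: bint_dist_le => //.
- exact: (bmf_sec1 z bF2).
- exact: (bmf_sec1 z bH2).
move=> y Oy.
have key p : S p -> `|y - p| <= 2 * de -> `|F (y + z) - g (y + z - V y)| <= Lg * (La * e).
  move=> Sp yp; apply: le_trans (gL _ _) _; rewrite ler_wpM2l//.
  rewrite (_ : _ - _ = V y - V (y + z)); last by rV_ring.
  have h1 : `|y - p| <= 4 * de by apply: le_trans yp _; lra.
  have h2 : `|y + z - p| <= 4 * de.
    by rewrite addrAC; apply: le_trans (ler_normD _ _) _; lra.
  apply: le_trans (VL Sp h1 h2) _.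
  rewrite (_ : y - (y + z) = - z); last by rV_ring.
  by rewrite normrN ler_wpM2l// ltW.
(* The Lipschitz bound of [V] is available only near [S]: if one of the two values of [g] is
   nonzero, its argument lies in [S] and within [2 * de] of [y]; otherwise the difference is 0. *)
have [Fz|] := eqVneq (F (y + z)) 0; last first.
  move=> /gS Sp; apply: (key _ Sp).
  rewrite (_ : y - _ = V (y + z) - z); last by rV_ring.
  by apply: le_trans (ler_normB _ _) _; have := Vka (y + z); lra.
have [gz|] := eqVneq (g (y + z - V y)) 0.
  by rewrite Fz gz subrr normr0 !mulr_ge0// ltW.
move=> /gS Sp; apply: (key _ Sp).
rewrite (_ : y - _ = V y - z); last by rV_ring.
by apply: le_trans (ler_normB _ _) _; have := Vka y; lra.
Qed.

End displacement.

(** The case of zero displacement, where the Lipschitz constant [La] of the field, and with it the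
    error, is 0. *)
Let mollify_integral : 0 <= Lg ->
  \int[mu]_(y in Omega) g y =
  \int[mu]_(y in Omega) \int[mu]_(x in Omega) (eta (x - y) * g x).
Proof.
move=> Lg_ge0; have [ha hb] := conj e0 ede.
have := @mollify_displacement (fun=> 0) 0 0 (measurable_cst _).
move=> /(_ (fun y => _) _ (lexx _) Lg_ge0) h; apply/eqP; rewrite -subr_eq0 -normr_le0.
have := h; rewrite mul0r mulr0 mul0r.
have -> : \int[mu]_(y in Omega) g (y - 0) = \int[mu]_(y in Omega) g y.
  by apply: eq_Rintegral => y _; rewrite subr0.
have -> : \int[mu]_(y in Omega) \int[mu]_(x in Omega) (eta (x - y + 0) * g x) =
   \int[mu]_(y in Omega) \int[mu]_(x in Omega) (eta (x - y) * g x).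
  by apply: eq_Rintegral => y _; apply: eq_Rintegral => x _; rewrite addr0.
apply.
- by rewrite normr0.
- by lra.
- by move=> p x y _ _ _; rewrite subrr normr0 mul0r.
Qed.

Let mollify_pointwise : 0 <= Lg -> forall y,
  `|\int[mu]_(x in Omega) (g x * eta (y - x)) - g y| <= Lg * e.
Proof.
move=> Lg_ge0 y; have [ha hb] := conj e0 ede.
have bgy : bmf (fun z : 'rV[R]_m => g (z + y)).
  by apply: (bmf_comp bg); apply: measurable_rVD => //; exact: measurable_cst.
have -> : \int[mu]_(x in Omega) (g x * eta (y - x)) = \int[mu]_(z in Bz) (eta z * g (z + y)).
  rewrite -(@bint_translate R m (fun x => g x * eta (y - x)) Omega Bz y).
  - apply: eq_Rintegral => z _; rewrite mulrC; congr (_ * _).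
    by rewrite -(mol_even mol); congr eta; rV_ring.
  - apply: measurable_funM; first exact: bg.1.
    apply: (measurableT_comp bmf_eta.1).
    by apply: measurable_rVB => //; exact: measurable_cst.
  - move=> x; rewrite mulf_eq0 negb_or => /andP[/gS /hS + _]; apply.
    by rewrite subrr normr0; lra.
  - move=> z; rewrite mulf_eq0 negb_or => /andP[_].
    by rewrite (_ : y - (z + y) = - z) ?(mol_even mol); [exact: eta_neq0|rV_ring].
have e1 : g y = \int[mu]_(z in Bz) (eta z * g y).
  by rewrite (bintZr mB fB _ bmf_eta) (mol_int mol) mul1r.
rewrite [X in _ - X]e1 -(bintB mB fB).
- under eq_Rintegral do rewrite -mulrBr.
  apply: (bint_weight mB fB bmf_eta _ (mol_ge0 mol) (mol_int mol)).
    by apply: bmfB => //; exact: bmf_cst.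
  move=> z /= ze; apply: le_trans (gL _ _) _; rewrite addrK.
  by rewrite ler_wpM2l// ltW.
- exact: bmfM.
- by apply: bmfM => //; exact: bmf_cst.
Qed.

(* First-order expansion of the volume distortion of the displacement y |-> y - V y
   in terms of the weak divergence be of V. *)
Lemma displacement_estimate (V : 'rV[R]_m -> 'rV[R]_m) (ka La : R)
    (be : 'rV[R]_m -> R) (B : R) :
  0 <= Lg -> measurable_fun setT V -> (forall y, `|V y| <= ka) -> ka <= de -> 0 <= La ->
  (forall p x y, S p -> `|x - p| <= 4 * de -> `|y - p| <= 4 * de ->
    `|V x - V y| <= La * `|x - y|) ->
  bmf be -> (forall y, `|be y| <= B) ->
  (forall phi, test_function Omega phi -> bmf phi ->
    (forall i, bmf (fun y => grad phi y ord0 i)) ->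
    \int[mu]_(y in Omega) dot (V y) (grad phi y) =
    - \int[mu]_(y in Omega) (be y * phi y)) ->
  `|\int[mu]_(y in Omega) g (y - V y) - \int[mu]_(y in Omega) g y
    - \int[mu]_(y in Omega) (be y * g y)|
  <= (Lg * (La * e) + G * (C * ka ^+ 2 * M) + B * (Lg * e)) * M.
Proof.
move=> Lg_ge0 mV Vka kade La0 VL bbe beB wd.
have [ha hb] := conj e0 ede.
have ede4 : e <= 4 * de by lra.
have M0 : 0 <= M by rewrite fine_ge0.
have C0 : 0 <= C := taylor2_ge0 (mol_taylor mol).
have G0 : 0 <= G by apply: le_trans (gG 0).
have ka0 : 0 <= ka by apply: le_trans (Vka 0).
have mV2 : measurable_fun setT (fun p : 'rV[R]_m * 'rV[R]_m => V p.2) by exact: (measurableT_comp mV).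
have bg1 : bmf (fun p : 'rV[R]_m * 'rV[R]_m => g p.1) by exact: (bmf_comp bg).
have bbe2 : bmf (fun p : 'rV[R]_m * 'rV[R]_m => be p.2) by exact: (bmf_comp bbe).
have bk1 : bmf (fun p : 'rV[R]_m * 'rV[R]_m => eta (p.2 - p.1 - V p.2)).
  by apply: (bmf_comp bmf_eta); apply: measurable_rVB => //; exact: measurable_rVB.
have bk0 : bmf (fun p : 'rV[R]_m * 'rV[R]_m => eta (p.2 - p.1)).
  by apply: (bmf_comp bmf_eta); exact: measurable_rVB.
have swap (k : 'rV[R]_m * 'rV[R]_m -> R) : bmf k ->
    \int[mu]_(y in Omega) \int[mu]_(x in Omega) (g x * k (x, y)) =
    \int[mu]_(x in Omega) (g x * \int[mu]_(y in Omega) k (x, y)).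
  move=> bk; rewrite -(@bfubini _ _ _ _ R mu mu Omega Omega mO mO finO finO
    (fun p => g p.1 * k p)); last exact: bmfM.
  by apply: eq_Rintegral => x _ /=; rewrite bintZ//; exact: (bmf_sec1 x bk).
have bI (k : 'rV[R]_m * 'rV[R]_m -> R) : bmf k ->
    bmf (fun x => g x * \int[mu]_(y in Omega) k (x, y)).
  by move=> bk; apply: bmfM => //; exact: (bmf_int2 mO finO bk).
have bbk : bmf (fun p : 'rV[R]_m * 'rV[R]_m => be p.2 * eta (p.2 - p.1)) by exact: bmfM.
have bK1 : bmf (fun x : 'rV[R]_m => g x * \int[mu]_(y in Omega) eta (y - x - V y)) by exact: (bI _ bk1).
have bK0 : bmf (fun x : 'rV[R]_m => g x * \int[mu]_(y in Omega) eta (y - x)) by exact: (bI _ bk0).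
have bK2 : bmf (fun x : 'rV[R]_m => g x * \int[mu]_(y in Omega) (be y * eta (y - x))) by exact: (bI _ bbk).
have bd : bmf (fun p : 'rV[R]_m * 'rV[R]_m => dot (D (p.2 - p.1)) (V p.2)).
  apply: bmf_dot => i.
    by apply: (bmf_comp (bmf_D i)); exact: measurable_rVB.
  split; first exact: (measurableT_comp (@measurable_coord _ R m i) mV2).
  by exists ka => p; exact: le_trans (rV_coord_le _ _) (Vka _).
(* Exchanging the integrals freezes [x], so the expansion in [V y] acts on the function y |-> eta (y
   - x), a test function of [Omega] when [x] is in the support of [g]. The weak divergence takes
   care of its first-order term; only the quadratic remainder is left. *)
have T1 : `|\int[mu]_(x in Omega) (g x * \int[mu]_(y in Omega) eta (y - x - V y))
    - \int[mu]_(x in Omega) (g x * \int[mu]_(y in Omega) eta (y - x))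
    - \int[mu]_(x in Omega) (g x * \int[mu]_(y in Omega) (be y * eta (y - x)))|
    <= G * (C * ka ^+ 2 * M) * M.
  rewrite -(bintB mO finO bK1 bK0).
  apply: (bint_dist_le mO finO (bmfB bK1 bK0) bK2).
  move=> x _; rewrite -!mulrBr.
  have [gx|gx] := eqVneq (g x) 0.
    by rewrite gx mul0r normr0 !mulr_ge0// exprn_ge0.
  have Sx := gS gx.
  rewrite normrM; apply: ler_pM => //.
  have test : test_function Omega (fun y => eta (y - x)).
    by apply: (mol_test mol) => y yx; exact: hS Sx (le_trans yx ede4).
  have -> : \int[mu]_(y in Omega) (be y * eta (y - x)) =
      \int[mu]_(y in Omega) (- dot (D (y - x)) (V y)).
    have b2 : bmf (fun y : 'rV[R]_m => dot (D (y - x)) (V y)) by exact: (bmf_sec1 x bd).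
    rewrite (bintN mO finO b2).
    have gradE y i : grad (fun y => eta (y - x)) y ord0 i = D (y - x) ord0 i.
      by rewrite mxE; exact: (mol_partial mol).
    have bgrad i : bmf (fun y => grad (fun y => eta (y - x)) y ord0 i).
      under eq_fun do rewrite gradE.
      by apply: (bmf_comp (bmf_D i)); exact: measurable_translate_rV.
    have beta : bmf (fun y : 'rV[R]_m => eta (y - x)).
      by apply: (bmf_comp bmf_eta); exact: measurable_translate_rV.
    rewrite -[LHS]opprK -(wd _ test beta bgrad); congr (- _); apply: eq_Rintegral => y _.
    by rewrite dotC; congr dot; apply/rowP => i; rewrite gradE.
  have b1 : bmf (fun y : 'rV[R]_m => eta (y - x - V y)) by exact: (bmf_sec1 x bk1).
  have b0 : bmf (fun y : 'rV[R]_m => eta (y - x)) by exact: (bmf_sec1 x bk0).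
  have b2 : bmf (fun y : 'rV[R]_m => - dot (D (y - x)) (V y)) by apply: bmfN; exact: (bmf_sec1 x bd).
  rewrite -(bintB mO finO b1 b0); apply: (bint_dist_le mO finO (bmfB b1 b0) b2).
  move=> y _ /=; rewrite opprK.
  have := taylor2_expand (mol_taylor mol) (y - x) (- V y).
  rewrite dotNr opprK => h; apply: le_trans h _.
  by rewrite ler_wpM2l// normrN lerXn2r ?nnegrE.
have bg0 : bmf (fun y : 'rV[R]_m => \int[mu]_(x in Omega) (g x * eta (y - x))).
  exact: (bmf_int1 mO finO (bmfM bg1 bk0)).
have T2 : `|\int[mu]_(y in Omega) (be y * \int[mu]_(x in Omega) (g x * eta (y - x)))
     - \int[mu]_(y in Omega) (be y * g y)| <= B * (Lg * e) * M.
  apply: (bint_dist_le mO finO (bmfM bbe bg0) (bmfM bbe bg)).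
  move=> y _; rewrite -mulrBr normrM; apply: ler_pM => //.
  exact: mollify_pointwise.
have E1 := mollify_displacement mV Vka kade La0 Lg_ge0 VL.
have E0 := mollify_integral Lg_ge0.
have e1 : \int[mu]_(y in Omega) \int[mu]_(x in Omega) (eta (x - y + V y) * g x) =
    \int[mu]_(x in Omega) (g x * \int[mu]_(y in Omega) eta (y - x - V y)).
  apply: etrans (swap (fun p => eta (p.2 - p.1 - V p.2)) bk1).
  apply: eq_Rintegral => y _; apply: eq_Rintegral => x _ /=.
  by rewrite mulrC -[in LHS](mol_even mol); congr (_ * eta _); rV_ring.
have e2 : \int[mu]_(y in Omega) \int[mu]_(x in Omega) (eta (x - y) * g x) =
    \int[mu]_(x in Omega) (g x * \int[mu]_(y in Omega) eta (y - x)).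
  apply: etrans (swap (fun p => eta (p.2 - p.1)) bk0).
  apply: eq_Rintegral => y _; apply: eq_Rintegral => x _ /=.
  by rewrite mulrC -[in LHS](mol_even mol); congr (_ * eta _); rV_ring.
have e3 : \int[mu]_(y in Omega) (be y * \int[mu]_(x in Omega) (g x * eta (y - x))) =
    \int[mu]_(x in Omega) (g x * \int[mu]_(y in Omega) (be y * eta (y - x))).
  apply: etrans (swap (fun p => be p.2 * eta (p.2 - p.1)) bbk).
  apply: eq_Rintegral => y _ /=.
  have b2 : bmf (fun x : 'rV[R]_m => g x * eta (y - x)) by apply: bmfM => //; exact: (bmf_sec2 y bk0).
  rewrite -(bintZ mO finO (be y) b2).
  by apply: eq_Rintegral => x _; rewrite mulrCA.
move: E1 T1 T2; rewrite e1 {e1} E0 e2 {E0 e2} e3 {e3}.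
set A1 := \int[mu]_(y in Omega) g (y - V y).
set J1 := \int[mu]_(x in Omega) _; set J0 := \int[mu]_(x in Omega) _.
set J2 := \int[mu]_(x in Omega) _; set A2 := \int[mu]_(y in Omega) _.
move: A1 J1 J0 J2 A2 => A1 J1 J0 J2 A2 E1 T1 T2.
(* In order: the cost of mollifying, the Taylor remainder, and the replacement of the mollified [g]
   by [g] against [be]. *)
have -> : A1 - J0 - A2 = (A1 - J1) + (J1 - J0 - J2) + (J2 - A2) by ring.
apply: le_trans (ler_normD _ _) _; apply: le_trans (lerD (ler_normD _ _) (lexx _)) _.
rewrite !mulrDl; apply: lerD => //; exact: lerD.
Qed.

End lipschitz_density.

End static_estimate.

(** * Lipschitz bounds from weak gradients *)

Section lipschitz_estimate.
Context {R : realType} {m : nat}.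
Variables (Omega : set 'rV[R]_m) (mO : measurable Omega).
Hypothesis finO : (lebesgue_rV m Omega < +oo)%E.
Notation mu := (lebesgue_rV m).
Notation M := (fine (mu Omega)).
Variables (f : 'rV[R]_m -> R) (Gf : 'I_m -> 'rV[R]_m -> R) (Mf Mg : R).
Hypotheses (bf : bmf f) (fM : forall x, `|f x| <= Mf).
Hypotheses (bG : forall j, bmf (Gf j)) (GM : forall j x, `|Gf j x| <= Mg).
Hypothesis wg : forall phi, test_function Omega phi -> forall j,
  \int[mu]_(x in Omega) (f x * partial j phi x) = - \int[mu]_(x in Omega) (Gf j x * phi x).

Section fixed_mollifier.
Variables (e : R) (eta : 'rV[R]_m -> R) (D : 'rV[R]_m -> 'rV[R]_m) (C : R).
Hypotheses (e0 : 0 < e) (mol : mollifier e eta D C).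
Notation Bz := [set z : 'rV[R]_m | `|z| < e].

Let bmf_eta : bmf eta.
Proof. by have t := mol_taylor mol; split; [exact: taylor2_meas t|exists C; exact: taylor2_bound t]. Qed.

Let bmf_D i : bmf (fun x => D x ord0 i).
Proof.
have t := mol_taylor mol; split; first exact: taylor2_measD t i.
by exists C => x; exact: le_trans (rV_coord_le _ _) (taylor2_boundD t x).
Qed.

Let eta_neq0 z : eta z != 0 -> `|z| <= e.
Proof. by move=> h; rewrite leNgt; apply/negP => /ltW/(mol_supp mol) ez; rewrite ez eqxx in h. Qed.

Let mB : measurable Bz. Proof. exact: measurable_ball0. Qed.

Let fB : (mu Bz < +oo)%E. Proof. by rewrite lebesgue_ball0// ltry. Qed.

Let F p := \int[mu]_(y in Omega) (f y * eta (y - p)).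

Let msub p : measurable_fun setT (fun y : 'rV[R]_m => y - p).
Proof. exact: measurable_translate_rV. Qed.

Let bsub p : bmf (fun y : 'rV[R]_m => eta (y - p)).
Proof. by apply: (bmf_comp bmf_eta); exact: msub. Qed.

Let eta_int p : (forall y, `|y - p| <= e -> Omega y) ->
  \int[mu]_(y in Omega) eta (y - p) = 1.
Proof.
move=> hp; rewrite -(mol_int mol); apply: bint_translate.
- exact: bmf_eta.1.
- move=> y h; rewrite /= ltNge; apply/negP => /(mol_supp mol) ey.
  by rewrite ey eqxx in h.
- by move=> y /eta_neq0 h; exact: hp.
Qed.

(** Moving [p] moves only [eta]. The first-order term involves partial derivatives of a test
    function, hence averages of the weak gradient with weight [eta]; the remainder is quadratic in
    [k], with a constant depending on the mollifier. *)
Lemma mollified_increment p k : (forall y, `|y - p| <= e -> Omega y) ->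
  `|F (p + k) - F p| <= m%:R * (`|k| * Mg) + Mf * (C * `|k| ^+ 2) * M.
Proof.
move=> hp.
have bd j : bmf (fun y : 'rV[R]_m => D (y - p) ord0 j).
  by apply: (bmf_comp (bmf_D j)); exact: msub.
have bdot : bmf (fun y : 'rV[R]_m => f y * dot (D (y - p)) k).
  apply: bmfM => //; apply: bmf_sum => j _; apply: bmfM => //; exact: bmf_cst.
have test := mol_test mol hp.
have E : \int[mu]_(y in Omega) (f y * dot (D (y - p)) k) =
    - \sum_j k ord0 j * \int[mu]_(y in Omega) (eta (y - p) * Gf j y).
  transitivity (\int[mu]_(y in Omega) (\sum_j k ord0 j * (f y * D (y - p) ord0 j))).
    apply: eq_Rintegral => y _; rewrite /dot mulr_sumr; apply: eq_bigr => j _.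
    by rewrite mulrA mulrC.
  rewrite bint_sum//; last by move=> j _; apply: bmfZ; exact: bmfM.
  rewrite -sumrN; apply: eq_bigr => j _.
  have b1 : bmf (fun y : 'rV[R]_m => f y * D (y - p) ord0 j) by exact: bmfM.
  rewrite (bintZ mO finO _ b1) -mulrN; congr (_ * _).
  transitivity (\int[mu]_(y in Omega) (f y * partial j (fun y => eta (y - p)) y)).
    by apply: eq_Rintegral => y _; rewrite (mol_partial mol).
  by rewrite (wg test); congr (- _); apply: eq_Rintegral => y _; rewrite mulrC.
have S1 : `|\int[mu]_(y in Omega) (f y * dot (D (y - p)) k)| <= m%:R * (`|k| * Mg).
  rewrite E normrN; apply: le_trans (ler_norm_sum _ _ _) _.
  rewrite mulr_natl -[X in _ *+ X]card_ord -sumr_const; apply: ler_sum => j _.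
  rewrite normrM; apply: ler_pM => //; first exact: rV_coord_le.
  apply: (bint_weight mO finO (bsub p) (bG j)) => //; last exact: eta_int.
  by move=> x; exact: mol_ge0 mol _.
have b1 : bmf (fun y : 'rV[R]_m => f y * eta (y - (p + k))) by exact: bmfM.
have b0 : bmf (fun y : 'rV[R]_m => f y * eta (y - p)) by exact: bmfM.
have S2 : `|F (p + k) - F p - \int[mu]_(y in Omega) (- (f y * dot (D (y - p)) k))|
    <= Mf * (C * `|k| ^+ 2) * M.
  rewrite /F -(bintB mO finO b1 b0).
  apply: (bint_dist_le mO finO (bmfB b1 b0) (bmfN bdot)) => y _.
  rewrite -mulrBr opprK -mulrDr normrM; apply: ler_pM => //.
  have := taylor2_expand (mol_taylor mol) (y - p) (- k).
  by rewrite dotNr opprK normrN (_ : y - (p + k) = y - p - k)// opprD addrA.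
move: S1 S2; rewrite (bintN mO finO bdot) {E}.
move: (F (p + k)) (F p) (\int[mu]_(y in Omega) _) => a b c S1 S2.
rewrite opprK in S2.
have -> : a - b = (a - b + c) - c by ring.
by apply: le_trans (ler_normB _ _) _; rewrite addrC; exact: lerD.
Qed.

(** Cut the segment into N+1 equal steps: the linear terms add up to the claimed bound and the
    quadratic errors to K/(N+1), which vanishes as N grows. The ball of radius [r] contains the
    segment with its e-neighbourhood. *)
Lemma mollified_lipschitz x y r : (forall z, `|z - x| < r -> Omega z) ->
  `|y - x| + e < r -> `|F y - F x| <= m%:R * (`|y - x| * Mg).
Proof.
move=> hr yr.
pose K := Mf * (C * `|y - x| ^+ 2) * M.
have K0 : 0 <= K.
  rewrite /K !mulr_ge0 ?exprn_ge0 ?fine_ge0//; first by apply: le_trans (fM 0).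
  exact: taylor2_ge0 (mol_taylor mol).
suff H (N : nat) : `|F y - F x| <= m%:R * (`|y - x| * Mg) + K * N.+1%:R^-1.
  apply/ler_addgt0Pr => t t0.
  have [N hN] : exists N : nat, K * N.+1%:R^-1 < t.
    exists (Num.truncn (K / t)); rewrite ltr_pdivrMr// mulrC -ltr_pdivrMr//.
    exact: truncnS_gt.
  by apply: le_trans (H N) _; rewrite lerD2l ltW.
pose k := N.+1%:R^-1 *: (y - x).
have nk : `|k| = N.+1%:R^-1 * `|y - x| by rewrite normrZ ger0_norm// invr_ge0 ltW.
pose p (l : nat) := x + l%:R *: k.
have step l : (l <= N)%N -> `|F (p l.+1) - F (p l)| <=
    N.+1%:R^-1 * (m%:R * (`|y - x| * Mg) + K * N.+1%:R^-1).
  move=> lN; rewrite (_ : p l.+1 = p l + k); last first.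
    by rewrite /p -addrA -[X in _ + (_ + X)]scale1r -scalerDl -natr1.
  have hpl z : `|z - p l| <= e -> Omega z.
    move=> ze; apply: hr; apply: le_lt_trans yr.
    have -> : z - x = (p l - x) + (z - p l) by rV_ring.
    apply: le_trans (ler_normD _ _) _; apply: lerD => //.
    have -> : p l - x = l%:R *: k by rewrite /p addrAC subrr add0r.
    rewrite normrZ nk mulrA -[leRHS]mul1r ler_wpM2r//.
    rewrite ger0_norm ?ler0n// ler_pdivrMr// mul1r ler_nat; exact: leqW.
  apply: le_trans (mollified_increment k hpl) _; rewrite nk /K.
  rewrite le_eqVlt; apply/orP; left; apply/eqP; ring.
have sum l : (l <= N.+1)%N -> `|F (p l) - F (p 0%N)| <=
    l%:R * (N.+1%:R^-1 * (m%:R * (`|y - x| * Mg) + K * N.+1%:R^-1)).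
  elim: l => [_|l ih lN]; first by rewrite subrr normr0 mul0r.
  have tri (a b c : R) : a - c = (a - b) + (b - c) by ring.
  rewrite (tri _ (F (p l))).
  apply: le_trans (ler_normD _ _) _; rewrite -natr1 mulrDl mul1r addrC; apply: lerD.
    by apply: ih; exact: ltnW.
  exact: step.
have := sum _ (leqnn _); rewrite mulrA divff ?gt_eqF// mul1r.
rewrite /p scale0r addr0 /k scalerA divff ?gt_eqF// scale1r.
by rewrite addrCA subrr addr0.
Qed.

Lemma mollified_close x t : (forall y, `|y - x| <= e -> Omega y) ->
  (forall y, `|y - x| < e -> `|f y - f x| <= t) -> `|F x - f x| <= t.
Proof.
move=> hx ft.
have bfx : bmf (fun z : 'rV[R]_m => f (z + x)).
  by apply: (bmf_comp bf); exact: measurable_translate_rV.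
have -> : F x = \int[mu]_(z in Bz) (eta z * f (z + x)).
  rewrite /F -(@bint_translate R m (fun y => f y * eta (y - x)) Omega Bz x).
  - by apply: eq_Rintegral => z _; rewrite addrK mulrC.
  - by apply: measurable_funM; [exact: bf.1|exact: (bsub x).1].
  - by move=> y; rewrite mulf_eq0 negb_or => /andP[_ /eta_neq0]; exact: hx.
  - move=> z; rewrite mulf_eq0 negb_or addrK => /andP[_ h] /=.
    by rewrite ltNge; apply/negP => /(mol_supp mol) ey; rewrite ey eqxx in h.
have e1 : f x = \int[mu]_(z in Bz) (eta z * f x).
  by rewrite (bintZr mB fB _ bmf_eta) (mol_int mol) mul1r.
have b1 : bmf (fun z : 'rV[R]_m => eta z * f (z + x)) by exact: bmfM.
have b2 : bmf (fun z : 'rV[R]_m => eta z * f x) by apply: bmfM => //; exact: bmf_cst.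
rewrite [X in _ - X]e1 -(bintB mB fB b1 b2) {e1}.
under eq_Rintegral do rewrite -mulrBr.
apply: (bint_weight mB fB bmf_eta (bmfB bfx (bmf_cst _ _)) (mol_ge0 mol) (mol_int mol)).
by move=> z /= ze; apply: ft; rewrite addrK.
Qed.

End fixed_mollifier.

(** The Lipschitz constant of the mollified function does not depend on the radius, so it survives
    the limit, taken at the two points [x] and [y] only. The estimate is confined to a ball because
    [Omega] need not be convex. *)
Lemma weak_gradient_lipschitz : {in Omega, continuous f} ->
  forall x r y, (forall z, `|z - x| < r -> Omega z) -> `|y - x| < r ->
  `|f y - f x| <= m%:R * Mg * `|y - x|.
Proof.
move=> cf x r y hr yr; apply/ler_addgt0Pr => t t0.
have t20 : 0 < t / 2 by rewrite divr_gt0.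
have Ox : Omega x by apply: hr; rewrite subrr normr0; exact: le_lt_trans yr.
have Oy : Omega y by exact: hr.
have /cvg_distP/(_ _ t20)[d1 d10 h1] := cf _ (mem_set Ox).
have /cvg_distP/(_ _ t20)[d2 d20 h2] := cf _ (mem_set Oy).
pose e := Num.min (Num.min d1 d2) ((r - `|y - x|) / 2).
have yr0 : 0 < r - `|y - x| by rewrite subr_gt0.
have e0 : 0 < e by rewrite !lt_min d10 d20 divr_gt0.
have e1 : e <= d1 by rewrite /e !ge_min lexx.
have e2 : e <= d2 by rewrite /e !ge_min lexx orbT.
have e3 : e <= (r - `|y - x|) / 2 by rewrite /e ge_min lexx orbT.
have er : `|y - x| + e < r by lra.
have [eta [D [C mol]]] := @ex_mollifier R m e e0.
have L := mollified_lipschitz mol hr er.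
have Cx : `|\int[mu]_(z in Omega) (f z * eta (z - x)) - f x| <= t / 2.
  apply: (mollified_close e0 mol) => z zx.
    by apply: hr; apply: le_lt_trans zx _; apply: le_lt_trans er; rewrite lerDr.
  by apply: ltW; apply: h1; exact: lt_le_trans e1.
have Cy : `|\int[mu]_(z in Omega) (f z * eta (z - y)) - f y| <= t / 2.
  apply: (mollified_close e0 mol) => z zy.
    apply: hr; apply: le_lt_trans er; have -> : z - x = (y - x) + (z - y) by rV_ring.
    by apply: le_trans (ler_normD _ _) _; rewrite lerD2l.
  by apply: ltW; apply: h2; exact: lt_le_trans e2.
move: L Cx Cy; set a := \int[mu]_(z in Omega) _; set b := \int[mu]_(z in Omega) _.
move: a b => a b L Ca Cb.
have -> : f y - f x = (a - b) + (b - f x) - (a - f y) by ring.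
apply: le_trans (ler_normB _ _) _; apply: le_trans (lerD (ler_normD _ _) (lexx _)) _.
by rewrite mulrAC -mulrA; lra.
Qed.

End lipschitz_estimate.

(** Meant for the velocity along a trajectory, before its measurability is known. The integrals of
    the positive and negative parts both lie between 0 and C mu(D), so their difference is at most C
    mu(D) in absolute value. *)
Lemma Rintegral_norm_le_any d (T : measurableType d) (R : realType)
    (mu : {measure set T -> \bar R}) (D : set T) (f : T -> R) (C : R) :
  measurable D -> (mu D < +oo)%E -> 0 <= C -> (forall x, D x -> `|f x| <= C) ->
  `|\int[mu]_(x in D) f x| <= C * fine (mu D).
Proof.
move=> mD fD C0 fC; rewrite /Rintegral integralE.
have key (g : T -> \bar R) : (forall x, D x -> (0 <= g x)%E) ->
    (forall x, D x -> (g x <= C%:E)%E) ->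
    (0 <= \int[mu]_(x in D) g x <= (C * fine (mu D))%:E)%E.
  move=> g0 gC; rewrite integral_ge0//=.
  apply: (@le_trans _ _ (\int[mu]_(x in D) (cst C%:E x))%E).
    by apply: ae_le_ge0_integral; [exact: g0|move=> x _; rewrite lee_fin|exact: aeW].
  by rewrite integral_cst// EFinM fineK// ge0_fin_numE.
have /andP[p0 pC] : (0 <= \int[mu]_(x in D) (EFin \o f)^\+ x <= (C * fine (mu D))%:E)%E.
  apply: key => // x Dx; rewrite funeposE ge_max lee_fin /=.
  by rewrite (le_trans (ler_norm _) (fC x Dx)) lee_fin.
have /andP[n0 nC] : (0 <= \int[mu]_(x in D) (EFin \o f)^\- x <= (C * fine (mu D))%:E)%E.
  apply: key => // x Dx; rewrite funenegE ge_max -EFinN lee_fin /=.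
  by rewrite (le_trans (ler_norm _)) ?lee_fin// normrN fC.
have pf : (\int[mu]_(x in D) (EFin \o f)^\+ x)%E \is a fin_num.
  by rewrite ge0_fin_numE// (le_lt_trans pC)// ltry.
have nf : (\int[mu]_(x in D) (EFin \o f)^\- x)%E \is a fin_num.
  by rewrite ge0_fin_numE// (le_lt_trans nC)// ltry.
rewrite fineB//; move: p0 pC n0 nC; rewrite -(fineK pf) -(fineK nf) !lee_fin.
move: (fine _) (fine _) (C * _) => a b c h1 h2 h3 h4.
by rewrite ler_norml /=; apply/andP; split; lra.
Qed.

Lemma maxr_lip (R : realType) (c a b : R) : `|Num.max c a - Num.max c b| <= `|a - b|.
Proof.
rewrite !maxEle; case: (leP c a) => h1; case: (leP c b) => h2; rewrite ?subrr ?normr0 ?normr_ge0//.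
  by rewrite [leRHS]ger0_norm ?ger0_norm; lra.
by rewrite [leRHS]ler0_norm ?ler0_norm; lra.
Qed.

Lemma minr_lip (R : realType) (c a b : R) : `|Num.min c a - Num.min c b| <= `|a - b|.
Proof.
rewrite !minEle; case: (leP c a) => h1; case: (leP c b) => h2; rewrite ?subrr ?normr0 ?normr_ge0//.
  by rewrite [leRHS]ger0_norm ?ger0_norm; lra.
by rewrite [leRHS]ler0_norm ?ler0_norm; lra.
Qed.

(** * Regular flows and Liouville's equation *)

Section time_integrals.
Context {R : realType}.
Notation leb := (@lebesgue_measure R).

Lemma leb_itv (a b : R) : a <= b -> leb `[a, b]%classic = (b - a)%:E.
Proof.
rewrite le_eqVlt => /predU1P[->|ab]; first by rewrite set_itv1 lebesgue_measure_set1 subrr.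
by rewrite lebesgue_measure_itv /= lte_fin ab -EFinB.
Qed.

Lemma leb_itv_fin (a b : R) : (leb `[a, b]%classic < +oo)%E.
Proof. by rewrite lebesgue_measure_itv /=; case: ifP => _; rewrite ?ltry. Qed.

Lemma fine_leb_itv (a b : R) : a <= b -> fine (leb `[a, b]%classic) = b - a.
Proof. by move=> ab; rewrite leb_itv. Qed.

Lemma bint_itv_split (f : R -> R) (a b c : R) : bmf (T := measurableTypeR R) f ->
  a <= b -> b <= c ->
  \int[leb]_(r in `[a, c]) f r = \int[leb]_(r in `[a, b]) f r + \int[leb]_(r in `[b, c]) f r.
Proof.
move=> bf ab bc.
have If (i : interval R) : (leb [set` i] < +oo)%E -> leb.-integrable [set` i] (EFin \o f).
  by move=> fi; apply: bmf_integrable => //; exact: measurable_itv.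
apply/eqP; rewrite addrC -subr_eq; apply/eqP.
rewrite (@Rintegral_itvB _ f (BLeft a) (BRight c) b).
- by apply: Rintegral_itv_obnd_cbnd; apply: If; rewrite lebesgue_measure_itv /=; case: ifP => _; rewrite ?ltry.
- by apply: If; exact: leb_itv_fin.
- by rewrite bnd_simp.
- by rewrite bnd_simp.
Qed.

(** Composing [f] with the projection [cl] of the line onto [0, T], which is 1-Lipschitz, gives a
    function with zero two-sided derivative everywhere. *)
Lemma zero_derivative_constant (f : R -> R) (T : R) : 0 <= T ->
  (forall t, 0 <= t <= T -> forall e, 0 < e -> exists2 d : R, 0 < d &
     forall s, 0 <= s <= T -> `|s - t| < d -> `|f s - f t| <= e * `|s - t|) ->
  f T = f 0.
Proof.
move=> T0 hf.
pose cl (t : R) := Num.min T (Num.max 0 t).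
have cl_in t : 0 <= cl t <= T.
  by rewrite /cl ge_min lexx /= andbT le_min T0 le_max lexx.
have cl_lip s t : `|cl s - cl t| <= `|s - t|.
  exact: le_trans (minr_lip _ _ _) (maxr_lip _ _ _).
have clT : cl T = T by rewrite /cl max_r// minxx.
have cl0 : cl 0 = 0 by rewrite /cl maxxx min_r.
rewrite -clT -[in RHS]cl0; apply: (@is_derive_0_is_cst _ (f \o cl)) => t.
apply/is_derive1_distP => e e0; have [d d0 hd] := hf _ (cl_in t) e e0.
exists d => // h hh /=; rewrite mulr0 subr0.
have ch : `|cl (t + h) - cl t| <= `|h|.
  by have := cl_lip (t + h) t; rewrite addrAC subrr add0r.
apply: le_trans (hd _ (cl_in _) _) _; first exact: le_lt_trans hh.
by rewrite ler_wpM2l// ltW.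
Qed.

End time_integrals.

Section compact_margin.
Context {R : realType} {m : nat}.

(** Each point has a margin valid on a neighbourhood; compactness, in its near-covering form, makes
    it uniform. *)
Lemma compact_margin (K Omega : set 'rV[R]_m) : compact K -> open Omega ->
  K `<=` Omega -> exists2 c : R, 0 < c & forall p y, K p -> `|y - p| <= c -> Omega y.
Proof.
move=> /compact_near_coveringP cK oO KO.
pose P (c : R) (p : 'rV[R]_m) := forall y, `|y - p| <= c -> Omega y.
have : \forall c \near (0 : R)^'+, forall p, K p -> P c p.
  apply: cK => p Kp.
  have /open_ballP/(_ p (KO p Kp))[e e0 he] := oO.
  have e20 : 0 < e / 2 by rewrite divr_gt0.
  exists ([set q : 'rV[R]_m | `|q - p| < e / 2], [set c : R | c < e / 2]) => /=.
    split; last by apply: nbhs_right_lt.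
    apply/nbhs_ballP; exists (e / 2) => //= q; rewrite -ball_normE /= distrC; exact.
  move=> [q c] /= [qp ce] y yq; apply: he.
  have -> : y - p = (y - q) + (q - p) by rV_ring.
  apply: le_lt_trans (ler_normD _ _) _; lra.
move=> H; have [c [c0 hc]] : exists c : R, 0 < c /\ forall p, K p -> P c p.
  have [c hc] : exists c : R, (0 < c) /\ (forall p, K p -> P c p).
    near (0 : R)^'+ => c; exists c; split; first by [].
    by near: c.
  by exists c.
by exists c => // p y Kp; exact: hc.
Unshelve. all: by end_near. Qed.

End compact_margin.

Section time_dependent_maps.
Context {R : realType} {m : nat}.
Variables (Omega : set 'rV[R]_m) (oO : open Omega).

Definition rat_seq (k : nat) : 'rV[R]_m :=
  if unpickle k is Some q then rat_rV q else 0.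

Lemma rat_seq_dense x (e : R) : 0 < e -> exists k, `|x - rat_seq k| < e.
Proof.
by move=> /(rat_rV_dense x)[q hq]; exists (pickle q); rewrite /rat_seq pickleK.
Qed.

(** A total map, so that measurability can be stated on the whole of space-time: negative times are
    replaced by 0, and points outside [Omega] are sent to 0. *)
Definition extend (P : R -> 'rV[R]_m -> 'rV[R]_m) (s : R) (x : 'rV[R]_m) : 'rV[R]_m :=
  if x \in Omega then P (Num.max s 0) x else 0.

Lemma extendE P s x : 0 <= s -> Omega x -> extend P s x = P s x.
Proof. by move=> s0 Ox; rewrite /extend mem_set// max_l. Qed.

Variable P : R -> 'rV[R]_m -> 'rV[R]_m.
Hypothesis P_lip : forall t, 0 <= t -> exists2 L : R, 0 <= L &
  forall x y, Omega x -> Omega y -> `|P t x - P t y| <= L * `|x - y|.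
Hypothesis P_time : forall t x, 0 <= t -> Omega x -> exists2 C : R, 0 <= C &
  forall s, 0 <= s -> `|s - t| <= 1 -> `|P s x - P t x| <= C * `|s - t|.

(** Joint measurability comes from continuity in [x] at each time and continuity in time at the
    points of a dense sequence. *)
Lemma measurable_extend :
  measurable_fun setT (fun p : measurableTypeR R * 'rV[R]_m => extend P p.1 p.2).
Proof.
apply/measurable_fun_coordP => i.
rewrite (_ : (fun p => _) = (fun p : measurableTypeR R * 'rV[R]_m =>
   extend P p.1 p.2 ord0 i * \1_Omega p.2)); last first.
  apply/funext => -[s x] /=; rewrite indicE /extend.
  by case: ifPn => _; rewrite ?mulr1// mxE mul0r.
apply: (@measurable_fun_caratheodory _ (measurableTypeR R) R m Omega oO rat_seq
  (fun x _ e e0 => rat_seq_dense x e0) (fun s x => extend P s x ord0 i)).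
- move=> k; have [Oq|nOq] := pselect (Omega (rat_seq k)); last first.
    rewrite (_ : (fun s => _) = cst 0); first exact: measurable_cst.
    by apply/funext => s; rewrite /extend memNset// mxE.
  apply: continuous_measurable_fun => t; apply/cvg_distP => e e0.
  rewrite /extend mem_set//.
  have t0 : 0 <= Num.max t 0 by rewrite le_max lexx orbT.
  have [C C0 hC] := P_time t0 Oq.
  exists (Num.min 1 (e / (C + 1))) => [|s].
    by rewrite lt_min ltr01 divr_gt0//; lra.
  rewrite lt_min => /andP[s1 s2].
  have lip : `|Num.max s 0 - Num.max t 0| <= `|s - t|.
    by rewrite ![Num.max _ 0]maxC; exact: maxr_lip.
  have s0 : 0 <= Num.max s 0 by rewrite le_max lexx orbT.
  have := hC _ s0 (le_trans lip (ltW s1)).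
  have := rV_coord_le (P (Num.max s 0) (rat_seq k) - P (Num.max t 0) (rat_seq k)) i.
  rewrite !mxE; move: s2; rewrite ltr_pdivlMr; last lra.
  have := normr_ge0 (s - t) => a1 a2 a3 a4.
  apply: le_lt_trans a3 _; apply: le_lt_trans a4 _.
  have : C * `|Num.max s 0 - Num.max t 0| <= C * `|s - t| by rewrite ler_wpM2l.
  have [->|st] := eqVneq `|s - t| 0; first by rewrite mulr0; lra.
  have : 0 < `|s - t| by rewrite lt_neqAle eq_sym st.
  nra.
- move=> s x; rewrite inE => Ox; apply/cvg_distP => e e0.
  have t0 : 0 <= Num.max s 0 by rewrite le_max lexx orbT.
  have [L L0 hL] := P_lip t0.
  have /open_ballP/(_ x Ox)[r r0 hr] := oO.
  exists (Num.min r (e / (L + 1))) => [|y].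
    by rewrite lt_min r0 divr_gt0//; lra.
  rewrite lt_min => /andP[y1 y2]; rewrite /extend !mem_set//; last exact: hr.
  have := hL y x (hr _ y1) Ox.
  have := rV_coord_le (P (Num.max s 0) y - P (Num.max s 0) x) i.
  rewrite !mxE; move: y2; rewrite ltr_pdivlMr; last lra.
  have := normr_ge0 (y - x) => a1 a2 a3 a4.
  apply: le_lt_trans a3 _; apply: le_lt_trans a4 _; rewrite mulrC.
  by nra.
Qed.

End time_dependent_maps.

Section regular_flows.
Context {R : realType} {m : nat}.
Notation leb := (@lebesgue_measure R).
Notation mu := (lebesgue_rV m).

(** A Borel field with every condition imposed at each time, exceptional times having been removed
    beforehand. The Lipschitz bound is only asked inside balls contained in [Omega]. *)
Record regular_field (Omega : set 'rV[R]_m) (v : R -> 'rV[R]_m -> 'rV[R]_m)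
    (d : R -> 'rV[R]_m -> R) (Dm : R) : Prop := {
  rf_meas : measurable_fun setT (fun p : measurableTypeR R * 'rV[R]_m => v p.1 p.2);
  rf_measd : measurable_fun setT (fun p : measurableTypeR R * 'rV[R]_m => d p.1 p.2);
  rf_d : forall s x, `|d s x| <= Dm;
  rf_bound : forall T : R, exists2 M : R, 0 <= M & forall s x, s <= T -> `|v s x| <= M;
  rf_lip : forall T : R, exists2 L : R, 0 <= L & forall s x r y, s <= T ->
    (forall z, `|z - x| < r -> Omega z) -> `|y - x| < r -> `|v s y - v s x| <= L * `|y - x|;
  rf_div : forall s phi, test_function Omega phi ->
    \int[mu]_(x in Omega) dot (v s x) (grad phi x) = - \int[mu]_(x in Omega) (d s x * phi x)
}.

(** [Y t] stands for X(t; 0, .) and [Z t] for its inverse X(0; t, .). *)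
Record regular_flow (Omega : set 'rV[R]_m) (v Y Z : R -> 'rV[R]_m -> 'rV[R]_m) : Prop := {
  fl_init : forall x, Omega x -> Y 0 x = x;
  fl_Y : forall t x, 0 <= t -> Omega x -> Omega (Y t x);
  fl_Z : forall t x, 0 <= t -> Omega x -> Omega (Z t x);
  fl_YZ : forall t x, 0 <= t -> Omega x -> Y t (Z t x) = x;
  fl_ZY : forall t x, 0 <= t -> Omega x -> Z t (Y t x) = x;
  fl_ode : forall x a b, Omega x -> 0 <= a -> a <= b -> forall i,
    Y b x ord0 i - Y a x ord0 i = \int[leb]_(r in `[a, b]) v r (Y r x) ord0 i;
  fl_lipY : forall t, 0 <= t -> exists2 L : R, 0 <= L &
    forall x y, Omega x -> Omega y -> `|Y t x - Y t y| <= L * `|x - y|;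
  fl_lipZ : forall t, 0 <= t -> exists2 L : R, 0 <= L &
    forall x y, Omega x -> Omega y -> `|Z t x - Z t y| <= L * `|x - y|
}.

Variables (Omega : set 'rV[R]_m) (oO : open Omega) (finO : (mu Omega < +oo)%E).
Variables (v Y Z : R -> 'rV[R]_m -> 'rV[R]_m) (d : R -> 'rV[R]_m -> R) (Dm : R).
Hypotheses (rf : regular_field Omega v d Dm) (fl : regular_flow Omega v Y Z).

Lemma flow_speed (T M : R) : 0 <= M -> (forall s x, s <= T -> `|v s x| <= M) ->
  forall a b x, 0 <= a <= T -> 0 <= b <= T -> Omega x -> `|Y b x - Y a x| <= M * `|b - a|.
Proof.
move=> M0 hM; suff H a b x : 0 <= a -> a <= b -> b <= T -> Omega x ->
    `|Y b x - Y a x| <= M * `|b - a|.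
  move=> a b x /andP[a0 aT] /andP[b0 bT] Ox; have [ab|/ltW ba] := leP a b; first exact: H.
  by rewrite distrC [`|b - a|]distrC; exact: H.
move=> a0 ab bT Ox; apply: rV_norm_le => [|i]; first by rewrite mulr_ge0.
rewrite !mxE (fl_ode fl Ox a0 ab) [X in _ * X]ger0_norm ?subr_ge0// -(fine_leb_itv ab).
apply: Rintegral_norm_le_any => //; first exact: leb_itv_fin.
move=> r /=; rewrite in_itv /= => /andP[_ rb]; apply: le_trans (rV_coord_le _ _) _.
by apply: hM; exact: le_trans bT.
Qed.

(** With [x = Z s y], the two points are the images under [Z t] of [Y t x] and of [Y s x = y], which
    are close by the speed bound; no equation for [Z] itself is used. *)
Lemma inverse_flow_speed (T M L t : R) : 0 <= M -> (forall s x, s <= T -> `|v s x| <= M) ->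
  0 <= t <= T -> (forall x y, Omega x -> Omega y -> `|Z t x - Z t y| <= L * `|x - y|) ->
  0 <= L -> forall s y, 0 <= s <= T -> Omega y -> `|Z s y - Z t y| <= L * (M * `|s - t|).
Proof.
move=> M0 hM tT hL L0 s y sT Oy.
have [t0 s0] : 0 <= t /\ 0 <= s by case/andP: tT => -> _; case/andP: sT => ->.
have Ox := fl_Z fl s0 Oy.
rewrite -{1}(fl_ZY fl t0 Ox); apply: le_trans (hL _ _ (fl_Y fl t0 Ox) Oy) _.
rewrite ler_wpM2l// -{2}(fl_YZ fl s0 Oy) [`|s - t|]distrC.
exact: (flow_speed M0 hM sT tT Ox).
Qed.

Lemma flow_time t x : 0 <= t -> Omega x -> exists2 C : R, 0 <= C &
  forall s, 0 <= s -> `|s - t| <= 1 -> `|Y s x - Y t x| <= C * `|s - t|.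
Proof.
move=> t0 Ox; have [M M0 hM] := rf_bound rf (t + 1).
exists M => // s s0; rewrite ler_norml => /andP[h1 h2].
by apply: (flow_speed M0 hM) => //; apply/andP; split; lra.
Qed.

Lemma inverse_flow_time t y : 0 <= t -> Omega y -> exists2 C : R, 0 <= C &
  forall s, 0 <= s -> `|s - t| <= 1 -> `|Z s y - Z t y| <= C * `|s - t|.
Proof.
move=> t0 Oy; have [M M0 hM] := rf_bound rf (t + 1); have [L L0 hL] := fl_lipZ fl t0.
exists (L * M); first by rewrite mulr_ge0.
move=> s s0; rewrite ler_norml => /andP[h1 h2]; rewrite -mulrA.
by apply: (inverse_flow_speed M0 hM _ hL) => //; apply/andP; split; lra.
Qed.

Notation Yt := (extend Omega Y).
Notation Zt := (extend Omega Z).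

Lemma measurable_flow :
  measurable_fun setT (fun p : measurableTypeR R * 'rV[R]_m => Yt p.1 p.2).
Proof. by apply: measurable_extend => //; [exact: (fl_lipY fl)|exact: flow_time]. Qed.

Lemma measurable_inverse_flow :
  measurable_fun setT (fun p : measurableTypeR R * 'rV[R]_m => Zt p.1 p.2).
Proof. by apply: measurable_extend => //; [exact: (fl_lipZ fl)|exact: inverse_flow_time]. Qed.

Lemma bmf_d : bmf (fun p : measurableTypeR R * 'rV[R]_m => d p.1 p.2).
Proof. by split; [exact: rf_measd rf|exists Dm => p; exact: rf_d rf _ _]. Qed.

(* Integrals from t to s, written over the unoriented interval [lo, hi] with a sign sg. *)
Lemma flow_orientation s t : 0 <= s -> 0 <= t -> exists lo hi sg : R,
  [/\ [/\ lo <= hi, `|sg| = 1, hi - lo = `|s - t| & 0 <= lo],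
   hi <= t + `|s - t| /\
   (forall r, lo <= r <= hi -> `|r - t| <= `|s - t| /\ `|r - s| <= `|s - t|) &
   (forall f, bmf (T := measurableTypeR R) f ->
     \int[leb]_(r in `[0, s]) f r - \int[leb]_(r in `[0, t]) f r =
     sg * \int[leb]_(r in `[lo, hi]) f r) /\
   (forall x, Omega x -> forall i, Y s x ord0 i - Y t x ord0 i =
     sg * \int[leb]_(r in `[lo, hi]) v r (Y r x) ord0 i)].
Proof.
move=> s0 t0; have [ts|/ltW st] := leP t s.
  exists t, s, 1; rewrite normr1 ger0_norm ?subr_ge0//; split; [by []| |].
    split=> [|r /andP[h1 h2]]; first lra.
    by rewrite ger0_norm ?subr_ge0// ler0_norm ?subr_le0//; split; lra.
  split=> [f bf|x Ox i]; rewrite mul1r; last exact: (fl_ode fl).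
  by rewrite (bint_itv_split bf t0 ts) addrAC subrr add0r.
exists s, t, (-1); rewrite normrN1 ler0_norm ?subr_le0// opprB; split; [by []| |].
  split=> [|r /andP[h1 h2]]; first lra.
  by rewrite ler0_norm ?subr_le0// ger0_norm ?subr_ge0//; split; lra.
split=> [f bf|x Ox i]; rewrite mulN1r.
  by rewrite (bint_itv_split bf s0 st) opprD addrA subrr sub0r.
by rewrite -(fl_ode fl Ox s0 st) opprB.
Qed.

End regular_flows.

Section time_average.
Context {R : realType} {m : nat}.
Notation leb := (@lebesgue_measure R).
Notation mu := (lebesgue_rV m).
Variables (Omega : set 'rV[R]_m) (mO : measurable Omega) (finO : (mu Omega < +oo)%E).
Variables (v : R -> 'rV[R]_m -> 'rV[R]_m) (d : R -> 'rV[R]_m -> R) (Dm : R).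
Hypothesis rf : regular_field Omega v d Dm.
Variables (T M L : R).
Hypotheses (M0 : 0 <= M) (hM : forall s x, s <= T -> `|v s x| <= M) (L0 : 0 <= L).
Hypothesis hL : forall s x r y, s <= T ->
  (forall z, `|z - x| < r -> Omega z) -> `|y - x| < r -> `|v s y - v s x| <= L * `|y - x|.
Variables (lo hi sg : R).
Hypotheses (lohi : lo <= hi) (hiT : hi <= T) (sg1 : `|sg| = 1).

Let I := `[lo, hi]%classic : set (measurableTypeR R).

Let mI : measurable I. Proof. exact: measurable_itv. Qed.
Let finI : (leb I < +oo)%E. Proof. exact: leb_itv_fin. Qed.

(** The velocity is bounded only up to a finite time; cutting it after [T] makes it a bounded Borel
    function on space-time, to which Fubini applies. *)
Definition trunc_field (r : R) (x : 'rV[R]_m) : 'rV[R]_m := \1_[set r | r <= T] r *: v r x.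

Lemma trunc_fieldE r x : r <= T -> trunc_field r x = v r x.
Proof. by move=> rT; rewrite /trunc_field indicE mem_set// scale1r. Qed.

Lemma bmf_trunc_field i :
  bmf (fun p : measurableTypeR R * 'rV[R]_m => trunc_field p.1 p.2 ord0 i).
Proof.
split.
  under eq_fun do rewrite mxE; apply: measurable_funM.
    apply: measurableT_comp; last exact: measurable_fst.
    apply: measurable_indic; rewrite (_ : [set r | r <= T] = `]-oo, T]%classic).
      exact: measurable_itv.
    by apply/seteqP; split => r /=; rewrite in_itv.
  by apply: (measurableT_comp (@measurable_coord _ R m i)); exact: rf_meas rf.
exists M => -[r x] /=; apply: le_trans (rV_coord_le _ _) _.
rewrite /trunc_field indicE; case: (boolP (r \in _)) => [|_].
  by rewrite inE /= => rT; rewrite scale1r; exact: hM.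
by rewrite scale0r normr0.
Qed.

(** An integral, not a mean: the signed displacement of a particle if the velocity were read at the
    fixed point [y] throughout. *)
Definition field_average (y : 'rV[R]_m) : 'rV[R]_m :=
  \row_i (sg * \int[leb]_(r in I) trunc_field r y ord0 i).

Definition div_average (y : 'rV[R]_m) : R := sg * \int[leb]_(r in I) d r y.

Let bmfd : bmf (fun p : measurableTypeR R * 'rV[R]_m => d p.1 p.2).
Proof. exact: bmf_d rf. Qed.

Lemma bmf_field_average i : bmf (fun y => field_average y ord0 i).
Proof.
under eq_fun do rewrite mxE; apply: bmfZ.
exact: (bmf_int1 mI finI (bmf_trunc_field i)).
Qed.

Lemma bmf_div_average : bmf div_average.
Proof. by apply: bmfZ; exact: (bmf_int1 mI finI bmfd). Qed.

Lemma field_average_le y : `|field_average y| <= M * (hi - lo).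
Proof.
apply: rV_norm_le => [|i]; first by rewrite mulr_ge0// subr_ge0.
rewrite mxE normrM sg1 mul1r -(fine_leb_itv lohi).
apply: bint_norm_le => //; first exact: (bmf_sec2 y (bmf_trunc_field i)).
move=> r; rewrite /I /= in_itv /= => /andP[_ rh].
have rT := le_trans rh hiT.
by rewrite trunc_fieldE//; apply: le_trans (rV_coord_le _ _) (hM _ rT).
Qed.

Lemma div_average_le y : `|div_average y| <= Dm * (hi - lo).
Proof.
rewrite /div_average normrM sg1 mul1r -(fine_leb_itv lohi).
apply: bint_norm_le => //; first exact: (bmf_sec2 y bmfd).
by move=> r _; exact: rf_d rf _ _.
Qed.

Lemma field_average_lip r x y : (forall z, `|z - y| < r -> Omega z) -> `|x - y| < r ->
  `|field_average x - field_average y| <= L * (hi - lo) * `|x - y|.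
Proof.
move=> hr xy; have lh := lohi; have L0' := L0.
apply: rV_norm_le => [|i]; first by rewrite !mulr_ge0// subr_ge0.
rewrite !mxE -mulrBr normrM sg1 mul1r mulrAC -[X in _ * X](fine_leb_itv lohi).
apply: bint_dist_le => //.
- exact: (bmf_sec2 x (bmf_trunc_field i)).
- exact: (bmf_sec2 y (bmf_trunc_field i)).
move=> s; rewrite /I /= in_itv /= => /andP[_ sh].
have sT := le_trans sh hiT.
rewrite !trunc_fieldE//; have := rV_coord_le (v s x - v s y) i; rewrite !mxE => h.
by apply: le_trans h _; exact: hL sT hr xy.
Qed.

(** The weak divergence is linear in the field, so Fubini transfers it from each time to the time
    integral. *)
Lemma field_average_weak_div phi : test_function Omega phi -> bmf phi ->
  (forall i, bmf (fun y => grad phi y ord0 i)) ->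
  \int[mu]_(y in Omega) dot (field_average y) (grad phi y) =
  - \int[mu]_(y in Omega) (div_average y * phi y).
Proof.
move=> test bphi bgrad.
have bgrad2 i : bmf (fun p : measurableTypeR R * 'rV[R]_m => grad phi p.2 ord0 i).
  by apply: (bmf_comp (bgrad i)); exact: measurable_snd.
have bphi2 : bmf (fun p : measurableTypeR R * 'rV[R]_m => phi p.2).
  by apply: (bmf_comp bphi); exact: measurable_snd.
pose k (p : measurableTypeR R * 'rV[R]_m) := dot (trunc_field p.1 p.2) (grad phi p.2).
have bk : bmf k by apply: bmf_dot => i; [exact: bmf_trunc_field|exact: bgrad2].
pose k2 (p : measurableTypeR R * 'rV[R]_m) := d p.1 p.2 * phi p.2.
have bk2 : bmf k2 by exact: bmfM.
transitivity (sg * \int[leb]_(r in I) \int[mu]_(y in Omega) k (r, y)).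
  rewrite (bfubini mI mO finI finO bk) -bintZ//; last exact: (bmf_int1 mI finI bk).
  apply: eq_Rintegral => y _; rewrite /k /dot /=.
  rewrite (bint_sum mI finI (F := fun i r => trunc_field r y ord0 i * grad phi y ord0 i)).
    rewrite mulr_sumr; apply: eq_bigr => i _; rewrite mxE -mulrA; congr (_ * _).
    rewrite (bintZr mI finI)//; exact: (bmf_sec2 y (bmf_trunc_field i)).
  move=> i _; apply: bmfM; [exact: (bmf_sec2 y (bmf_trunc_field i))|exact: bmf_cst].
transitivity (sg * \int[leb]_(r in I) - \int[mu]_(y in Omega) k2 (r, y)).
  congr (_ * _); apply: eq_Rintegral => r; rewrite /I inE /= in_itv /= => /andP[_ rh].
  rewrite -(rf_div rf _ test); apply: eq_Rintegral => y _.
  by rewrite /k /= trunc_fieldE// (le_trans rh hiT).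
rewrite bintN//; last exact: (bmf_int2 mO finO bk2).
rewrite mulrN; congr (- _); rewrite (bfubini mI mO finI finO bk2).
rewrite -bintZ//; last exact: (bmf_int1 mI finI bk2).
apply: eq_Rintegral => y _; rewrite /k2 /div_average /= -mulrA; congr (_ * _).
by rewrite (bintZr mI finI)//; exact: (bmf_sec2 y bmfd).
Qed.

End time_average.

Lemma mul_le_half (R : realType) (a b e : R) : 0 <= a -> 0 < e -> 0 <= b ->
  b <= e / (2 * (a + 1)) -> a * b <= e / 2.
Proof. by move=> a0 e0 b0; rewrite ler_pdivlMr; [nra|lra]. Qed.

Section weak_liouville.
Context {R : realType} {m : nat}.
Notation leb := (@lebesgue_measure R).
Notation mu := (lebesgue_rV m).
Notation muO Omega := (fine (mu Omega)).
Variables (Omega : set 'rV[R]_m) (oO : open Omega) (finO : (mu Omega < +oo)%E).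
Variables (v Y Z : R -> 'rV[R]_m -> 'rV[R]_m) (d : R -> 'rV[R]_m -> R) (Dm : R).
Hypotheses (rf : regular_field Omega v d Dm) (fl : regular_flow Omega v Y Z).
Notation Yt := (extend Omega Y).
Notation Zt := (extend Omega Z).
Variables (phi : 'rV[R]_m -> R) (F : set 'rV[R]_m) (G Lp : R).
Hypotheses (cF : compact F) (FO : F `<=` Omega).
Hypotheses (phiF : forall x, phi x != 0 -> F x) (phiG : forall x, `|phi x| <= G).
Hypotheses (mphi : measurable_fun setT phi) (Lp0 : 0 <= Lp).
Hypothesis phiL : forall x y, `|phi x - phi y| <= Lp * `|x - y|.

Let mO : measurable Omega. Proof. exact: open_measurable_rV. Qed.

Let G0 : 0 <= G. Proof. exact: le_trans (normr_ge0 _) (phiG 0). Qed.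

Let bphi : bmf phi. Proof. by split => //; exists G. Qed.

Let bphiZ : bmf (fun p : measurableTypeR R * 'rV[R]_m => phi (Zt p.1 p.2)).
Proof. by apply: (bmf_comp bphi); exact: (measurable_inverse_flow oO rf fl). Qed.

Definition mass (s : R) := \int[mu]_(y in Omega) phi (Zt s y).

(** The derivative expected of [mass]: formally w = phi (Z s y) solves w_s + v . grad w = 0, and
    integrating by parts turns - v . grad w into [d] times w. *)
Definition mass_rate (s : R) := \int[mu]_(y in Omega) (d s y * phi (Zt s y)).

Lemma bmf_mass_rate : bmf (T := measurableTypeR R) mass_rate.
Proof.
exact: (bmf_int2 mO finO (f := fun p : measurableTypeR R * 'rV[R]_m =>
  d p.1 p.2 * phi (Zt p.1 p.2)) (bmfM (bmf_d rf) bphiZ)).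
Qed.

Section fixed_time.
Variables (t : R) (t0 : 0 <= t).

(** The transported function at time [t], set to 0 outside [Omega] because the displaced points
    [y - V y] may leave it. *)
Let g (y : 'rV[R]_m) := phi (Zt t y) * \1_Omega y.

Let gE y : Omega y -> g y = phi (Z t y).
Proof. by move=> Oy; rewrite /g extendE// indicE mem_set// mulr1. Qed.

Let bg : bmf g.
Proof. by apply: bmfM; [exact: (bmf_sec1 t bphiZ)|exact: bmf_indic]. Qed.

Let gG y : `|g y| <= G.
Proof.
rewrite /g indicE; case: (_ \in _); first by rewrite mulr1.
by rewrite mulr0 normr0.
Qed.

Let S := [set y | g y != 0].

Let SO y : S y -> Omega y.
Proof.
by rewrite /S /= /g indicE; case: (boolP (y \in Omega)) => [/set_mem//|_]; rewrite mulr0 eqxx.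
Qed.

(** The support of [g] lies in the compact image of [F] under [Y t]. The factor 16 lets every point
    within [4 * de] of the support be the centre of a ball of radius [12 * de] on which the velocity
    is Lipschitz. *)
Let margin : exists2 de : R, 0 < de & forall p y, S p -> `|y - p| <= 16 * de -> Omega y.
Proof.
have [L L0 hL] := fl_lipY fl t0.
have cY : compact (Y t @` F).
  apply: continuous_compact => //; apply/within_continuous_distP => x Fx e e0.
  exists (e / (L + 1)) => [|y Fy]; first by rewrite divr_gt0//; lra.
  rewrite ltr_pdivlMr; last lra.
  have := hL y x (FO Fy) (FO Fx); have := normr_ge0 (y - x) => h1 h2 h3.
  by apply: le_lt_trans h2 _; nra.
have YO : Y t @` F `<=` Omega by move=> _ [x Fx <-]; exact: (fl_Y fl t0 (FO Fx)).
have [c c0 hc] := compact_margin cY oO YO.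
exists (c / 16); first by rewrite divr_gt0.
move=> p y Sp yp; apply: (hc p); last by apply: le_trans yp _; lra.
have Op := SO Sp; exists (Z t p); last exact: (fl_YZ fl t0 Op).
by apply: phiF; rewrite -gE.
Qed.

(** Inside [Omega] the Lipschitz constants compose. Between a point where [g] is nonzero and a point
    outside [Omega], the distance is at least [16 * de] and the jump at most [G], hence the slope
    [G / (16 * de)]. *)
Let gL : exists2 Lg : R, 0 <= Lg & forall x y, `|g x - g y| <= Lg * `|x - y|.
Proof.
have [L L0 hL] := fl_lipZ fl t0; have [de de0 hde] := margin.
pose Lg := Lp * L + G / (16 * de).
have Gd : 0 <= G / (16 * de) by rewrite divr_ge0// mulr_ge0// ltW.
have LL : 0 <= Lp * L by rewrite mulr_ge0.
exists Lg; first by rewrite /Lg; lra.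
have far x y : S x -> ~ Omega y -> `|g x - g y| <= Lg * `|x - y|.
  move=> Sx nOy.
  have -> : g y = 0 by rewrite /g indicE memNset// mulr0.
  rewrite subr0; apply: le_trans (gG x) _.
  have h : 16 * de <= `|x - y|.
    by rewrite leNgt distrC; apply/negP => h; apply: nOy; apply: (hde x) => //; exact: ltW.
  apply: (@le_trans _ _ (G / (16 * de) * `|x - y|)).
    by rewrite mulrAC ler_pdivlMr ?mulr_gt0// ler_wpM2l.
  by rewrite ler_wpM2r// /Lg; lra.
move=> x y; have [Ox|nOx] := pselect (Omega x); have [Oy|nOy] := pselect (Omega y).
- rewrite !gE//; apply: le_trans (phiL _ _) _.
  apply: (@le_trans _ _ (Lp * L * `|x - y|)); first by rewrite -mulrA ler_wpM2l// hL.
  by rewrite ler_wpM2r// /Lg; lra.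
- have [gx|gx] := eqVneq (g x) 0; last exact: far.
  by rewrite gx /g indicE memNset// mulr0 subrr normr0 mulr_ge0// /Lg; lra.
- have [gy|gy] := eqVneq (g y) 0; last by rewrite distrC [`|x - y|]distrC; exact: far.
  by rewrite gy /g indicE memNset// mulr0 subrr normr0 mulr_ge0// /Lg; lra.
- rewrite /g !indicE !memNset// !mulr0 subrr normr0 mulr_ge0// /Lg; lra.
Qed.

(* For s near t, phi (Z s y) = g (y - w y) with w y = y - Y t (Z s y) the displacement
   along the flow from time t to time s, which is close to the time average of v. *)
Lemma mass_increment e : 0 < e -> exists2 rho : R, 0 < rho &
  forall s, 0 <= s -> `|s - t| < rho ->
  `|(mass s - \int[leb]_(r in `[0, s]) mass_rate r) -
    (mass t - \int[leb]_(r in `[0, t]) mass_rate r)| <= e * `|s - t|.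
Proof.
move=> e0; have t0' := t0.
have [M M0 hM] := rf_bound rf (t + 1); have [L L0 hL] := rf_lip rf (t + 1).
have [Lg Lg0 hg] := gL; have [de de0 hde] := margin.
have [Lz Lz0 hLz] := fl_lipZ fl t0.
have D0 : 0 <= Dm := le_trans (normr_ge0 _) (rf_d rf 0 0).
have mu0 : 0 <= muO Omega by exact: fine_ge0.
(* [K1 * ep] bounds the error per unit of time due to mollification, [K2 * h] the one quadratic in
   the time step; [K2] contains the constant [C] of the mollifier. So [ep] is fixed by [K1] before
   the time step is restricted by [K2]. *)
pose K1 := (Lg * L + Dm * Lg) * muO Omega.
have K10 : 0 <= K1 by rewrite mulr_ge0// addr_ge0// mulr_ge0.
pose ep := Num.min de (e / (2 * (K1 + 1))).
have ep0 : 0 < ep by rewrite lt_min de0 divr_gt0// mulr_gt0//; lra.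
have [eta [D [C mol]]] := @ex_mollifier R m ep ep0.
have C0 : 0 <= C := taylor2_ge0 (mol_taylor mol).
pose K2 := (Lg * L * M + G * C * M ^+ 2 * muO Omega + Dm * Lp * Lz * M) * muO Omega.
have K20 : 0 <= K2.
  by rewrite mulr_ge0// !addr_ge0 ?mulr_ge0 ?exprn_ge0.
exists (Num.min 1 (Num.min (de / (M + 1)) (e / (2 * (K2 + 1))))).
  by rewrite !lt_min ltr01 !divr_gt0// ?mulr_gt0//; lra.
move=> s s0; rewrite !lt_min => /andP[h1 /andP[h2 h3]].
have [lo [hi [sg [[lohi sg1 hiE lo0] [hit hrt] [hint hode]]]]] :=
  flow_orientation fl s0 t0'.
set h := `|s - t| in h1 h2 h3 hiE hit hrt *.
have hh0 : 0 <= h by exact: normr_ge0.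
have hiT : hi <= t + 1 by have := hit; lra.
have sT : 0 <= s <= t + 1.
  by apply/andP; split => //; move: (h1); rewrite /h ltr_norml => /andP[_]; lra.
have tT : 0 <= t <= t + 1 by apply/andP; split => //; lra.
have Mh : M * h <= de.
  move: h2; rewrite ltr_pdivlMr; last lra.
  by move=> h2; rewrite mulrC; apply: le_trans (ltW h2); rewrite ler_wpM2l//; lra.
pose V := field_average v (t + 1) lo hi sg.
pose be := div_average d lo hi sg.
have mV : measurable_fun setT V.
  by apply/measurable_fun_coordP => i; have [] := bmf_field_average rf M0 hM lo hi sg i.
have VM y : `|V y| <= M * h by rewrite -hiE; exact: (field_average_le rf M0 hM lohi hiT sg1).
have bbe : bmf be by exact: (bmf_div_average rf).
have beB y : `|be y| <= Dm * h by rewrite -hiE; exact: (div_average_le rf lohi sg1).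
have VL p x y : S p -> `|x - p| <= 4 * de -> `|y - p| <= 4 * de ->
    `|V x - V y| <= L * h * `|x - y|.
  move=> Sp xp yp; rewrite -hiE.
  apply: (field_average_lip rf M0 hM L0 hL lohi hiT sg1 (r := 12 * de)) => [z zy|].
    apply: (hde p) => //; have -> : z - p = (z - y) + (y - p) by rV_ring.
    by apply: le_trans (ler_normD _ _) _; lra.
  have -> : x - y = (x - p) - (y - p) by rV_ring.
  by apply: le_lt_trans (ler_normB _ _) _; lra.
have hS p y : S p -> `|y - p| <= 4 * de -> Omega y.
  by move=> Sp yp; apply: (hde p) => //; lra.
have epde : ep <= de by rewrite /ep ge_min lexx.
have wd psi : test_function Omega psi -> bmf psi -> (forall i, bmf (fun y => grad psi y ord0 i)) ->
    \int[mu]_(y in Omega) dot (V y) (grad psi y) = - \int[mu]_(y in Omega) (be y * psi y).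
  by move=> tp bp bgp; exact: (field_average_weak_div mO finO rf M0 hM lo sg hiT tp bp bgp).
have bfs : bmf (fun y => phi (Zt s y)) by exact: (bmf_sec1 s bphiZ).
have bgV : bmf (fun y : 'rV[R]_m => g (y - V y)).
  by apply: (bmf_comp bg); apply: measurable_rVB => //; exact: measurable_id.
have T1 : `|mass s - \int[mu]_(y in Omega) g (y - V y)| <= Lg * (L * (M * h) * h) * muO Omega.
  apply: (bint_dist_le mO finO bfs bgV) => y Oy.
  rewrite (extendE Z s0 Oy); set x := Z s y.
  have Ox : Omega x by exact: (fl_Z fl s0 Oy).
  have OYx : Omega (Y t x) by exact: (fl_Y fl t0 Ox).
  have yE : Y s x = y by exact: (fl_YZ fl s0 Oy).
  have -> : phi x = g (Y t x) by rewrite gE// (fl_ZY fl t0 Ox).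
  have Wy : `|y - Y t x| <= M * h.
    by rewrite -{1}yE; exact: (flow_speed fl M0 hM tT sT Ox).
  (* The true displacement [y - Y t x] integrates the velocity along the trajectory, [V y]
     integrates it at the fixed point [y]. The trajectory stays within [M * h] of [y], so the two
     differ by at most [L * (M * h) * h]. *)
  have key p : S p -> `|y - p| <= M * h -> `|g (Y t x) - g (y - V y)| <= Lg * (L * (M * h) * h).
    move=> Sp yp; apply: le_trans (hg _ _) _; rewrite ler_wpM2l//.
    apply: rV_norm_le => [|i]; first by rewrite !mulr_ge0.
    have -> : (Y t x - (y - V y)) ord0 i = V y ord0 i - (Y s x ord0 i - Y t x ord0 i).
      by rewrite yE !mxE; ring.
    rewrite mxE (hode _ Ox) -mulrBr normrM sg1 mul1r -{2}hiE -(fine_leb_itv lohi).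
    have btr := bmf_trunc_field rf M0 hM i.
    have mY : measurable_fun setT (fun r : measurableTypeR R => (r, Yt r x)).
      apply/measurable_fun_pairP; split; first exact: measurable_id.
      exact: (measurableT_comp (measurable_flow oO rf fl) (pair2_measurable x)).
    have b1 : bmf (T := measurableTypeR R) (fun r => trunc_field v (t + 1) r y ord0 i).
      exact: (bmf_sec2 y btr).
    have b2 : bmf (T := measurableTypeR R) (fun r => trunc_field v (t + 1) r (Yt r x) ord0 i).
      exact: (bmf_comp btr mY).
    have -> : \int[leb]_(r in `[lo, hi]) v r (Y r x) ord0 i =
        \int[leb]_(r in `[lo, hi]) trunc_field v (t + 1) r (Yt r x) ord0 i.
      apply: eq_Rintegral => r; rewrite inE /= in_itv /= => /andP[lr rh].
      rewrite trunc_fieldE ?(le_trans rh)// extendE//; exact: le_trans lr.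
    apply: (bint_dist_le _ (leb_itv_fin lo hi) b1 b2); first exact: measurable_itv.
    move=> r; rewrite /= in_itv /= => /andP[lr rh].
    have r0 : 0 <= r by exact: le_trans lr.
    have rT : r <= t + 1 by exact: le_trans hiT.
    rewrite !trunc_fieldE// extendE//.
    have Yry : `|Y r x - y| <= M * h.
      rewrite -yE distrC; apply: (@le_trans _ _ (M * `|s - r|)).
        by apply: (flow_speed fl M0 hM _ sT Ox); rewrite r0.
      by rewrite ler_wpM2l// distrC; apply: (hrt r _).2; rewrite lr.
    have hrb : forall z, `|z - y| < 2 * de -> Omega z.
      move=> z zy; apply: (hde p) => //; have -> : z - p = (z - y) + (y - p) by rV_ring.
      by apply: le_trans (ler_normD _ _) _; lra.
    have Yry2 : `|Y r x - y| < 2 * de.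
      by apply: le_lt_trans (le_trans Yry Mh) _; rewrite ltr_pMl// ltr1n.
    have := rV_coord_le (v r y - v r (Y r x)) i; rewrite !mxE => cc.
    apply: le_trans cc _; rewrite distrC; apply: le_trans (hL _ _ _ _ rT hrb Yry2) _.
    by rewrite ler_wpM2l.
  have [gx|gx] := eqVneq (g (Y t x)) 0; last by apply: (key _ gx).
  have [gy|gy] := eqVneq (g (y - V y)) 0.
    by rewrite gx gy subrr normr0 !mulr_ge0.
  apply: (key _ gy); have -> : y - (y - V y) = V y by rV_ring.
  exact: VM.
have brate := bmf_mass_rate.
have bg2 : bmf (fun p : measurableTypeR R * 'rV[R]_m => g p.2).
  by apply: (bmf_comp bg); exact: measurable_snd.
have bdg : bmf (fun p : measurableTypeR R * 'rV[R]_m => d p.1 p.2 * g p.2).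
  by apply: bmfM => //; exact: bmf_d rf.
have mI : measurable (`[lo, hi]%classic : set (measurableTypeR R)) by exact: measurable_itv.
have finI := leb_itv_fin lo hi.
have beg : \int[mu]_(y in Omega) (be y * g y) =
    sg * \int[leb]_(r in `[lo, hi]) \int[mu]_(y in Omega) (d r y * g y).
  rewrite (bfubini mI mO finI finO bdg).
  rewrite -(bintZ mO finO sg (bmf_int1 mI finI bdg)).
  apply: eq_Rintegral => y _ /=; rewrite /be /div_average -mulrA; congr (_ * _).
  rewrite (bintZr mI finI)//; exact: (bmf_sec2 y (bmf_d rf)).
(* [mass_rate r] involves [Z r], whereas [g] is made with [Z t]; over a time at most [h] these
   differ by at most [Lz * (M * h)]. *)
have T3 : `|\int[mu]_(y in Omega) (be y * g y) - sg * \int[leb]_(r in `[lo, hi]) mass_rate r|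
    <= Dm * (Lp * (Lz * (M * h))) * muO Omega * h.
  rewrite beg {beg} -mulrBr normrM sg1 mul1r -[X in _ * X]hiE -(fine_leb_itv lohi).
  apply: (bint_dist_le mI finI (bmf_int2 mO finO bdg) brate) => r.
  rewrite /= in_itv /= => /andP[lr rh].
  have r0 : 0 <= r by exact: le_trans lr.
  have rT : 0 <= r <= t + 1 by rewrite r0 (le_trans rh).
  have b1 : bmf (fun y : 'rV[R]_m => d r y * g y) by exact: (bmf_sec1 r bdg).
  have b2 : bmf (fun y : 'rV[R]_m => d r y * phi (Zt r y)).
    exact: (bmf_sec1 r (bmfM (bmf_d rf) bphiZ)).
  apply: (bint_dist_le mO finO b1 b2) => y Oy.
  rewrite -mulrBr normrM gE// extendE//; apply: ler_pM => //; first exact: rf_d rf _ _.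
  apply: le_trans (phiL _ _) _; rewrite ler_wpM2l// distrC.
  apply: le_trans (inverse_flow_speed fl M0 hM tT hLz Lz0 rT Oy) _.
  by rewrite !ler_wpM2l//; apply: (hrt r _).1; rewrite lr.
have T2 := displacement_estimate mO finO ep0 mol hS bg gG hg (fun y h => h) epde
  Lg0 mV VM Mh (mulr_ge0 L0 hh0) VL bbe beB wd.
have massE : mass t = \int[mu]_(y in Omega) g y.
  by apply: eq_Rintegral => y; rewrite inE => Oy; rewrite gE// extendE.
have K1h : K1 * ep <= e / 2.
  by apply: mul_le_half => //; [exact: ltW|rewrite /ep ge_min lexx orbT].
have K2h : K2 * h <= e / 2 by apply: mul_le_half => //; exact: ltW.
have -> : (mass s - \int[leb]_(r in `[0, s]) mass_rate r) -
    (mass t - \int[leb]_(r in `[0, t]) mass_rate r) =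
    mass s - mass t - sg * \int[leb]_(r in `[lo, hi]) mass_rate r.
  have E (a b c x : R) : a - b - (c - x) = a - c - (b - x) by ring.
  by rewrite E (hint _ brate).
move: T1 T2 T3 K1h K2h; rewrite -massE /K1 /K2.
move: (mass s) (mass t) (\int[mu]_(y in Omega) g (y - V y)) (\int[mu]_(y in Omega) (be y * g y))
  (sg * _) (muO Omega) hh0 => A B P Q J MO hh0' T1 T2 T3 K1h K2h.
have -> : A - B - J = (A - P) + (P - B - Q) + (Q - J) by ring.
apply: le_trans (ler_normD _ _) _; apply: le_trans (lerD (ler_normD _ _) (lexx _)) _.
apply: le_trans (lerD (lerD T1 T2) T3) _.
have -> : e * h = e / 2 * h + e / 2 * h by rewrite -mulrDl -splitr.
apply: le_trans (lerD (ler_wpM2r hh0' K1h) (ler_wpM2r hh0' K2h)).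
rewrite le_eqVlt; apply/orP; left; apply/eqP.
ring.
Qed.

End fixed_time.

End weak_liouville.

(** * Liouville's equation: from Lipschitz functions to bounded Borel functions *)

Section bounded_convergence.
Context d (T : measurableType d) (R : realType).
Variable mu : {measure set T -> \bar R}.
Variables (D : set T) (mD : measurable D) (finD : (mu D < +oo)%E).

Lemma bint_cvg (f_ : nat -> T -> R) (f : T -> R) (C : R) :
  (forall n, bmf (f_ n)) -> bmf f -> (forall n x, D x -> `|f_ n x| <= C) ->
  (forall x, D x -> f_ n x @[n --> \oo] --> f x) ->
  \int[mu]_(x in D) f_ n x @[n --> \oo] --> \int[mu]_(x in D) f x.
Proof.
move=> bf_ bf fC cf.
apply: fine_cvg; rewrite fineK; last exact: integrable_fin_num (bmf_integrable mD finD bf).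
have [] := @dominated_convergence _ T R mu D mD (fun n x => (f_ n x)%:E)
  (EFin \o f) (EFin \o cst C) => //.
- by move=> n; apply/measurable_EFinP; apply: measurable_funTS; exact: (bf_ n).1.
- by apply/measurable_EFinP; apply: measurable_funTS; exact: bf.1.
- by apply: aeW => x Dx; apply: cvg_EFin; [exact: nearW|exact: cf].
- by apply: bmf_integrable => //; exact: bmf_cst.
- by apply: aeW => x n Dx; rewrite /= lee_fin; exact: fC.
Qed.

End bounded_convergence.

Section borel_induction.
Context {R : realType} {m : nat}.

(** Dynkin's theorem for the open sets, which are stable under intersection and generate the Borel
    sets. *)
Lemma borel_rV_induction (P : set 'rV[R]_m -> Prop) :
  (forall V, open V -> P V) ->
  (forall A B, measurable A -> measurable B -> B `<=` A -> P A -> P B -> P (A `\` B)) ->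
  (forall F : (set 'rV[R]_m)^nat, nondecreasing_seq F -> (forall n, measurable (F n)) ->
    (forall n, P (F n)) -> P (\bigcup_n F n)) ->
  forall B, measurable B -> P B.
Proof.
move=> hV hD hU B mB.
pose H := [set A : set 'rV[R]_m | measurable A /\ P A].
have lam : lambda_system setT H.
  split=> //; first by split => //; apply: hV; exact: openT.
    by move=> A C CA [mA PA] [mC PC]; split; [exact: measurableD|exact: hD].
  move=> F ndF HF; split; first by apply: bigcupT_measurable => n; have [] := HF n.
  by apply: hU => // n; have [] := HF n.
have GH : [set U : set 'rV[R]_m | open U] `<=` H.
  by move=> U oU; split; [exact: open_measurable_rV|exact: hV].
have GI : setI_closed [set U : set 'rV[R]_m | open U] by move=> U V oU oV; exact: openI.
have := lambda_system_subset GI lam GH.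
rewrite measurable_rVE in mB; move=> /(_ (fun _ _ _ _ => Logic.I) B mB).
by case.
Qed.

End borel_induction.

Section distance_to_complement.
Context {R : realType} {m : nat}.
Variables (V : set 'rV[R]_m) (p0 : 'rV[R]_m) (Vp0 : ~ V p0).

Definition dist_compl (x : 'rV[R]_m) : R := inf [set `|x - y| | y in ~` V].

Let has_inf_dist x : has_inf [set `|x - y| | y in ~` V].
Proof.
split; first by exists `|x - p0|, p0.
by exists 0 => _ [y _ <-].
Qed.

Lemma dist_compl_le x y : ~ V y -> dist_compl x <= `|x - y|.
Proof. by move=> Vy; apply: ge_inf; [exact: (has_inf_dist x).2|exists y]. Qed.

Lemma dist_compl_ge x (c : R) : (forall y, ~ V y -> c <= `|x - y|) -> c <= dist_compl x.
Proof.
move=> h; apply: lb_le_inf; first exact: (has_inf_dist x).1.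
by move=> _ [y Vy <-]; exact: h.
Qed.

Lemma dist_compl_ge0 x : 0 <= dist_compl x.
Proof. exact: dist_compl_ge. Qed.

Lemma dist_compl_lip x y : `|dist_compl x - dist_compl y| <= `|x - y|.
Proof.
suff H a b : dist_compl a - dist_compl b <= `|a - b|.
  rewrite ler_norml; apply/andP; split; last exact: H.
  by rewrite lerNl opprB distrC; exact: H.
rewrite lerBlDr -lerBlDl; apply: dist_compl_ge => z Vz.
rewrite lerBlDl; apply: le_trans (dist_compl_le a Vz) _.
have -> : a - z = (a - b) + (b - z) by rV_ring.
exact: ler_normD.
Qed.

Lemma dist_compl_gt0 x : open V -> V x -> 0 < dist_compl x.
Proof.
move=> /open_ballP oV /oV[e e0 he]; apply: lt_le_trans e0 _.
apply: dist_compl_ge => y Vy; rewrite leNgt distrC; apply/negP => h.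
by apply: Vy; exact: he.
Qed.

Lemma dist_compl0 x : ~ V x -> dist_compl x = 0.
Proof.
move=> Vx; apply/eqP; rewrite eq_le dist_compl_ge0 andbT.
by have := dist_compl_le x Vx; rewrite subrr normr0.
Qed.

(** Subtracting 1 kills the function wherever [k%:R * dist_compl x] is at most 1. For a bounded [V]
    its nonzero values thus lie in a compact subset of [V], as the Lipschitz case requires. *)
Definition cutoff (k : nat) (x : 'rV[R]_m) : R :=
  Num.min 1 (Num.max 0 (k%:R * dist_compl x - 1)).

Lemma cutoff_in01 k x : 0 <= cutoff k x <= 1.
Proof. by rewrite /cutoff le_min ler01 le_max lexx /= ge_min lexx. Qed.

Lemma cutoff_lip k x y : `|cutoff k x - cutoff k y| <= k%:R * `|x - y|.
Proof.
apply: le_trans (minr_lip _ _ _) _; apply: le_trans (maxr_lip _ _ _) _.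
have -> : k%:R * dist_compl x - 1 - (k%:R * dist_compl y - 1) =
  k%:R * (dist_compl x - dist_compl y) by ring.
by rewrite normrM ger0_norm// ler_wpM2l// dist_compl_lip.
Qed.

Lemma cutoff_neq0 k x : cutoff k x != 0 -> 1 <= k%:R * dist_compl x.
Proof.
move=> h; rewrite leNgt; apply/negP => h1; move: h.
by rewrite /cutoff max_l ?min_r ?eqxx// subr_le0 ltW.
Qed.

Lemma cutoff_cvg x : open V -> cutoff k x @[k --> \oo] --> (\1_V x : R).
Proof.
move=> oV; rewrite indicE; have [Vx|Vx] := pselect (V x); last first.
  rewrite memNset//; apply: cvg_near_cst; apply: nearW => k.
  by rewrite /cutoff dist_compl0// mulr0 sub0r max_l ?min_r// ltW// ltrN10.
rewrite mem_set//; have d0 := dist_compl_gt0 oV Vx; apply: cvg_near_cst.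
near=> k.
rewrite /cutoff min_l// le_max; apply/orP; right.
rewrite lerBrDr -ler_pdivrMr//.
near: k; exact: nbhs_infty_ger.
Unshelve. all: by end_near. Qed.

Lemma cutoff_support_compact k : bounded_set V ->
  compact [set x | 1 <= k%:R * dist_compl x] /\ [set x | 1 <= k%:R * dist_compl x] `<=` V.
Proof.
move=> bV.
have sub : [set x | 1 <= k%:R * dist_compl x] `<=` V.
  move=> x /= h; apply: contrapT => Vx; move: h.
  by rewrite dist_compl0// mulr0 ler10.
split=> //; apply: bounded_closed_compact.
  by move: bV => [M [Mr hM]]; exists M; split => // x Mx y /sub; exact: hM.
rewrite (_ : [set x | _] = ~` [set x | k%:R * dist_compl x < 1]); last first.
  by apply/seteqP; split=> x /=; rewrite leNgt => /negP.
apply: open_closedC; apply/open_ballP => x /= h.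
exists ((1 - k%:R * dist_compl x) / (k%:R + 1)).
  by rewrite divr_gt0 ?subr_gt0.
move=> y; rewrite ltr_pdivlMr// => hy.
have := dist_compl_lip y x; rewrite ler_norml => /andP[_ hd].
have k0 : 0 <= k%:R :> R by [].
have := ler_wpM2l k0 hd; have := normr_ge0 (y - x).
move: hy h k0; move: (dist_compl x) (dist_compl y) `|y - x| (k%:R : R) => a b c kk.
nra.
Qed.

End distance_to_complement.

Section mass_balance.
Context {R : realType} {m : nat}.
Notation leb := (@lebesgue_measure R).
Notation mu := (lebesgue_rV m).
Variables (Omega : set 'rV[R]_m) (oO : open Omega) (finO : (mu Omega < +oo)%E).
Hypothesis bO : bounded_set Omega.
Variables (v Y Z : R -> 'rV[R]_m -> 'rV[R]_m) (d : R -> 'rV[R]_m -> R) (Dm : R).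
Hypotheses (rf : regular_field Omega v d Dm) (fl : regular_flow Omega v Y Z).
Notation Zt := (extend Omega Z).
Notation mass := (mass Omega Z).
Notation rate := (mass_rate Omega Z d).
Implicit Types f g : 'rV[R]_m -> R.

Let mO : measurable Omega. Proof. exact: open_measurable_rV. Qed.

(** Liouville's equation in integrated form which, unlike differentiability of [mass], passes to
    bounded pointwise limits. *)
Definition balanced f := forall s, 0 <= s ->
  mass f s = \int[mu]_(y in Omega) f y + \int[leb]_(r in `[0, s]) rate f r.

Let mI (s : R) : measurable (`[0, s]%classic : set (measurableTypeR R)).
Proof. exact: measurable_itv. Qed.

Lemma bmf_transport f : bmf f ->
  bmf (fun p : measurableTypeR R * 'rV[R]_m => f (Zt p.1 p.2)).
Proof. by move=> bf; apply: (bmf_comp bf); exact: (measurable_inverse_flow oO rf fl). Qed.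

Lemma bmf_transport_at f s : bmf f -> bmf (fun y => f (Zt s y)).
Proof. by move=> bf; exact: (bmf_sec1 s (bmf_transport bf)). Qed.

Let bmf_dtransport f : bmf f ->
  bmf (fun p : measurableTypeR R * 'rV[R]_m => d p.1 p.2 * f (Zt p.1 p.2)).
Proof. by move=> bf; apply: bmfM; [exact: bmf_d rf|exact: bmf_transport]. Qed.

Let bmf_dtransport_at f s : bmf f -> bmf (fun y => d s y * f (Zt s y)).
Proof. by move=> bf; exact: (bmf_sec1 s (bmf_dtransport bf)). Qed.

Lemma bmf_rate f : bmf f -> bmf (T := measurableTypeR R) (rate f).
Proof. by move=> bf; exact: (bmf_int2 mO finO (bmf_dtransport bf)). Qed.

Lemma massB f g s : bmf f -> bmf g -> mass (fun x => f x - g x) s = mass f s - mass g s.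
Proof. by move=> bf bg; apply: bintB => //; exact: bmf_transport_at. Qed.

Lemma rateB f g s : bmf f -> bmf g -> rate (fun x => f x - g x) s = rate f s - rate g s.
Proof.
move=> bf bg; rewrite /mass_rate -(bintB mO finO (bmf_dtransport_at s bf) (bmf_dtransport_at s bg)).
by apply: eq_Rintegral => y _; rewrite mulrBr.
Qed.

Lemma balancedB f g : bmf f -> bmf g -> balanced f -> balanced g ->
  balanced (fun x => f x - g x).
Proof.
move=> bf bg hf hg s s0; rewrite massB// hf// hg//.
rewrite (bintB mO finO bf bg).
have -> : \int[leb]_(r in `[0, s]) rate (fun x => f x - g x) r =
    \int[leb]_(r in `[0, s]) (rate f r - rate g r).
  by apply: eq_Rintegral => r _; exact: rateB.
rewrite (bintB (mI s) (leb_itv_fin 0 s) (bmf_rate bf) (bmf_rate bg)).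
move: (Rintegral _ _ _) (Rintegral _ _ _) (Rintegral _ _ _) (Rintegral _ _ _) => a b c e.
by ring.
Qed.

Lemma balancedZ (c : R) f : bmf f -> balanced f -> balanced (fun x => c * f x).
Proof.
move=> bf hf s s0; rewrite {1}/mass (bintZ mO finO c (bmf_transport_at s bf)).
rewrite -/(mass f s) hf// (bintZ mO finO c bf) mulrDr; congr (_ + _).
rewrite -(bintZ (mI s) (leb_itv_fin 0 s) c (bmf_rate bf)).
apply: eq_Rintegral => r _; rewrite /mass_rate -(bintZ mO finO c (bmf_dtransport_at r bf)).
by apply: eq_Rintegral => y _; rewrite mulrCA.
Qed.

Lemma balanced_cvg (f_ : nat -> 'rV[R]_m -> R) f (C : R) :
  (forall n, bmf (f_ n)) -> bmf f -> (forall n x, `|f_ n x| <= C) ->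
  (forall x, f_ n x @[n --> \oo] --> f x) ->
  (forall n, balanced (f_ n)) -> balanced f.
Proof.
move=> bf_ bf fC cf hf s s0.
have c1 : mass (f_ n) s @[n --> \oo] --> mass f s.
  apply: (@bint_cvg _ _ _ mu Omega mO finO _ _ C) => //.
  - by move=> n; exact: bmf_transport_at.
  - exact: bmf_transport_at.
have c2 : \int[mu]_(y in Omega) f_ n y @[n --> \oo] --> \int[mu]_(y in Omega) f y.
  exact: (@bint_cvg _ _ _ mu Omega mO finO _ _ C).
have rC n r : `|rate (f_ n) r| <= Dm * C * fine (mu Omega).
  apply: (bint_norm_le mO finO (bmf_dtransport_at r (bf_ n))) => y _.
  by rewrite normrM; apply: ler_pM => //; exact: rf_d rf _ _.
have c3 : \int[leb]_(r in `[0, s]) rate (f_ n) r @[n --> \oo] -->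
    \int[leb]_(r in `[0, s]) rate f r.
  apply: (@bint_cvg _ _ _ leb `[0, s]%classic (mI s) (leb_itv_fin 0 s) _ _ (Dm * C * fine (mu Omega))) => //.
  - by move=> n; exact: bmf_rate.
  - exact: bmf_rate.
  move=> r _; apply: (@bint_cvg _ _ _ mu Omega mO finO _ _ (Dm * C)).
  - by move=> n; exact: bmf_dtransport_at.
  - exact: bmf_dtransport_at.
  - by move=> n y _; rewrite normrM; apply: ler_pM => //; exact: rf_d rf _ _.
  - by move=> y _; apply: cvgMl_tmp; exact: cf.
have c4 : mass (f_ n) s @[n --> \oo] -->
    \int[mu]_(y in Omega) f y + \int[leb]_(r in `[0, s]) rate f r.
  by under eq_fun do rewrite (hf _ _ s0); exact: cvgD c2 c3.
exact: (@cvg_unique _ (@norm_hausdorff _ R) _ _ _ _ c1 c4).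
Qed.

Lemma balanced_lipschitz f (F : set 'rV[R]_m) (G L : R) :
  compact F -> F `<=` Omega -> (forall x, f x != 0 -> F x) -> (forall x, `|f x| <= G) ->
  measurable_fun setT f -> 0 <= L -> (forall x y, `|f x - f y| <= L * `|x - y|) ->
  balanced f.
Proof.
move=> cF FO fF fG mf L0 fL s s0.
pose B r := mass f r - \int[leb]_(u in `[0, r]) rate f u.
have BE : B s = B 0.
  apply: zero_derivative_constant => // t /andP[t0 _] e e0.
  have [rho rho0 h] := mass_increment oO finO rf fl cF FO fF fG mf L0 fL t0 e0.
  by exists rho => // r /andP[r0 _]; exact: h.
have <- : B 0 = \int[mu]_(y in Omega) f y.
  rewrite /B set_itv1 Rintegral_set1 subr0; apply: eq_Rintegral => y; rewrite inE => Oy.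
  rewrite extendE//; congr f.
  by rewrite -{1}(fl_init fl Oy); exact: (fl_ZY fl (lexx 0) Oy).
by rewrite -BE /B subrK.
Qed.

(** [Z r] maps [Omega] into itself, so only values on [Omega] enter. *)
Lemma balanced_eq f g : (forall x, Omega x -> f x = g x) -> balanced f -> balanced g.
Proof.
move=> fg hf s s0.
have Og r y : 0 <= r -> Omega y -> f (Zt r y) = g (Zt r y).
  by move=> r0 Oy; rewrite extendE//; apply: fg; exact: (fl_Z fl r0 Oy).
have -> : mass g s = mass f s.
  by apply: eq_Rintegral => y; rewrite inE => Oy; rewrite Og.
rewrite (hf s s0); congr (_ + _).
  by apply: eq_Rintegral => y; rewrite inE => Oy; exact: fg.
apply: eq_Rintegral => r; rewrite inE /= in_itv /= => /andP[r0 _].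
by apply: eq_Rintegral => y; rewrite inE => Oy; rewrite Og.
Qed.

Hypothesis nfull : exists p, ~ Omega p.

Let balanced_open_sub (V : set 'rV[R]_m) : open V -> V `<=` Omega -> balanced (\1_V : _ -> R).
Proof.
move=> oV VO; have [p0 Op0] := nfull.
have Vp0 : ~ V p0 by move/VO.
have mc k : measurable_fun setT (cutoff V k : 'rV[R]_m -> R).
  apply: measurable_fun_continuous_on; first exact: openT.
  move=> x _; apply/cvg_distP => e e0; exists (e / (k%:R + 1)).
    by rewrite divr_gt0// ltr_wpDl.
  move=> y; rewrite ltr_pdivlMr ?ltr_wpDl// => hy.
  apply: le_lt_trans (cutoff_lip Vp0 k y x) _; apply: le_lt_trans hy.
  by rewrite mulrC ler_wpM2l// lerDl.
have c1 k x : `|cutoff V k x| <= 1.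
  by have /andP[h0 h1] := cutoff_in01 V k x; rewrite ger0_norm.
apply: (@balanced_cvg (cutoff V) _ 1) => //.
- by move=> k; split => //; exists 1.
- by apply: bmf_indic; exact: open_measurable_rV.
- by move=> x; exact: (cutoff_cvg Vp0).
move=> k.
have bV : bounded_set V.
  by move: bO => [M [Mr hM]]; exists M; split => // x Mx y /VO; exact: hM.
have [cF FV] := cutoff_support_compact Vp0 k bV.
apply: (balanced_lipschitz cF (subset_trans FV VO) _ (c1 k) (mc k) (ler0n _ k)).
  by move=> x /cutoff_neq0.
exact: (cutoff_lip Vp0).
Qed.

Lemma balanced_open (V : set 'rV[R]_m) : open V -> balanced (\1_V : _ -> R).
Proof.
move=> oV; apply: (@balanced_eq (\1_(V `&` Omega))).
  by move=> x Ox; rewrite !indicE in_setI (mem_set Ox) andbT.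
by apply: balanced_open_sub; [exact: openI|exact: subIsetr].
Qed.

Lemma balanced_borel (B : set 'rV[R]_m) : measurable B -> balanced (\1_B : _ -> R).
Proof.
move=> mB; apply: (@borel_rV_induction R m (fun B => balanced (\1_B : _ -> R))) mB.
- exact: balanced_open.
- move=> A C mA mC CA hA hC.
  apply: (@balanced_eq (fun x => \1_A x - \1_C x)); last first.
    exact: (balancedB (bmf_indic R mA) (bmf_indic R mC) hA hC).
  move=> x _; rewrite !indicE in_setD.
  have [xC|xC] := boolP (x \in C); last by rewrite andbT subr0.
  by rewrite (mem_set (CA _ (set_mem xC))) subrr.
- move=> F ndF mF hF; apply: (@balanced_cvg (fun n => \1_(F n)) _ 1) => //.
  + by move=> n; exact: bmf_indic.
  + by apply: bmf_indic; exact: bigcupT_measurable.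
  + by move=> n x; rewrite indicE; case: (_ \in _); rewrite ?normr1 ?normr0.
  move=> x; rewrite indicE; apply: cvg_near_cst.
  have [[k _ Fkx]|nF] := pselect ((\bigcup_n F n) x).
    have UFx : (\bigcup_n F n) x by exists k.
    near=> n; have kn : (k <= n)%N by near: n; exact: nbhs_infty_ge.
    have Fnx : F n x by move: Fkx; apply/subsetPset; exact: ndF.
    by rewrite indicE (mem_set UFx) (mem_set Fnx).
  by apply: nearW => n; rewrite indicE (memNset nF) memNset// => Fn; apply: nF; exists n.
Unshelve. all: by end_near. Qed.

Lemma balanced_sum (n : nat) (f_ : nat -> 'rV[R]_m -> R) :
  (forall k, bmf (f_ k)) -> (forall k, balanced (f_ k)) ->
  balanced (fun x => \sum_(k < n) f_ k x).
Proof.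
move=> bf hf; elim: n => [|n ih].
  apply: (@balanced_eq (fun x => 0 * f_ 0%N x)); last exact: balancedZ.
  by move=> x _; rewrite big_ord0 mul0r.
apply: (@balanced_eq (fun x => \sum_(k < n) f_ k x - (-1) * f_ n x)).
  by move=> x _; rewrite big_ord_recr /= mulN1r opprK.
have b1 : bmf (fun x => \sum_(k < n) f_ k x) by apply: bmf_sum => k _; exact: bf.
exact: (balancedB b1 (bmfZ (-1) (bf n)) ih (balancedZ (-1) (bf n) (hf n))).
Qed.

(** Such a function is the uniform limit of the staircases [st n], the mesh [h n] times the number
    of multiples of the mesh that [f x] reaches; each staircase is a combination of indicators of
    Borel sets. *)
Let balanced_nonneg f (C : R) : bmf f -> 0 < C -> (forall x, 0 <= f x <= C) -> balanced f.
Proof.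
move=> bf C0 fC.
pose h (n : nat) : R := C / n.+1%:R.
have h0 n : 0 < h n by rewrite divr_gt0.
pose step n k : set 'rV[R]_m := [set x | h n * k.+1%:R <= f x].
have mS n k : measurable (step n k).
  rewrite (_ : step n k = f @^-1` `[h n * k.+1%:R, +oo[%classic).
    by rewrite -[X in measurable X]setTI; apply: bf.1 => //; exact: measurable_itv.
  by apply/seteqP; split=> x; rewrite /step /preimage /= in_itv /= andbT.
pose st n x := h n * \sum_(k < n.+1) (\1_(step n k) x : R).
have bst1 n : bmf (fun x => \sum_(k < n.+1) (\1_(step n k) x : R)).
  by apply: bmf_sum => k _; exact: bmf_indic.
have close n x : `|st n x - f x| <= h n.
  have /andP[f0 f1] := fC x; pose q := Num.truncn (f x / h n).
  have fh0 : 0 <= f x / h n by rewrite divr_ge0// ltW.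
  have /andP[q1 q2] : q%:R <= f x / h n < q.+1%:R by exact: truncn_itv.
  (* The n+1 thresholds go exactly up to [C], so the sum misses none of those reached by [f x]. *)
  have qn : (q <= n.+1)%N.
    rewrite -(ler_nat R); apply: le_trans q1 _; rewrite ler_pdivrMr//.
    by rewrite /h mulrCA divff ?mulr1// pnatr_eq0.
  have sumq (N : nat) : \sum_(k < N) (\1_(step n k) x : R) = (minn N q)%:R.
    elim: N => [|N ih]; first by rewrite big_ord0 min0n.
    rewrite big_ord_recr /= ih indicE.
    have -> : (x \in step n N) = (N < q)%N.
      apply/idP/idP => [|Nq].
        rewrite inE /step /= mulrC -ler_pdivlMr// => hN.
        by rewrite -ltnS -(ltr_nat R); exact: le_lt_trans q2.
      rewrite inE /step /= mulrC -ler_pdivlMr//; apply: le_trans q1.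
      by rewrite ler_nat.
    case: (ltnP N q) => Nq; last by rewrite addr0 !minnE; congr _%:R; lia.
    by rewrite -natrD !minnE; congr _%:R; lia.
  rewrite /st sumq (minn_idPr qn).
  move: q1 q2; rewrite ler_pdivlMr// ltr_pdivrMr// -natr1 => q1 q2.
  by rewrite ler_norml; apply/andP; split; move: q1 q2; rewrite mulrDl mul1r [q%:R * _]mulrC; lra.
apply: (@balanced_cvg st _ (2 * C)) => //.
- by move=> n; exact: bmfZ (bst1 n).
- move=> n x; have := close n x; have /andP[f0 f1] := fC x.
  have hC : h n <= C by rewrite /h ler_pdivrMr//; apply: ler_peMr; [exact: ltW|rewrite ler1n].
  rewrite !ler_norml => /andP[c1 c2]; apply/andP; split; lra.
- move=> x; apply/cvgrPdist_le => e e0.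
  near=> n; rewrite distrC; apply: le_trans (close n x) _.
  rewrite /h ler_pdivrMr// mulrC -ler_pdivrMr//.
  apply: (@le_trans _ _ n%:R); last by rewrite ler_nat.
  near: n; exact: nbhs_infty_ger.
- move=> n; apply: (balancedZ (h n) (bst1 n)).
  apply: (@balanced_sum n.+1 (fun k => \1_(step n k))) => k; first exact: bmf_indic.
  exact: balanced_borel.
Unshelve. all: by end_near. Qed.

Theorem balanced_bmf f : bmf f -> balanced f.
Proof.
move=> bf; have [_ [C hC]] := bf.
have C0 : 0 <= C := le_trans (normr_ge0 _) (hC 0).
have bc (c : R) : bmf (fun _ : 'rV[R]_m => c) by exact: bmf_cst.
apply: (@balanced_eq (fun x => (f x + (C + 1)) - (C + 1))); first by move=> x _; rewrite addrK.
apply: balancedB => //; first exact: bmfD.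
  apply: (balanced_nonneg (C := 2 * C + 1)); [exact: bmfD|lra|].
  by move=> x; have := hC x; rewrite ler_norml => /andP[]; move=> h1 h2; apply/andP; split; lra.
by apply: (balanced_nonneg (C := C + 1)) => //; [lra|move=> x; apply/andP; split; lra].
Qed.

End mass_balance.

Lemma expR_taylor1 (R : realType) (x : R) : `|x| <= 2^-1 ->
  `|expR x - 1 - x| <= 2 * x ^+ 2.
Proof.
move=> hx; have := hx; rewrite ler_norml => /andP[h1 h2].
have l := expR_ge1Dx x; have l' := expR_ge1Dx (- x).
rewrite expRN in l'; have e0 := expR_gt0 x.
have u : expR x * (1 - x) <= 1.
  by rewrite mulrC -ler_pdivlMr// div1r.
rewrite ger0_norm; last lra.
have x2 : 0 <= x ^+ 2 by exact: sqr_ge0.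
move: x2; rewrite expr2 => x2; nra.
Qed.

Lemma mul_lt_divS (R : realFieldType) (D h e : R) : 0 <= D -> 0 <= h ->
  h < e / (D + 1) -> D * h <= e.
Proof.
move=> D0 h0; rewrite ltr_pdivlMr; last by rewrite ltr_wpDl.
by move=> he; apply: le_trans (ltW he); rewrite mulrDr mulr1 mulrC lerDl.
Qed.

(** * Change of variables along the flow *)

Section change_of_variables.
Context {R : realType} {m : nat}.
Notation leb := (@lebesgue_measure R).
Notation mu := (lebesgue_rV m).
Variables (Omega : set 'rV[R]_m) (oO : open Omega) (finO : (mu Omega < +oo)%E).
Hypotheses (bO : bounded_set Omega) (nfull : exists p, ~ Omega p).
Variables (v Y Z : R -> 'rV[R]_m -> 'rV[R]_m) (d : R -> 'rV[R]_m -> R) (Dm : R).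
Hypotheses (rf : regular_field Omega v d Dm) (fl : regular_flow Omega v Y Z).
Notation Yt := (extend Omega Y).
Notation Zt := (extend Omega Z).
Notation mass := (mass Omega Z).
Notation rate := (mass_rate Omega Z d).
Implicit Types f g psi : 'rV[R]_m -> R.

Let mO : measurable Omega. Proof. exact: open_measurable_rV. Qed.

Let mI (s t : R) : measurable (`[s, t]%classic : set (measurableTypeR R)).
Proof. exact: measurable_itv. Qed.

Let D0 : 0 <= Dm. Proof. exact: le_trans (normr_ge0 _) (rf_d rf 0 0). Qed.

Let balance f : bmf f -> forall s, 0 <= s ->
  mass f s = \int[mu]_(y in Omega) f y + \int[leb]_(r in `[0, s]) rate f r.
Proof. by move=> bf; exact: (balanced_bmf oO finO bO rf fl nfull bf). Qed.

Definition flow_div (r : R) (x : 'rV[R]_m) : R := d r (Yt r x).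

(** Liouville's formula for the logarithm of the Jacobian determinant of [Y t], taken here as the
    definition. *)
Definition log_jacobian (t : R) (x : 'rV[R]_m) : R := \int[leb]_(r in `[0, t]) flow_div r x.

Lemma bmf_flow_div : bmf (fun p : measurableTypeR R * 'rV[R]_m => flow_div p.1 p.2).
Proof.
have mh : measurable_fun setT (fun p : measurableTypeR R * 'rV[R]_m => (p.1, Yt p.1 p.2)).
  by apply/measurable_fun_pairP; split; [exact: measurable_fst|exact: (measurable_flow oO rf fl)].
exact: (bmf_comp (bmf_d rf) mh).
Qed.

Lemma bmf_log_jacobian t : bmf (log_jacobian t).
Proof. exact: (bmf_int1 (mI 0 t) (leb_itv_fin 0 t) bmf_flow_div). Qed.

Let bfd r : bmf (flow_div r).
Proof. exact: (bmf_sec1 r bmf_flow_div). Qed.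

Let bfdr x : bmf (T := measurableTypeR R) (flow_div ^~ x).
Proof. exact: (bmf_sec2 x bmf_flow_div). Qed.

Lemma log_jacobianB s t x : 0 <= t -> t <= s ->
  log_jacobian s x - log_jacobian t x = \int[leb]_(r in `[t, s]) flow_div r x.
Proof.
by move=> t0 ts; rewrite /log_jacobian (bint_itv_split (bfdr x) t0 ts) addrAC subrr add0r.
Qed.

Lemma log_jacobian_le t x : 0 <= t -> `|log_jacobian t x| <= Dm * t.
Proof.
move=> t0; rewrite -{2}[t]subr0 -(fine_leb_itv t0).
apply: (bint_norm_le (mI 0 t) (leb_itv_fin 0 t) (bfdr x)) => r _; exact: rf_d rf _ _.
Qed.

Lemma bmf_expR f : bmf f -> bmf (fun x => expR (f x)).
Proof.
move=> [mf [C hC]]; split; first exact: (measurableT_comp (@measurable_expR R)).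
exists (expR C) => x; rewrite ger0_norm ?expR_ge0// ler_expR.
exact: le_trans (ler_norm _) (hC x).
Qed.

(** [psi] divided by the Jacobian. The change of variables says that the mass of this function,
    carried by the flow, does not depend on time. *)
Definition weighted psi (t : R) (x : 'rV[R]_m) : R := psi x * expR (- log_jacobian t x).

Let bw psi t : bmf psi -> bmf (weighted psi t).
Proof. by move=> bp; apply: bmfM => //; apply: bmf_expR; apply: bmfN; exact: bmf_log_jacobian. Qed.

Let mass_diff f (C : R) t s : bmf f -> (forall x, `|f x| <= C) -> 0 <= t -> t <= s ->
  mass f s - mass f t = \int[leb]_(r in `[t, s]) rate f r /\
  `|mass f s - mass f t| <= Dm * C * fine (mu Omega) * (s - t).
Proof.
move=> bf fC t0 ts; have s0 := le_trans t0 ts.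
have br := bmf_rate oO finO rf fl bf.
have e : mass f s - mass f t = \int[leb]_(r in `[t, s]) rate f r.
  rewrite (balance bf s0) (balance bf t0) (bint_itv_split br t0 ts).
  move: (Rintegral _ _ _) (Rintegral _ _ _) (Rintegral _ _ _) => a b c; ring.
split=> //; rewrite e -(fine_leb_itv ts).
apply: (bint_norm_le (mI t s) (leb_itv_fin t s) br) => r _.
have b1 : bmf (fun y => d r y * f (Zt r y)).
  by apply: bmfM; [exact: (bmf_sec1 r (bmf_d rf))|exact: (bmf_transport_at oO rf fl r bf)].
apply: (bint_norm_le mO finO b1) => y _.
by rewrite normrM; apply: ler_pM => //; exact: rf_d rf _ _.
Qed.

(** With [f = weighted psi s], the function at time [t] is [f * expR (de x)], [de] being the
    integral of the divergence along the trajectory over [t, s]. The term linear in [de] cancels the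
    increment of the mass of [f] to first order, and a quadratic increment forces constancy. *)
Let step psi (P T s t : R) : bmf psi -> (forall x, `|psi x| <= P) ->
  0 <= t -> t <= s -> s <= T -> Dm * (s - t) <= 2^-1 ->
  `|mass (weighted psi s) s - mass (weighted psi t) t| <=
   (3 * (P * expR (Dm * T)) * Dm ^+ 2 * fine (mu Omega)) * (s - t) ^+ 2.
Proof.
move=> bp pP t0 ts sT hs.
have s0 := le_trans t0 ts.
pose f := weighted psi s; pose E := P * expR (Dm * T).
have P0 : 0 <= P := le_trans (normr_ge0 _) (pP 0).
have M0 : 0 <= fine (mu Omega) by exact: fine_ge0.
have bf : bmf f by exact: bw.
have fE x : `|f x| <= E.
  rewrite /f /weighted normrM; apply: ler_pM => //.
  rewrite ger0_norm ?expR_ge0// ler_expR.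
  apply: le_trans (ler_norm _) _; rewrite normrN.
  by apply: le_trans (log_jacobian_le x s0) _; rewrite ler_wpM2l.
pose de x := log_jacobian s x - log_jacobian t x.
have bde : bmf de by apply: bmfB; exact: bmf_log_jacobian.
have deD x : `|de x| <= Dm * (s - t).
  rewrite /de log_jacobianB// -(fine_leb_itv ts).
  by apply: (bint_norm_le (mI t s) (leb_itv_fin t s) (bfdr x)) => r _; exact: rf_d rf _ _.
pose q x := expR (de x) - 1 - de x.
have bq : bmf q by apply: bmfB => //; apply: bmfB; [exact: bmf_expR|exact: bmf_cst].
have phiE x : weighted psi t x = f x * de x + f x * q x + f x.
  have -> : weighted psi t x = f x * expR (de x).
    rewrite /f /weighted /de -mulrA -expRD; congr (_ * expR _).
    by rewrite addrA addNr add0r.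
  by rewrite /q; ring.
have bfde : bmf (fun x => f x * de x) by exact: bmfM.
have bfq : bmf (fun x => f x * q x) by exact: bmfM.
have tr := bmf_transport_at oO rf fl t.
have massD : mass (weighted psi t) t =
    mass (fun x => f x * de x) t + mass (fun x => f x * q x) t + mass f t.
  rewrite /mass -(bintD mO finO (tr _ bfde) (tr _ bfq)).
  rewrite -(bintD mO finO (bmfD (tr _ bfde) (tr _ bfq)) (tr _ bf)).
  by apply: eq_Rintegral => y _; exact: phiE.
have massq : `|mass (fun x => f x * q x) t| <= E * (2 * (Dm * (s - t)) ^+ 2) * fine (mu Omega).
  apply: (bint_norm_le mO finO (tr _ bfq)) => y _.
  rewrite normrM; apply: ler_pM => //.
  apply: le_trans (expR_taylor1 (le_trans (deD _) hs)) _.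
  rewrite ler_wpM2l// -real_normK ?num_real// lerXn2r ?nnegrE//.
  by apply: le_trans (deD (Zt t y)).
have bk : bmf (fun p : measurableTypeR R * 'rV[R]_m => f (Zt t p.2) * flow_div p.1 (Zt t p.2)).
  have mz : measurable_fun setT (fun p : measurableTypeR R * 'rV[R]_m => Zt t p.2).
    apply: (measurableT_comp (f := fun y => Zt t y)); last exact: measurable_snd.
    exact: (measurableT_comp (measurable_inverse_flow oO rf fl) (pair1_measurable t)).
  apply: bmfM; first exact: (bmf_comp bf).
  have mh : measurable_fun setT (fun p : measurableTypeR R * 'rV[R]_m => (p.1, Zt t p.2)).
    by apply/measurable_fun_pairP; split; [exact: measurable_fst|].
  exact: (bmf_comp bmf_flow_div mh).
have massde : mass (fun x => f x * de x) t =
    \int[leb]_(r in `[t, s]) mass (fun x => f x * flow_div r x) t.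
  rewrite [RHS](bfubini (mI t s) mO (leb_itv_fin t s) finO bk) /mass.
  apply: eq_Rintegral => y _ /=; rewrite /de log_jacobianB//.
  by rewrite (bintZ (mI t s) (leb_itv_fin t s) _ (bfdr _)).
have bfr r : bmf (fun x => f x * flow_div r x) by exact: bmfM.
have fr r x : `|f x * flow_div r x| <= E * Dm.
  by rewrite normrM; apply: ler_pM => //; exact: rf_d rf _ _.
(* Read at the starting point [x = Z r y], the number [d r y] is [flow_div r x]. *)
have rateE r : 0 <= r -> rate f r = mass (fun x => f x * flow_div r x) r.
  move=> r0; apply: eq_Rintegral => y; rewrite inE => Oy; rewrite mulrC; congr (_ * d r _).
  by rewrite extendE// extendE ?(fl_YZ fl r0 Oy)//; exact: (fl_Z fl r0 Oy).
have br := bmf_rate oO finO rf fl bf.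
(* Both the increment and the linear term are integrals over [t, s] of masses of [f * flow_div r],
   taken at time [r] for the former and [t] for the latter; such a mass moves by O(s - t) in
   between. *)
have main : `|mass f s - mass f t - mass (fun x => f x * de x) t| <=
    Dm * (E * Dm) * fine (mu Omega) * (s - t) * (s - t).
  rewrite (mass_diff bf fE t0 ts).1 massde -[X in _ * X](fine_leb_itv ts).
  have bm : bmf (T := measurableTypeR R) (fun r => mass (fun x => f x * flow_div r x) t).
    exact: (bmf_int2 mO finO bk).
  apply: (bint_dist_le (mI t s) (leb_itv_fin t s) br bm) => r.
  rewrite /= in_itv /= => /andP[tr' rs]; have r0 := le_trans t0 tr'.
  rewrite (rateE _ r0); apply: le_trans (mass_diff (bfr r) (fr r) t0 tr').2 _.
  by rewrite ler_wpM2l ?lerD2r// !mulr_ge0.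
rewrite massD -/f.
move: main massq; rewrite -/E.
move: (mass f s) (mass f t) (mass (fun x => f x * de x) t) (mass (fun x => f x * q x) t).
move=> a b c g h1 h2.
(* The constant 3 is 1 from [main] plus 2 from the exponential remainder in [massq]. *)
have -> : a - (c + g + b) = (a - b - c) - g by ring.
apply: le_trans (ler_normB _ _) _; apply: le_trans (lerD h1 h2) _.
rewrite le_eqVlt; apply/orP; left; apply/eqP; ring.
Qed.

Theorem mass_weighted psi t : bmf psi -> 0 <= t ->
  mass (weighted psi t) t = \int[mu]_(y in Omega) psi y.
Proof.
move=> bp t0; have [_ [P pP]] := bp.
have -> : \int[mu]_(y in Omega) psi y = mass (weighted psi 0) 0.
  apply: eq_Rintegral => y; rewrite inE => Oy.
  have -> : Zt 0 y = y.
    by rewrite extendE// -{1}(fl_init fl Oy); exact: (fl_ZY fl (lexx 0) Oy).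
  by rewrite /weighted /log_jacobian set_itv1 Rintegral_set1 oppr0 expR0 mulr1.
apply: (@zero_derivative_constant _ (fun s => mass (weighted psi s) s)) => // s /andP[s0 st] e e0.
have D0' := D0.
pose K := 3 * (P * expR (Dm * t)) * Dm ^+ 2 * fine (mu Omega).
have K0 : 0 <= K.
  rewrite !mulr_ge0 ?expR_ge0 ?sqr_ge0 ?fine_ge0//.
  exact: le_trans (normr_ge0 _) (pP 0).
exists (Num.min (2^-1 / (Dm + 1)) (e / (K + 1))).
  by rewrite lt_min !divr_gt0//; lra.
move=> r /andP[r0 rt]; rewrite lt_min => /andP[h1 h2].
have key a b : 0 <= a -> a <= b -> b <= t -> `|b - a| < 2^-1 / (Dm + 1) -> `|b - a| < e / (K + 1) ->
    `|mass (weighted psi b) b - mass (weighted psi a) a| <= e * `|b - a|.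
  move=> a0 ab bt; have ba0 : 0 <= b - a by rewrite subr_ge0.
  rewrite (ger0_norm ba0) => k1 k2.
  have k3 := mul_lt_divS D0' ba0 k1.
  apply: (le_trans (step bp pP a0 ab bt k3)).
  rewrite -/K expr2 mulrA; apply: (ler_wpM2r ba0); exact: mul_lt_divS K0 ba0 k2.
have [sr|/ltW rs] := leP s r; first exact: key.
by rewrite distrC [`|r - s|]distrC; apply: key => //; rewrite distrC.
Qed.

End change_of_variables.

Lemma cvg_truncated_integral d (T : measurableType d) (R : realType)
    (mu : {measure set T -> \bar R}) (D : set T) (g w : T -> R) :
  measurable D -> measurable_fun setT g -> measurable_fun setT w ->
  (forall x, 0 <= g x) -> (forall x, 0 <= w x) ->
  (\int[mu]_(x in D) (Num.min (g x) n%:R * w x)%:E)%E @[n --> \oo] -->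
  (\int[mu]_(x in D) (g x * w x)%:E)%E.
Proof.
move=> mD mg mw g0 w0.
have min0 (n : nat) x : 0 <= Num.min (g x) n%:R by rewrite le_min g0 ler0n.
have -> : (\int[mu]_(x in D) (g x * w x)%:E)%E =
    (\int[mu]_(x in D) limn (fun n => (Num.min (g x) n%:R * w x)%:E))%E.
  apply: eq_integral => x _; apply/esym/cvg_lim => //.
  apply: (@cvg_near_cst); near=> n; congr (_ * _)%:E.
  by apply: min_l; near: n; exact: nbhs_infty_ger.
apply: (@cvg_monotone_convergence _ _ _ mu D mD (fun n x => (Num.min (g x) n%:R * w x)%:E)).
- move=> n; apply/measurable_EFinP; apply: measurable_funS (@measurableT _ _) _ _ => //.
  by apply: measurable_funM => //; apply: measurable_minr.
- by move=> n x _; rewrite lee_fin mulr_ge0.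
- move=> x _ a b ab; rewrite lee_fin ler_wpM2r// le_min !ge_min lexx/= ler_nat ab orbT.
  by [].
Unshelve. all: by end_near. Qed.

Lemma null_ge0_integral d (T : measurableType d) (R : realType)
    (mu : {measure set T -> \bar R}) (D : set T) (g : T -> R) :
  measurable D -> measurable_fun setT g -> (forall x, 0 <= g x) ->
  (\int[mu]_(x in D) (g x)%:E = 0)%E <-> {ae mu, forall x, D x -> g x = 0}.
Proof.
move=> mD mg g0.
have mg' : measurable_fun D (EFin \o g).
  by apply/measurable_EFinP; apply: measurable_funS (@measurableT _ _) _ mg.
have := ae_eq_integral_abs mu mD mg'.
have -> : (\int[mu]_(x in D) `|(EFin \o g) x| = \int[mu]_(x in D) (g x)%:E)%E.
  by apply: eq_integral => x _; rewrite /= ger0_norm.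
move=> ->; split; apply: filterS => x h Dx; first by have [] := h Dx.
by rewrite /= h.
Qed.

Section transport_consequences.
Context {R : realType} {m : nat}.
Notation leb := (@lebesgue_measure R).
Notation mu := (lebesgue_rV m).
Variables (Omega : set 'rV[R]_m) (oO : open Omega) (finO : (mu Omega < +oo)%E).
Hypotheses (bO : bounded_set Omega) (nfull : exists p, ~ Omega p).
Variables (v Y Z : R -> 'rV[R]_m -> 'rV[R]_m) (d : R -> 'rV[R]_m -> R) (Dm : R).
Hypotheses (rf : regular_field Omega v d Dm) (fl : regular_flow Omega v Y Z).
Notation Yt := (extend Omega Y).
Notation Zt := (extend Omega Z).
Notation log_jac := (log_jacobian Omega Y d).

Let mO : measurable Omega. Proof. exact: open_measurable_rV. Qed.

Let mZ t : measurable_fun setT (Zt t).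
Proof. exact: (measurableT_comp (measurable_inverse_flow oO rf fl) (pair1_measurable t)). Qed.

Let mY t : measurable_fun setT (Yt t).
Proof. exact: (measurableT_comp (measurable_flow oO rf fl) (pair1_measurable t)). Qed.

Let mw t : measurable_fun setT (fun y => expR (- log_jac t (Zt t y))).
Proof.
apply: (measurableT_comp (f := fun x => expR (- log_jac t x))) (mZ t).
apply: (bmf_expR _).1; apply: bmfN; exact: (bmf_log_jacobian oO rf fl).
Qed.

(** Truncation brings [G] into the bounded case and monotone convergence removes it. It is meant for
    squares of L^2 functions, which may be unbounded. *)
Lemma ge0_change_of_variables (G : 'rV[R]_m -> R) t : measurable_fun setT G ->
  (forall x, 0 <= G x) -> 0 <= t ->
  (\int[mu]_(y in Omega) (G (Zt t y) * expR (- log_jac t (Zt t y)))%:E =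
   \int[mu]_(y in Omega) (G y)%:E)%E.
Proof.
move=> mG G0 t0.
have mGZ : measurable_fun setT (fun y => G (Zt t y)) by exact: measurableT_comp.
have c1 := cvg_truncated_integral (mu := mu) mO mGZ (mw t) (fun y => G0 _) (fun y => expR_ge0 _).
have c2 := cvg_truncated_integral (mu := mu) mO mG (measurable_cst (1 : R)) G0 (fun y => ler01).
have -> : (\int[mu]_(y in Omega) (G y)%:E = \int[mu]_(y in Omega) (G y * 1)%:E)%E.
  by apply: eq_integral => y _; rewrite mulr1.
apply: (cvg_unique _ c1); rewrite -/(_ --> _); first exact: ereal_hausdorff.
move: c2; apply: cvg_trans; apply: near_eq_cvg; near=> n.
have bp : bmf (fun y => Num.min (G y) n%:R).
  split; first exact: measurable_minr.
  exists n%:R => y; rewrite ger0_norm; last by rewrite le_min G0 ler0n.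
  by rewrite ge_min lexx orbT.
have bq := bmf_transport_at oO rf fl t
  (bmfM bp (bmf_expR (bmfN (bmf_log_jacobian oO rf fl t)))).
rewrite (bmf_EFin_int mO finO bq) [X in X%:E](mass_weighted oO finO bO nfull rf fl bp t0).
by rewrite -(bmf_EFin_int mO finO bp); apply: eq_integral => y _; rewrite mulr1.
Unshelve. all: by end_near. Qed.

(** The change of variables is applied to the indicator of [N] composed with [Y t]: composing
    further with [Z t] gives back the indicator of [N], whose integral is 0. *)
Lemma null_flow_preimage (N : set 'rV[R]_m) t : measurable N -> mu N = 0%E -> 0 <= t ->
  {ae mu, forall x, Omega x -> ~ N (Y t x)}.
Proof.
move=> mN N0 t0.
have b : bmf (fun x => (\1_N (Yt t x) : R)) by exact: (bmf_comp (bmf_indic R mN) (mY t)).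
have cv := ge0_change_of_variables b.1 (fun x => ler0n _ _) t0.
have mg : measurable_fun setT (fun y => \1_N (Yt t (Zt t y)) * expR (- log_jac t (Zt t y))).
  by apply: measurable_funM => //; exact: measurableT_comp b.1 (mZ t).
have g0 y : 0 <= \1_N (Yt t (Zt t y)) * expR (- log_jac t (Zt t y)).
  by rewrite mulr_ge0 ?expR_ge0// ler0n.
rewrite (null_ge0_integral mu mO mg g0).2 in cv; last first.
  exists N; split=> // y /= h; apply: contrapT => nN; apply: h => Oy.
  have zO := fl_Z fl t0 Oy.
  have e1 : Zt t y = Z t y by rewrite extendE.
  have e2 : Yt t (Zt t y) = y by rewrite e1 extendE// (fl_YZ fl t0 Oy).
  by rewrite e2 indicE memNset// mul0r.
move: (esym cv) => /(null_ge0_integral mu mO b.1 (fun x => ler0n _ _)).1; apply: filterS => x h Ox Nx.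
have := h Ox; rewrite extendE// indicE mem_set// => /eqP; by rewrite oner_eq0.
Qed.

(** The change of variables is applied to the indicator of [N] itself; the Jacobian factor is
    positive, so a zero integral makes the indicator vanish at almost every [Z t y]. *)
Lemma null_inverse_flow_preimage (N : set 'rV[R]_m) t : measurable N -> mu N = 0%E -> 0 <= t ->
  {ae mu, forall y, Omega y -> ~ N (Z t y)}.
Proof.
move=> mN N0 t0.
have b := bmf_indic R mN.
have cv := ge0_change_of_variables b.1 (fun x => ler0n _ _) t0.
have mg : measurable_fun setT (fun y => \1_N (Zt t y) * expR (- log_jac t (Zt t y))).
  by apply: measurable_funM => //; exact: measurableT_comp b.1 (mZ t).
have g0 y : 0 <= \1_N (Zt t y) * expR (- log_jac t (Zt t y)).
  by rewrite mulr_ge0 ?expR_ge0// ler0n.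
rewrite (null_ge0_integral mu mO b.1 (fun x => ler0n _ _)).2 in cv; last first.
  exists N; split=> // y /= h; apply: contrapT => nN; apply: h => Oy.
  by rewrite indicE memNset.
move: cv => /(null_ge0_integral mu mO mg g0).1; apply: filterS => y h Oy Ny.
have := h Oy; rewrite extendE// indicE mem_set// mul1r => /eqP.
by rewrite gt_eqF// expR_gt0.
Qed.

(** Pulled back by (r, x) |-> (r, Y r x), the exceptional set has null sections at almost every time
    by [null_flow_preimage]. It is therefore null, and slicing it by [x] instead of [r] gives the
    claim. *)
Lemma ae_along_flow (P : R * 'rV[R]_m -> Prop) t :
  {ae (leb \x mu)%E, forall p : measurableTypeR R * 'rV[R]_m, P p} -> 0 <= t ->
  {ae mu, forall x, Omega x -> {ae leb, forall r : measurableTypeR R, 0 <= r <= t -> P (r, Y r x)}}.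
Proof.
move=> [N [mN N0 sN]] t0.
pose A := [set p : measurableTypeR R * 'rV[R]_m |
   [/\ 0 <= p.1, Omega p.2 & N (p.1, Yt p.1 p.2)]].
have mA : measurable A.
  rewrite (_ : A = (`[0, +oo[ `*` Omega) `&`
     (fun p : measurableTypeR R * 'rV[R]_m => (p.1, Yt p.1 p.2)) @^-1` N).
    apply: measurableI; first exact: measurableX.
    rewrite -[X in measurable X]setTI.
    have mh : measurable_fun setT (fun p : measurableTypeR R * 'rV[R]_m => (p.1, Yt p.1 p.2)).
      by apply/measurable_fun_pairP; split; [exact: measurable_fst|exact: (measurable_flow oO rf fl)].
    exact: mh.
  apply/seteqP; split=> -[r x] /=; first by move=> [r0 Ox Nx]; rewrite in_itv/= r0.
  by rewrite in_itv/= andbT => -[[? ?] ?].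
have nN : {ae leb, forall r : measurableTypeR R, mu (xsection N r) = 0%E}.
  have : {ae (leb \x mu)%E, forall p, ~ N p} by exists N; split => // p /= /contrapT.
  move/ae_prod1; apply: filterS => r [B [mB B0 sB]].
  apply: (@subset_measure0 _ _ _ mu _ B) => //; first exact: measurable_xsection.
  by move=> x; rewrite /xsection /= inE => Nx; apply: sB => /=.
have A0 : (leb \x mu)%E A = 0%E.
  apply: prod_null => //; move: nN; apply: filterS => r Nr.
  have [r0|r0] := leP 0 r; last first.
    rewrite (_ : xsection A r = set0) ?measure0//.
    by apply/seteqP; split=> x //; rewrite /xsection /= inE => -[]; rewrite /= leNgt r0.
  have mNr : measurable (xsection N r) by exact: measurable_xsection.
  have [B [mB B0 sB]] := null_flow_preimage mNr Nr r0.
  apply: (@subset_measure0 _ _ _ mu _ B) => //; first exact: measurable_xsection.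
  move=> x; rewrite /xsection /= inE => -[_ /= Ox Nx]; apply: sB => /= /(_ Ox); apply.
  by rewrite /xsection /= inE; rewrite extendE// in Nx.
have : {ae (leb \x mu)%E, forall p, ~ A p} by exists A; split => // p /= /contrapT.
move/ae_prod2; apply: filterS => x hx Ox; move: hx; apply: filterS => r nA /andP[r0 rt].
apply: contrapT => nP; apply: nA; split => //=.
by rewrite extendE//; exact: sN.
Qed.

End transport_consequences.

(** * Borel representatives of the velocity field *)

Section representatives.
Context {R : realType} {m : nat}.
Notation leb := (@lebesgue_measure R).
Notation mu := (lebesgue_rV m).
Implicit Types (Omega : set 'rV[R]_m).

Lemma open_ae_ex (U : set 'rV[R]_m) (P : 'rV[R]_m -> Prop) p : open U -> U p ->
  {ae mu, forall x, P x} -> exists2 x, U x & P x.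
Proof.
move=> /open_ballP oU /oU[e e0 he] [N [mN N0 sN]].
apply: contrapT => hn.
have : (mu [set y : 'rV[R]_m | (`|y - p| < e)%R] <= mu N)%E.
  apply: le_measure; rewrite ?inE//; first exact: measurable_rVball.
  by move=> y /= ye; apply: sN => Py; apply: hn; exists y => //; exact: he.
by rewrite N0 lebesgue_rVball// lee_fin leNgt exprn_gt0// mulr_gt0.
Qed.

Definition clamp (M x : R) : R := Num.max (- M) (Num.min M x).

Lemma clamp_le M x : 0 <= M -> `|clamp M x| <= M.
Proof.
move=> M0; rewrite /clamp ler_norml le_max lexx/= ge_max ge_min lexx/= andbT.
by rewrite lerNl (le_trans _ M0)// oppr_le0.
Qed.

Lemma clampE M x : `|x| <= M -> clamp M x = x.
Proof. by rewrite ler_norml => /andP[h1 h2]; rewrite /clamp min_r// max_r. Qed.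

Lemma bmf_clamp d (T : measurableType d) (f : T -> R) M : 0 <= M -> measurable_fun setT f ->
  bmf (fun x => clamp M (f x)).
Proof.
move=> M0 mf; split; last by exists M => x; exact: clamp_le.
by apply: measurable_maxr => //; apply: measurable_minr.
Qed.

Lemma ae_fst (P : R -> Prop) : {ae leb, forall t : measurableTypeR R, P t} ->
  {ae (leb \x mu)%E, forall p : measurableTypeR R * 'rV[R]_m, P p.1}.
Proof.
move=> [N [mN N0 sN]]; exists (N `*` setT); split.
- exact: measurableX.
- by rewrite (product_measure1E leb mu)// [X in (X * _)%E](N0 : _) mul0e.
- by move=> [t x] /= h; split => //; apply: sN.
Qed.

Lemma bmf_test_function Omega (phi : 'rV[R]_m -> R) : test_function Omega phi ->
  bmf phi /\ forall i, bmf (partial i phi).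
Proof.
move=> [Ck cS _]; set S := closure _ in cS.
have key (f : 'rV[R]_m -> R) : continuous f -> (forall x, ~ S x -> f x = 0) -> bmf f.
  move=> cf f0; split; first by apply: measurable_fun_continuous_on => [|x _]; [exact: openT|exact: cf].
  have cS' : compact (f @` S) by apply: continuous_compact => //; exact: continuous_subspaceT.
  have [M [_ hM]] := compact_bounded cS'.
  exists (Num.max (M + 1) 0) => x; rewrite le_max; have [Sx|nSx] := pselect (S x).
    by rewrite (hM (M + 1)) ?ltrDl//; exists x.
  by rewrite f0// normr0 lexx orbT.
split.
  apply: key; first by move=> x; apply: (Ck 0).1; rewrite inE.
  move=> x nS; apply: contrapT => fx; apply: nS; apply: subset_closure; exact/eqP.
move=> i; have [c h] := Ck 1; have [_ [cp _]] := h i.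
apply: key => [x|x nS]; first by apply: cp; rewrite inE.
have : nbhs x (~` S) by apply: open_nbhs_nbhs; split => //; apply: closed_openC; exact: closed_closure.
move=> nb; rewrite /partial; rewrite (near_eq_derive (g := cst 0)) ?derive_cst//.
move: nb; apply: filterS => y nS'; apply: contrapT => fy; apply: nS'.
by apply: subset_closure; exact/eqP.
Qed.

Lemma mx_coord_le p q (A : 'M[R]_(p, q)) i j : `|A i j| <= `|A|.
Proof.
rewrite [leRHS]mx_normrE.
exact: (le_bigmax _ (fun k : 'I_p * 'I_q => `|A k.1 k.2|) (i, j)).
Qed.

(** A rational ball has positive measure, so it contains a point where [P] holds; one is picked in
    each ball contained in [Omega]. Indices that code no such ball receive a point outside [Omega],
    where nothing is claimed. *)
Lemma dense_good_points Omega (P : 'rV[R]_m -> Prop) : open Omega -> (exists p, ~ Omega p) ->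
  {ae mu, forall x, P x} -> exists q : nat -> 'rV[R]_m,
  (forall k, Omega (q k) -> P (q k)) /\
  forall x, Omega x -> forall e : R, 0 < e -> exists k, `|x - q k| < e.
Proof.
move=> oO [p0 np0] aeP.
pose B (p : 'rV[rat]_m * nat) : set 'rV[R]_m := [set y | `|y - (rat_rV p.1 : 'rV[R]_m)| < p.2.+1%:R^-1].
have oB p : open (B p).
  apply/open_ballP => x Bx; exists (p.2.+1%:R^-1 - `|x - (rat_rV p.1 : 'rV[R]_m)|); first by rewrite subr_gt0.
  move=> y; rewrite ltrBrDr => h; apply: le_lt_trans h.
  by rewrite -[y in leLHS](subrK x) -addrA ler_normD.
have /choice[q hq] k : exists x : 'rV[R]_m, (forall p : 'rV[rat]_m * nat, unpickle k = Some p ->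
    B p `<=` Omega -> B p x) /\ (Omega x -> P x).
  case uk : (unpickle k : option ('rV[rat]_m * nat)%type) => [p|]; last first.
    by exists p0; split.
  have [sB|nB] := pselect (B p `<=` Omega); last by exists p0; split => // p' [<-] /nB.
  have pB : B p (rat_rV p.1 : 'rV[R]_m) by rewrite /B/= subrr normr0 invr_gt0 ltr0n.
  by have [x Bx Px] := open_ae_ex (oB p) pB aeP; exists x; split => // p' [<-].
exists q; split=> [k|x Ox e e0]; first exact: (hq k).2.
pose U := Omega `&` [set y | `|y - x| < e].
have oU : open U.
  apply: openI => //; apply/open_ballP => z /= zx; exists (e - `|z - x|); first by rewrite subr_gt0.
  move=> y; rewrite ltrBrDr => h; apply: le_lt_trans h.
  by rewrite -[y in leLHS](subrK z) -addrA ler_normD.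
have Ux : U x by split => //=; rewrite subrr normr0.
move: Ux; rewrite [X in X x](open_rat_balls oU) => -[p sp _].
exists (pickle p); rewrite distrC.
have Bq : B p (q (pickle p)).
  by apply: (hq _).1; rewrite ?pickleK// => y /sp[].
exact: (sp _ Bq).2.
Qed.

Lemma open_within_continuous Omega (f : 'rV[R]_m -> 'rV[R]_m) : open Omega ->
  {within closure Omega, continuous f} -> {in Omega, continuous f}.
Proof.
move=> oO cf x; rewrite inE => Ox.
have : {within Omega, continuous f}.
  by apply: continuous_subspaceW cf; exact: subset_closure.
by rewrite continuous_open_subspace// => h; apply: h; rewrite inE.
Qed.

Section slice.
Variables (Omega : set 'rV[R]_m) (oO : open Omega) (finO : (mu Omega < +oo)%E).
Variables (w : 'rV[R]_m -> 'rV[R]_m) (W : 'rV[R]_m -> 'M[R]_m) (M : R).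
Variable h : 'I_m -> 'I_m -> 'rV[R]_m -> R.
Hypotheses (mh : forall i j, measurable_fun setT (h i j))
  (wc : {in Omega, continuous w}) (ww : weak_gradient Omega w W)
  (wb : {ae mu, forall x, Omega x -> `|w x| <= M /\ `|W x| <= M})
  (Wh : {ae mu, forall x, Omega x -> forall i j, W x i j = h i j x}).

Let mO : measurable Omega. Proof. exact: open_measurable_rV. Qed.

(** If the bound failed at a point, it would by continuity fail on an open set, which is not
    negligible. *)
Lemma slice_bound x : Omega x -> `|w x| <= M.
Proof.
move=> Ox; rewrite leNgt; apply/negP => Mx.
pose U := Omega `&` [set y | M < `|w y|].
have oU : open U.
  apply/open_ballP => y [Oy My].
  have [d1 d10 h1] := (open_ballP Omega).1 oO y Oy.
  have My' : 0 < `|w y| - M by rewrite subr_gt0.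
  have [d2 d20 h2] := (cvg_distP w y).1 (wc (mem_set Oy)) _ My'.
  exists (Num.min d1 d2); first by rewrite lt_min d10.
  move=> z; rewrite lt_min => /andP[/h1 Oz /h2]; rewrite distrC => wd; split => //=.
  have := lerB_dist (w y) (w z); move: wd; move: (`|w y|) (`|w z|) (`|w y - w z|) => a b c; lra.
have [y [Oy My] hy] := open_ae_ex oU (conj Ox Mx) wb.
by move: My; rewrite /= ltNge (hy Oy).1.
Qed.

Let wcoord i : {in Omega, continuous (fun x => w x ord0 i)}.
Proof.
move=> x Ox; apply: (@continuous_comp _ _ _ w (fun z => z ord0 i)); first exact: wc.
exact: coord_continuous.
Qed.

Let bw i : 0 <= M -> bmf (fun x => w x ord0 i * \1_Omega x).
Proof.
move=> M0; split.
  have := measurable_fun_continuous_on oO (@wcoord i).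
  rewrite (measurable_restrictT _ mO) => mw; rewrite (_ : (fun x => _) = (fun x => w x ord0 i) \_ Omega)//.
  by apply/funext => x; rewrite patchE indicE; case: ifP => _; rewrite ?mulr1 ?mulr0.
exists M => x; rewrite indicE; case: (boolP (x \in Omega)) => [|_].
  by rewrite inE mulr1 => Ox; apply: le_trans (rV_coord_le _ _) (slice_bound Ox).
by rewrite mulr0 normr0.
Qed.

(** A Borel version of the weak gradient, bounded everywhere rather than almost everywhere. *)
Let ch i j (x : 'rV[R]_m) : R := clamp M (h i j x).

Let chE : 0 <= M -> {ae mu, forall x, Omega x -> forall i j, W x i j = ch i j x}.
Proof.
move=> M0; move: wb Wh; apply: filterS2 => x h1 h2 Ox i j.
have [_ WM] := h1 Ox; rewrite /ch -(h2 Ox) clampE//.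
exact: le_trans (mx_coord_le _ _ _) WM.
Qed.

Let wg phi : 0 <= M -> test_function Omega phi -> forall i j,
  \int[mu]_(x in Omega) (w x ord0 i * \1_Omega x * partial j phi x) =
  - \int[mu]_(x in Omega) (ch i j x * phi x).
Proof.
move=> M0 tp i j; transitivity (\int[mu]_(x in Omega) (w x ord0 i * partial j phi x)).
  by apply: eq_Rintegral => x Ox; rewrite indicE Ox mulr1.
rewrite (ww tp); congr (- _); apply: ae_eq_Rintegral.
by move: (chE M0); apply: filterS => x hx Ox; rewrite hx.
Qed.

Lemma slice_lipschitz x r y : (forall z, `|z - x| < r -> Omega z) -> `|y - x| < r ->
  `|w y - w x| <= m%:R * M * `|y - x|.
Proof.
move=> hr yx.
have Oy := hr _ yx.
have Ox : Omega x by apply: hr; rewrite subrr normr0; apply: le_lt_trans yx.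
have M0 : 0 <= M := le_trans (normr_ge0 _) (slice_bound Ox).
apply: rV_norm_le => [|i]; first by rewrite !mulr_ge0.
rewrite !mxE; have := @weak_gradient_lipschitz _ _ _ mO finO (fun x => w x ord0 i * \1_Omega x)
  (ch i) M M (bw i M0) _ _ _ (fun phi tp j => wg M0 tp i j) _ x r y hr yx.
rewrite !indicE !mem_set// !mulr1; apply.
- move=> z; rewrite indicE; case: (boolP (z \in Omega)) => [|_].
    by rewrite inE mulr1 => Oz; apply: le_trans (rV_coord_le _ _) (slice_bound Oz).
  by rewrite mulr0 normr0.
- by move=> j; apply: bmf_clamp.
- by move=> j z; exact: clamp_le.
- move=> z; rewrite inE => Oz.
  have : {near z, (fun x => w x ord0 i) =1 (fun x => w x ord0 i * \1_Omega x)}.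
    have : nbhs z Omega by exact: open_nbhs_nbhs.
    by apply: filterS => y' Oy'; rewrite indicE mem_set// mulr1.
  move=> nb; have c := @wcoord i _ (mem_set Oz).
  rewrite /continuous_at indicE mem_set// mulr1.
  by apply: cvg_trans c; exact: (near_eq_cvg nb).
Qed.

Lemma slice_weak_div (D : 'rV[R]_m -> R) phi : {ae mu, forall x, Omega x -> D x = \tr (W x)} ->
  test_function Omega phi ->
  \int[mu]_(x in Omega) dot (w x) (grad phi x) = - \int[mu]_(x in Omega) (D x * phi x).
Proof.
move=> DW tp; have [bp bpp] := bmf_test_function tp.
have [->|/set0P[x0 Ox0]] := eqVneq Omega set0; first by rewrite !Rintegral_set0 oppr0.
have M0 : 0 <= M := le_trans (normr_ge0 _) (slice_bound Ox0).
transitivity (\int[mu]_(x in Omega) \sum_i (w x ord0 i * \1_Omega x * partial i phi x)).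
  apply: eq_Rintegral => x Ox; apply: eq_bigr => i _.
  by rewrite indicE Ox mulr1 mxE.
have b1 i : bmf (fun x => w x ord0 i * \1_Omega x * partial i phi x).
  by apply: (bmfM (bw i M0)); exact: bpp.
have b2 i : bmf (fun x => ch i i x * phi x) by apply: bmfM => //; exact: bmf_clamp.
rewrite (bint_sum mO finO (fun i _ => b1 i)).
under eq_bigr do rewrite wg//.
rewrite sumrN -(bint_sum mO finO (fun i _ => b2 i)).
congr (- _); apply: ae_eq_Rintegral.
move: DW (chE M0); apply: filterS2 => x h1 h2 Ox.
by rewrite h1// -mulr_suml; congr (_ * _); apply: eq_bigr => i _; rewrite h2.
Qed.

End slice.

End representatives.

Section velocity_representative.
Context {R : realType} {m : nat}.
Notation leb := (@lebesgue_measure R).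
Notation mu := (lebesgue_rV m).
Variables (Omega : set 'rV[R]_m) (oO : open Omega) (finO : (mu Omega < +oo)%E).
Hypothesis nfull : exists p, ~ Omega p.
Variables (n : 'rV[R]_m -> 'rV[R]_m) (u : R -> 'rV[R]_m -> 'rV[R]_m) (Du : R -> 'rV[R]_m -> 'M[R]_m).
Hypothesis vf : velocity_field Omega n u Du.

Let mO : measurable Omega. Proof. exact: open_measurable_rV. Qed.

(** Changing [u] on a space-time null set could destroy the trajectories, so [v] is [u] itself on
    [Omega] at almost every time and 0 at the others. That it is Borel is seen through countably
    many points: there [u] agrees at almost every time with a Borel function, and continuity in [x]
    does the rest. *)
Lemma velocity_representative : exists v d Dm,
  [/\ regular_field Omega v d Dm,
      {ae leb, forall t : measurableTypeR R, 0 <= t -> forall x, Omega x -> v t x = u t x} &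
      spacetime_ae_eq Omega d (div Du)].
Proof.
have /choice[g hg] : forall i, exists g : measurableTypeR R * 'rV[R]_m -> R,
    measurable_fun setT g /\ ae_eq (leb \x mu)%E
      [set p : measurableTypeR R * 'rV[R]_m | 0 <= p.1 /\ Omega p.2] (fun p => u p.1 p.2 ord0 i) g.
  by move=> i; have [g mg gE] := velocity_measurable vf i; exists g.
have /choice[h hh] : forall ij : 'I_m * 'I_m, exists h : measurableTypeR R * 'rV[R]_m -> R,
    measurable_fun setT h /\ ae_eq (leb \x mu)%E
      [set p : measurableTypeR R * 'rV[R]_m | 0 <= p.1 /\ Omega p.2] (fun p => Du p.1 p.2 ij.1 ij.2) h.
  by move=> [i j]; have [h mh hE] := velocity_grad_measurable vf i j; exists h.
have /choice[M hM] := fun N : nat => velocity_loc_bounded vf N%:R.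
have [_ [Dm' hD]] := velocity_div_bounded vf.
pose Dm := Num.max Dm' 0; have Dm0 : 0 <= Dm by rewrite le_max lexx orbT.
pose P y := forall i, {ae leb, forall t : measurableTypeR R, 0 <= t -> Omega y -> u t y ord0 i = g i (t, y)}.
have aeP : {ae mu, forall y, P y}.
  apply: filter_forall => i; have [_ gE] := hg i.
  by move/ae_prod2 : gE; apply: filterS => y hy; move: hy; apply: filterS => t ht t0 Oy; exact: ht.
have [q [qP qd]] := dense_good_points oO nfull aeP.
(* Only countably many conditions: integer horizons [N] for the bounds, and the dense points [q k]
   for the agreement with the Borel functions [g i]. *)
pose good (t : R) := [/\ {within closure Omega, continuous (u t)},
  weak_gradient Omega (u t) (Du t),
  forall N : nat, t <= N%:R -> {ae mu, forall x, Omega x -> `|u t x| <= M N /\ `|Du t x| <= M N},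
  forall k i, Omega (q k) -> u t (q k) ord0 i = g i (t, q k) &
  {ae mu, forall x, Omega x -> (forall i j, Du t x i j = h (i, j) (t, x)) /\ `|div Du t x| <= Dm}].
have [B [mB B0 sB]] : {ae leb, forall t : measurableTypeR R, 0 <= t -> good t}.
  have h1 := velocity_continuous vf; have h2 := velocity_weak_gradient vf.
  have h3 := ae_foralln hM.
  have h4 : {ae leb, forall t : measurableTypeR R, forall k i,
      0 <= t -> Omega (q k) -> u t (q k) ord0 i = g i (t, q k)}.
    apply: ae_foralln => k; apply: filter_forall => i.
    have [Oq|nOq] := pselect (Omega (q k)); last by apply: nearW.
    by have := qP k Oq i.
  have h5 : {ae leb, forall t : measurableTypeR R, {ae mu, forall x, 0 <= t -> Omega x ->
      (forall i j, Du t x i j = h (i, j) (t, x)) /\ `|div Du t x| <= Dm}}.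
    have hh' : {ae (leb \x mu)%E, forall p : measurableTypeR R * 'rV[R]_m, forall ij, (0 <= p.1 /\ Omega p.2) ->
       Du p.1 p.2 ij.1 ij.2 = h ij p} by apply: filter_forall => ij; exact: (hh ij).2.
    have hp : {ae (leb \x mu)%E, forall p : measurableTypeR R * 'rV[R]_m, 0 <= p.1 -> Omega p.2 ->
       (forall i j, Du p.1 p.2 i j = h (i, j) p) /\ `|div Du p.1 p.2| <= Dm}.
      move: hh' hD; apply: filterS2 => -[t x] /= k1 k2 t0 Ox; split; first by move=> i j; exact: (k1 (i, j)).
      by rewrite le_max k2.
    exact: ae_prod1 hp.
  have h12 : {ae leb, forall t : measurableTypeR R, 0 <= t ->
      {within closure Omega, continuous (u t)} /\ weak_gradient Omega (u t) (Du t)}.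
    by move: h1 h2; apply: (@filterS2 (measurableTypeR R) (almost_everywhere leb)) => t k1 k2 t0; split; [exact: k1|exact: k2].
  have h45 : {ae leb, forall t : measurableTypeR R, (forall k i, 0 <= t -> Omega (q k) ->
      u t (q k) ord0 i = g i (t, q k)) /\ {ae mu, forall x, 0 <= t -> Omega x ->
      (forall i j, Du t x i j = h (i, j) (t, x)) /\ `|div Du t x| <= Dm}}.
    by move: h4 h5; apply: filterS2 => t k4 k5; split.
  move: h12 h3 h45; apply: filterS3 => t k12 k3 [k4 k5] t0; have [k1 k2] := k12 t0.
  split; [exact: k1|exact: k2| | |].
  - by move=> N tN; apply: k3; rewrite t0.
  - by move=> k i; exact: k4.
  - by move: k5; apply: filterS => x hx; exact: hx.
pose G := [set t : measurableTypeR R | 0 <= t] `\` B.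
have mG : measurable G.
  apply: measurableD => //; rewrite (_ : mkset _ = `[0, +oo[%classic) ?measurable_itv//.
  by apply/seteqP; split => t /=; rewrite in_itv /= andbT.
have Ggood t : G t -> good t.
  by move=> [t0 nB]; apply: contrapT => ng; apply: nB; apply: sB => /= /(_ t0).
have aeG : {ae leb, forall t : measurableTypeR R, 0 <= t -> G t}.
  by exists B; split => // t /= hn; apply: contrapT => nB; apply: hn.
(* At bad times both fields are 0, which satisfies all the requirements. At good times [v] agrees
   with [u] at every point of [Omega], whereas [d] comes from the Borel weak gradient and matches
   [div Du] only almost everywhere. *)
pose v (t : R) x : 'rV[R]_m := if (t \in G) && (x \in Omega) then u t x else 0.
pose d (t : R) x : R := \1_G t * \1_Omega x * clamp Dm (\sum_i h (i, i) (t, x)).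
have vE t x : G t -> Omega x -> v t x = u t x by move=> Gt Ox; rewrite /v !mem_set.
have v0G t x : ~ G t -> v t x = 0 by move=> Gt; rewrite /v (memNset Gt).
have v0O t x : ~ Omega x -> v t x = 0 by move=> Ox; rewrite /v (memNset Ox) andbF.
have uc t : G t -> {in Omega, continuous (u t)}.
  by move=> /Ggood[c _ _ _ _]; exact: open_within_continuous.
have mh i j t : measurable_fun setT (fun x => h (i, j) (t, x)).
  by apply: (measurableT_comp (hh (i, j)).1); exact: pair1_measurable.
have hW t : G t -> {ae mu, forall x, Omega x -> forall i j, Du t x i j = h (i, j) (t, x)}.
  move=> /Ggood[_ _ _ _]; apply: filterS => x hx Ox; exact: (hx Ox).1.
have dE t : G t -> {ae mu, forall x, Omega x -> d t x = \tr (Du t x)}.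
  move=> Gt; have [_ _ _ _] := Ggood t Gt; apply: filterS => x hx Ox.
  have [h1 h2] := hx Ox; rewrite /d !indicE !mem_set// !mul1r.
  have -> : \sum_i h (i, i) (t, x) = div Du t x by apply: eq_bigr => i _; rewrite h1.
  by rewrite clampE.
exists v, d, Dm; split.
- split.
  + apply/measurable_fun_coordP => i.
    have -> : (fun p : measurableTypeR R * 'rV[R]_m => v p.1 p.2 ord0 i) =
       (fun p => v p.1 p.2 ord0 i * \1_Omega p.2).
      apply/funext => -[t x] /=; rewrite indicE; case: (boolP (x \in Omega)); rewrite ?mulr1//.
      by rewrite notin_setE => nO; rewrite v0O// mxE mul0r.
    apply: (@measurable_fun_caratheodory _ (measurableTypeR R) R m Omega oO q qd
      (fun s x => v s x ord0 i)).
    * move=> k; have [Oq|nOq] := pselect (Omega (q k)); last first.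
        by rewrite (_ : (fun s => _) = cst 0)//; apply/funext => t; rewrite v0O// mxE.
      rewrite (_ : (fun s => _) = (fun s => \1_G s * g i (s, q k))).
        apply: measurable_funM => //.
        by apply: (measurableT_comp (hg i).1); exact: pair2_measurable.
      apply/funext => t; rewrite indicE; case: (boolP (t \in G)) => [|Gt].
        rewrite inE => Gt; rewrite vE// mul1r; have [_ _ _ e _] := Ggood t Gt; exact: e.
      by rewrite v0G ?mxE ?mul0r//; rewrite notin_setE in Gt.
    * move=> t; have [Gt|nG] := pselect (G t); last first.
        rewrite (_ : (fun x => _) = cst 0); first by move=> x _; exact: cst_continuous.
        by apply/funext => x; rewrite v0G// mxE.
      move=> x Ox; have xO := set_mem Ox.
      have c : u t y ord0 i @[y --> x] --> u t x ord0 i.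
        apply: (@continuous_comp _ _ _ (u t) (fun z : 'rV[R]_m => z ord0 i)); first exact: (uc _ Gt _ Ox).
        exact: coord_continuous.
      have nb : {near x, (fun y => u t y ord0 i) =1 (fun y => v t y ord0 i)}.
        have : nbhs x Omega by exact: open_nbhs_nbhs.
        by apply: filterS => y Oy; rewrite vE.
      by rewrite /prop_for /continuous_at vE//; apply: cvg_trans c; exact: (near_eq_cvg nb).
  + apply: measurable_funM; first apply: measurable_funM.
    * exact: (measurableT_comp (bmf_indic R mG).1 measurable_fst).
    * exact: (measurableT_comp (bmf_indic R mO).1 measurable_snd).
    * have mS : measurable_fun setT (fun p : measurableTypeR R * 'rV[R]_m => \sum_i h (i, i) (p.1, p.2)).
        rewrite (_ : (fun p => _) = (fun p => \sum_i h (i, i) p)); last by apply/funext => -[].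
        by apply: measurable_sum => i; exact: (hh (i, i)).1.
      exact: (bmf_clamp Dm0 mS).1.
  + move=> t x; rewrite /d !normrM -[leRHS]mul1r; apply: ler_pM => //; last exact: clamp_le.
    rewrite -[leRHS]mul1r; apply: ler_pM => //; rewrite indicE; case: (_ \in _); rewrite ?normr1 ?normr0 ?ler01//.
  + move=> T; have [N TN] : exists N : nat, T <= N%:R.
      by exists (Num.bound `|T|); apply: le_trans (ler_norm _) _; apply/ltW/archi_boundP/normr_ge0.
    exists (Num.max (M N) 0) => [|t x tT]; first by rewrite le_max lexx orbT.
    have [Gt|nG] := pselect (G t); last by rewrite v0G// normr0 le_max lexx orbT.
    have [Ox|nO] := pselect (Omega x); last by rewrite v0O// normr0 le_max lexx orbT.
    rewrite vE// le_max; apply/orP; left; have [_ _ b _ _] := Ggood t Gt.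
    exact: (slice_bound oO (uc _ Gt) (b _ (le_trans tT TN)) Ox).
  + move=> T; have [N TN] : exists N : nat, T <= N%:R.
      by exists (Num.bound `|T|); apply: le_trans (ler_norm _) _; apply/ltW/archi_boundP/normr_ge0.
    exists (m%:R * Num.max (M N) 0) => [|t x r y tT hr yx].
      by rewrite mulr_ge0// le_max lexx orbT.
    have [Gt|nG] := pselect (G t); last first.
      by rewrite !v0G// subr0 normr0 !mulr_ge0// le_max lexx orbT.
    have Oy := hr _ yx.
    have Ox : Omega x by apply: hr; rewrite subrr normr0; apply: le_lt_trans yx.
    rewrite !vE//; have [_ w b _ _] := Ggood t Gt.
    have := slice_lipschitz oO finO (fun i j => mh i j t) (uc _ Gt) w (b _ (le_trans tT TN)) (hW _ Gt) hr yx.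
    by move=> /le_trans; apply; rewrite ler_wpM2r// ler_wpM2l// le_max lexx.
  + move=> t phi tp; have [Gt|nG] := pselect (G t); last first.
      have z (f : 'rV[R]_m -> R) : (forall x, f x = 0) -> \int[mu]_(x in Omega) f x = 0.
        by move=> f0; rewrite /Rintegral integral0_eq// => x _; rewrite f0.
      rewrite !z ?oppr0// => x; first by rewrite /d indicE (memNset nG) !mul0r.
      by rewrite v0G// /dot big1// => i _; rewrite mxE mul0r.
    have [N tN] : exists N : nat, t <= N%:R.
      by exists (Num.bound `|t|); apply: le_trans (ler_norm _) _; apply/ltW/archi_boundP/normr_ge0.
    have [_ w b _ _] := Ggood t Gt.
    have := slice_weak_div oO finO (fun i j => mh i j t) (uc _ Gt) w (b _ tN) (hW _ Gt) (dE _ Gt) tp.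
    move=> <-; apply: eq_Rintegral => x; rewrite inE => Ox.
    by rewrite vE.
- by move: aeG; apply: filterS => t Gt t0 x Ox; rewrite vE//; exact: Gt.
- have aeG2 : {ae (leb \x mu)%E, forall p : measurableTypeR R * 'rV[R]_m, 0 <= p.1 -> G p.1}.
    exact: (@ae_fst R m (fun t => 0 <= t -> G t)).
  have hh' : {ae (leb \x mu)%E, forall p : measurableTypeR R * 'rV[R]_m, forall ij, (0 <= p.1 /\ Omega p.2) ->
     Du p.1 p.2 ij.1 ij.2 = h ij p} by apply: filter_forall => ij; exact: (hh ij).2.
  suff H : {ae (leb \x mu)%E, forall p : measurableTypeR R * 'rV[R]_m,
    (0 <= p.1 /\ Omega p.2) -> d p.1 p.2 = div Du p.1 p.2} by exact: H.
  have F := @ae_filter_ringOfSetsType _ _ R (leb \x mu)%E.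
  move: aeG2 hh' hD; apply: (@filterS3 _ _ F) => -[t x] /= Gt hp hd [t0 Ox].
  rewrite /d !indicE !mem_set//; last exact: Gt.
  rewrite !mul1r; have -> : \sum_i h (i, i) (t, x) = div Du t x.
    by apply: eq_bigr => i _; rewrite (hp (i, i)).
  by rewrite clampE// le_max hd.
Qed.

End velocity_representative.

(** * The chain rule along characteristics *)

Section chain_rule.
Context {R : realType} {m : nat}.
Notation leb := (@lebesgue_measure R).

Lemma derivative_increment (f f' : R -> R) (a b c eta : R) :
  (forall x, Num.min a b <= x <= Num.max a b -> is_derive x (1 : R) f (f' x) /\ `|f' x - c| <= eta) ->
  `|f b - f a - c * (b - a)| <= eta * `|b - a|.
Proof.
wlog ab : a b / a <= b => [hw|].
  have /orP[|ba h] := le_total a b; first exact: hw.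
  rewrite -normrN (_ : - (f b - f a - c * (b - a)) = f a - f b - c * (a - b)); last by ring.
  by rewrite [`|b - a|]distrC; apply: hw => // x; rewrite minC maxC; exact: h.
rewrite min_l// max_r// => h.
have d x : x \in `[a, b] -> is_derive x (1 : R) f (f' x) by rewrite in_itv /= => /h[].
have d' x : x \in `]a, b[ -> is_derive x (1 : R) f (f' x).
  by move=> xi; apply: d; exact: subset_itv_oo_cc xi.
have cf : {within `[a, b], continuous f}.
  by apply: derivable_within_continuous => x /d[].
have [x] := MVT_segment ab d' cf; rewrite in_itv /= => /h[_ hx] ->.
by rewrite -mulrBl normrM ler_wpM2r.
Qed.

Lemma is_derive_line (f : 'rV[R]_m -> R) (x w : 'rV[R]_m) (h df : R) :
  is_derive (x + h *: w) w f df -> is_derive h (1 : R) (fun k => f (x + k *: w)) df.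
Proof.
move=> /is_derive_distP H; apply/is_derive1_distP => e /H[d d0 hd]; exists d => // k /hd.
by rewrite scalerDl addrA.
Qed.

Lemma prod_dist_lt (s t e : R) (x y : 'rV[R]_m) :
  (`|(s, x) - (t, y)| < e) = (`|s - t| < e) && (`|x - y| < e).
Proof. by rewrite prod_normE gt_max. Qed.

Variables (Omega : set 'rV[R]_m) (oO : open Omega).
Variables (Phi Phit : R -> 'rV[R]_m -> R) (gradPhi : R -> 'rV[R]_m -> 'rV[R]_m).
Hypothesis C1 : C1_closure Omega Phi Phit gradPhi.

Lemma C1_modulus t0 x0 eta : 0 < t0 -> Omega x0 -> 0 < eta -> exists2 del : R, 0 < del &
  forall s x, `|s - t0| < del -> `|x - x0| < del -> [/\ 0 < s, Omega x,
    `|Phit s x - Phit t0 x0| <= eta & `|gradPhi s x - gradPhi t0 x0| <= eta].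
Proof.
move=> t00 Ox0 e0.
have A0 : [set p : R * 'rV[R]_m | 0 <= p.1 /\ closure Omega p.2] (t0, x0).
  by split; [exact: ltW|exact: subset_closure].
have [d1 d10 h1] := (within_continuous_distP _ _).1 (C1_dt C1) _ A0 _ e0.
have [d2 d20 h2] := (within_continuous_distP _ _).1 (C1_dx C1) _ A0 _ e0.
have [d3 d30 h3] := (open_ballP Omega).1 oO _ Ox0.
exists (Num.min (Num.min d1 d2) (Num.min d3 t0)); first by rewrite !lt_min d10 d20 d30.
move=> s x; rewrite !lt_min => /andP[/andP[s1 s2] /andP[_ s4]] /andP[/andP[x1 x2] /andP[x3 _]].
have s0 : 0 < s by move: s4; rewrite ltr_norml => /andP[]; rewrite ltrBrDr addNr.
have Ox := h3 x x3.
have A : [set p : R * 'rV[R]_m | 0 <= p.1 /\ closure Omega p.2] (s, x).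
  by split; [exact: ltW|exact: subset_closure].
split => //.
- by apply/ltW; apply: (h1 (s, x)) => //; rewrite prod_dist_lt s1.
- by apply/ltW; apply: (h2 (s, x)) => //; rewrite prod_dist_lt s2.
Qed.

(** The first k coordinates come from [x], the others from [x0]: consecutive points differ in one
    coordinate, where a partial derivative applies, and all are within sup-norm distance |x - x0| of
    [x0]. *)
Let mix (x0 x : 'rV[R]_m) (k : nat) : 'rV[R]_m :=
  \row_i (if (i < k)%N then x ord0 i else x0 ord0 i).

Lemma C1_increment t0 x0 eta : 0 < t0 -> Omega x0 -> 0 < eta -> exists2 del : R, 0 < del &
  forall s x, `|s - t0| < del -> `|x - x0| < del ->
  `|Phi s x - Phi t0 x0 - Phit t0 x0 * (s - t0) - dot (x - x0) (gradPhi t0 x0)| <=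
   eta * (`|s - t0| + m%:R * `|x - x0|).
Proof.
move=> t00 Ox0 e0; have [del d0 h] := C1_modulus t00 Ox0 e0; exists del => // s x sd xd.
have t0d : `|t0 - t0| < del by rewrite subrr normr0.
have p1 : `|Phi s x - Phi t0 x - Phit t0 x0 * (s - t0)| <= eta * `|s - t0|.
  apply: (derivative_increment (f := Phi ^~ x) (f' := Phit ^~ x)) => r hr.
  have rd : `|r - t0| < del.
    apply: le_lt_trans sd; move: hr; rewrite ge_min le_max => /andP[r1 r2].
    rewrite ler_norml; have := ler_norm (s - t0); have := lerNnormlW (lexx `|s - t0|).
    by case/orP: r1 => ?; case/orP: r2 => ?; lra.
  by have [r0 Ox ? _] := h r x rd xd; split => //; exact: (C1_is_dt C1 r0 Ox).
have mixS (i : 'I_m) : mix x0 x i.+1 = mix x0 x i + (x ord0 i - x0 ord0 i) *: delta_mx ord0 i.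
  apply/rowP => j; rewrite !mxE eqxx /= ltnS leq_eqVlt.
  have [->|ji] := eqVneq j i; first by rewrite eqxx ltnn mulr1 addrC subrK.
  by rewrite (negbTE (_ : (j : nat) != i))//= mulr0 addr0.
have mix0 : mix x0 x 0 = x0 by apply/rowP => j; rewrite mxE ltn0.
have mixm : mix x0 x m = x by apply/rowP => j; rewrite mxE ltn_ord.
have p2 (i : 'I_m) : `|Phi t0 (mix x0 x i.+1) - Phi t0 (mix x0 x i) -
    (x - x0) ord0 i * gradPhi t0 x0 ord0 i| <= eta * `|x - x0|.
  set b := x ord0 i - x0 ord0 i.
  have bx : `|b| <= `|x - x0| by have := rV_coord_le (x - x0) i; rewrite !mxE.
  apply: (@le_trans _ _ (eta * `|b - 0|)); last by rewrite subr0 ler_wpM2l// ltW.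
  have := @derivative_increment (fun k => Phi t0 (mix x0 x i + k *: delta_mx ord0 i))
    (fun k => gradPhi t0 (mix x0 x i + k *: delta_mx ord0 i) ord0 i) 0 b (gradPhi t0 x0 ord0 i) eta.
  rewrite scale0r addr0 -mixS mulrC subr0 !mxE => H; apply: H => k hk.
  have kb : `|k| <= `|x - x0|.
    apply: le_trans bx; move: hk; rewrite ge_min le_max => /andP[r1 r2].
    rewrite ler_norml; have := ler_norm b; have := lerNnormlW (lexx `|b|).
    by case/orP: r1 => ?; case/orP: r2 => ?; lra.
  have kd : `|mix x0 x i + k *: delta_mx ord0 i - x0| < del.
    apply: le_lt_trans xd; apply: rV_norm_le => // j; rewrite !mxE eqxx /=.
    have [->|ji] := eqVneq j i; first by rewrite ltnn mulr1 addrAC subrr add0r.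
    rewrite mulr0 addr0; case: ifP => _; last by rewrite subrr normr0.
    by have := rV_coord_le (x - x0) j; rewrite !mxE.
  have [_ Ok _ gk] := h t0 _ t0d kd; split.
    exact: is_derive_line (C1_is_dx C1 i t00 Ok).
  by apply: le_trans gk; have := rV_coord_le (gradPhi t0 (mix x0 x i + k *: delta_mx ord0 i) - gradPhi t0 x0) i; rewrite !mxE.
have tel : Phi t0 x - Phi t0 x0 = \sum_(i < m) (Phi t0 (mix x0 x i.+1) - Phi t0 (mix x0 x i)).
  rewrite -(big_mkord xpredT (fun i => Phi t0 (mix x0 x i.+1) - Phi t0 (mix x0 x i))).
  by rewrite (telescope_sumr (fun i => Phi t0 (mix x0 x i)))// mixm mix0.
have p3 : `|Phi t0 x - Phi t0 x0 - dot (x - x0) (gradPhi t0 x0)| <= eta * (m%:R * `|x - x0|).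
  rewrite tel /dot -sumrB; apply: le_trans (ler_norm_sum _ _ _) _.
  apply: (@le_trans _ _ (\sum_(i < m) eta * `|x - x0|)); first exact: ler_sum.
  by rewrite sumr_const card_ord -[leLHS]mulr_natl mulrCA.
rewrite [leRHS]mulrDr; apply: (le_trans _ (lerD p1 p3)); apply: (le_trans _ (ler_normD _ _)).
by rewrite le_eqVlt; apply/orP; left; apply/eqP; congr (`|_|); ring.
Qed.

End chain_rule.

Section chain_rule_along_flow.
Context {R : realType} {m : nat}.
Notation leb := (@lebesgue_measure R).
Variables (Omega : set 'rV[R]_m) (oO : open Omega).
Variables (Phi Phit : R -> 'rV[R]_m -> R) (gradPhi : R -> 'rV[R]_m -> 'rV[R]_m).
Hypothesis C1 : C1_closure Omega Phi Phit gradPhi.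
Variables (v Y Z : R -> 'rV[R]_m -> 'rV[R]_m) (d : R -> 'rV[R]_m -> R) (Dm : R).
Hypotheses (rf : regular_field Omega v d Dm) (fl : regular_flow Omega v Y Z).
Variables (x : 'rV[R]_m) (Ox : Omega x) (T : R) (T0 : 0 <= T).

(** Projecting times onto [0, T] makes functions along the trajectory bounded and Borel on the whole
    line. *)
Let tc (r : R) : R := Num.max 0 (Num.min T r).

Let tcT r : 0 <= tc r <= T.
Proof. by rewrite le_max lexx /= ge_max T0 ge_min lexx. Qed.

Let tcE r : 0 <= r <= T -> tc r = r.
Proof. by move=> /andP[r0 rT]; rewrite /tc min_r// max_r. Qed.

Let tc_lip r s : `|tc r - tc s| <= `|r - s|.
Proof.
exact: le_trans (maxr_lip _ _ _) (minr_lip _ _ _).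
Qed.

Let y (r : R) := Y (tc r) x.

Let Oy r : Omega (y r).
Proof. by have /andP[r0 _] := tcT r; exact: (fl_Y fl r0 Ox). Qed.

Let cyl := [set p : R * 'rV[R]_m | 0 <= p.1 /\ closure Omega p.2].

Let bmf_curve (f : R -> 'rV[R]_m -> R) : {within cyl, continuous (fun p => f p.1 p.2)} ->
  continuous (fun r => f (tc r) (y r)) /\ bmf (T := measurableTypeR R) (fun r => f (tc r) (y r)).
Proof.
move=> cf; have [M M0 hM] := rf_bound rf T.
have cyl_y r : cyl (tc r, y r).
  by split; [case/andP: (tcT r)|apply: subset_closure; exact: Oy].
have c : continuous (fun r => f (tc r) (y r)).
  move=> r; apply/cvg_distP => e e0.
  have [del d0 hd] := (within_continuous_distP _ _).1 cf _ (cyl_y r) _ e0.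
  have M1 : 0 < M + 1 by rewrite ltr_wpDl.
  exists (Num.min del (del / (M + 1))); first by rewrite lt_min d0 divr_gt0.
  move=> s; rewrite lt_min => /andP[sr sr']; apply: (hd (tc s, y s) (cyl_y s)).
  rewrite prod_dist_lt (le_lt_trans (tc_lip _ _) sr) /=.
  apply: le_lt_trans (flow_speed fl M0 hM (tcT r) (tcT s) Ox) _.
  apply: (@le_lt_trans _ _ (M * `|s - r|)); first by rewrite ler_wpM2l// tc_lip.
  move: sr'; rewrite ltr_pdivlMr// mulrC; apply: le_lt_trans.
  by rewrite ler_wpM2r// lerDl.
split=> //; split; first exact: continuous_measurable_fun.
have cK : compact ((fun r => f (tc r) (y r)) @` `[0, T]).
  by apply: continuous_compact; [exact: continuous_subspaceT|exact: segment_compact].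
have [C [_ hC]] := compact_bounded cK.
exists (C + 1) => r; apply: (hC (C + 1)); first by rewrite ltrDl.
have tt := tcE (tcT r).
by exists (tc r); [rewrite /= in_itv; exact: tcT|rewrite /y tt].
Qed.

Let bmf_velocity i : bmf (T := measurableTypeR R) (fun r => v (tc r) (y r) ord0 i).
Proof.
have [M M0 hM] := rf_bound rf T; split; last first.
  by exists M => r; apply: le_trans (rV_coord_le _ _) _; apply: hM; case/andP: (tcT r).
have mtc : measurable_fun setT (tc : measurableTypeR R -> measurableTypeR R).
  by apply: measurable_maxr => //; apply: measurable_minr.
have e r : (tc r, y r) = (tc r, extend Omega Y (tc r) x).
  by rewrite extendE//; case/andP: (tcT r).
have my : measurable_fun setT (fun r : measurableTypeR R => (tc r, y r)).
  under eq_fun do rewrite e.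
  apply/measurable_fun_pairP; split; first exact: mtc.
  apply: (measurableT_comp (f := fun s => extend Omega Y s x)) mtc.
  exact: (measurableT_comp (measurable_flow oO rf fl) (pair2_measurable x)).
apply: (measurableT_comp (@measurable_coord _ R m i)).
exact: (measurableT_comp (rf_meas rf) my).
Qed.

Let Gv (r : R) : R := Phit (tc r) (y r) + dot (v (tc r) (y r)) (gradPhi (tc r) (y r)).

Let cdx i : {within cyl, continuous (fun p => gradPhi p.1 p.2 ord0 i)}.
Proof.
apply/within_continuous_distP => p Ap e e0.
have [del d0 hd] := (within_continuous_distP _ _).1 (C1_dx C1) _ Ap _ e0.
exists del => // q Aq qp; apply: le_lt_trans (hd q Aq qp).
by have := rV_coord_le (gradPhi q.1 q.2 - gradPhi p.1 p.2) i; rewrite !mxE.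
Qed.

Let bG : bmf (T := measurableTypeR R) Gv.
Proof.
have b1 := (bmf_curve (C1_dt C1)).2.
have b2 (i : 'I_m) : i \in index_enum 'I_m -> bmf (T := measurableTypeR R)
    (fun r => v (tc r) (y r) ord0 i * gradPhi (tc r) (y r) ord0 i).
  by move=> _; exact: (bmfM (bmf_velocity i) (@bmf_curve (fun r z => gradPhi r z ord0 i) (@cdx i)).2).
exact: (bmfD b1 (bmf_sum b2)).
Qed.

Let mI (a b : R) : measurable (`[a, b]%classic : set (measurableTypeR R)).
Proof. exact: measurable_itv. Qed.

Let F (s : R) : R := Phi s (Y s x).
Let H (s : R) : R := F s - \int[leb]_(r in `[0, s]) Gv r.

Let HB a b : 0 <= a -> a <= b -> H b - H a = F b - F a - \int[leb]_(r in `[a, b]) Gv r.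
Proof.
move=> a0 ab; rewrite /H (bint_itv_split bG a0 ab).
by move: (F a) (F b) (Rintegral _ _ _) (Rintegral _ _ _) => p q c e; ring.
Qed.

(** [v] is only measurable in time, so [Y] need not be differentiable at [t0]. But with [Phit] and
    [gradPhi] frozen there, the integral of the velocity is exactly the increment of [Y]; so [F] and
    the integral of [Gv] share the same expansion in [s - t0] and [Y s x - z]. *)
Let step t0 e : 0 < t0 -> t0 <= T -> 0 < e -> exists2 del : R, 0 < del &
  forall s, 0 <= s <= T -> `|s - t0| < del -> `|H s - H t0| <= e * `|s - t0|.
Proof.
move=> t00 t0T e0; have [M M0 hM] := rf_bound rf T.
have z0 := fl_Y fl (ltW t00) Ox.
set z := Y t0 x in z0; set P := Phit t0 z; set Q := gradPhi t0 z.
have c0 : 0 < 1 + m%:R * M by rewrite ltr_wpDr// mulr_ge0.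
(* Two errors of size [eta * (1 + m%:R * M) * |s - t0|], one for [F] and one for the integral, must
   add up to [e * |s - t0|]. *)
pose eta := e / (2 * (1 + m%:R * M)).
have eta0 : 0 < eta by rewrite divr_gt0// mulr_gt0.
have etaE : e = eta * (2 * (1 + m%:R * M)) by rewrite /eta divfK// gt_eqF// mulr_gt0.
have [d1 d10 h1] := C1_increment oO C1 t00 z0 eta0.
have [d2 d20 h2] := C1_modulus oO C1 t00 z0 eta0.
have M1 : 0 < M + 1 by rewrite ltr_wpDl.
pose del := Num.min (Num.min d1 d2) (Num.min (d1 / (M + 1)) (d2 / (M + 1))).
have t0T' : 0 <= t0 <= T by rewrite ltW.
have sp s : 0 <= s <= T -> `|Y s x - z| <= M * `|s - t0|.
  by move=> hs; exact: (flow_speed fl M0 hM t0T' hs Ox).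
have near_z s : 0 <= s <= T -> `|s - t0| < del ->
    [/\ `|s - t0| < d1, `|s - t0| < d2, `|Y s x - z| < d1 & `|Y s x - z| < d2].
  move=> hs; rewrite !lt_min => /andP[/andP[k1 k2] /andP[k3 k4]]; split => //.
    by apply: le_lt_trans (sp s hs) _; move: k3; rewrite ltr_pdivlMr// mulrC mulrDl mul1r; apply: le_lt_trans; rewrite lerDl.
  by apply: le_lt_trans (sp s hs) _; move: k4; rewrite ltr_pdivlMr// mulrC mulrDl mul1r; apply: le_lt_trans; rewrite lerDl.
have key lo hi : 0 <= lo -> lo <= hi -> hi <= T -> (forall r, lo <= r <= hi -> `|r - t0| < del) ->
    `|\int[leb]_(r in `[lo, hi]) Gv r - (P * (hi - lo) + dot (Y hi x - Y lo x) Q)| <=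
    eta * (1 + m%:R * M) * (hi - lo).
  move=> lo0 lh hT hd.
  have bv (i : 'I_m) : i \in index_enum 'I_m ->
      bmf (T := measurableTypeR R) (fun r => v (tc r) (y r) ord0 i * Q ord0 i).
    by move=> _; apply: bmfM; [exact: bmf_velocity|exact: bmf_cst].
  have bP : bmf (T := measurableTypeR R) (fun r => P) by exact: bmf_cst.
  have bPv : bmf (T := measurableTypeR R) (fun r => P + dot (v (tc r) (y r)) Q).
    by apply: bmfD => //; exact: bmf_sum.
  have -> : P * (hi - lo) + dot (Y hi x - Y lo x) Q =
      \int[leb]_(r in `[lo, hi]) (P + dot (v (tc r) (y r)) Q).
    rewrite (bintD (mI lo hi) (leb_itv_fin lo hi) bP (bmf_sum bv)).
    rewrite (bint_cst leb (mI lo hi)) fine_leb_itv//; congr (_ + _).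
    rewrite (bint_sum (mI lo hi) (leb_itv_fin lo hi) bv); apply: eq_bigr => i _.
    rewrite (bintZr (mI lo hi) (leb_itv_fin lo hi) _ (bmf_velocity i)); congr (_ * _).
    rewrite !mxE (fl_ode fl Ox lo0 lh); apply: eq_Rintegral => r; rewrite inE /= in_itv /= => /andP[r1 r2].
    by rewrite /y tcE// (le_trans lo0)//= (le_trans r2).
  rewrite -(fine_leb_itv lh).
  apply: (bint_dist_le (mI lo hi) (leb_itv_fin lo hi) bG bPv) => r.
  rewrite /= in_itv /= => hr; have /andP[r1 r2] := hr.
  have rT : 0 <= r <= T by rewrite (le_trans lo0)//= (le_trans r2).
  rewrite /Gv /y tcE//.
  have [k1 k2 k3 k4] := near_z r rT (hd r hr).
  have [_ _ p1 p2] := h2 r (Y r x) k2 k4.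
  have -> : Phit r (Y r x) + dot (v r (Y r x)) (gradPhi r (Y r x)) - (P + dot (v r (Y r x)) Q) =
      (Phit r (Y r x) - P) + dot (v r (Y r x)) (gradPhi r (Y r x) - Q).
    rewrite dotDr dotNr; move: (dot _ _) (dot _ _) => a b; ring.
  apply: le_trans (ler_normD _ _) _.
  have rT2 : r <= T by exact: le_trans r2 hT.
  have := lerD p1 (dot_le (hM r (Y r x) rT2) p2).
  by rewrite (_ : eta + m%:R * (M * eta) = eta * (1 + m%:R * M))//; ring.
exists del; first by rewrite !lt_min d10 d20 !divr_gt0.
move=> s hs sd; have [g1 _ g3 _] := near_z s hs sd; have /andP[s0 sT] := hs.
have q1 := h1 s (Y s x) g1 g3; rewrite -/P -/Q -/z in q1.
have q1' : `|F s - F t0 - P * (s - t0) - dot (Y s x - z) Q| <= eta * (1 + m%:R * M) * `|s - t0|.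
  apply: le_trans q1 _; rewrite -mulrA ler_wpM2l ?(ltW eta0)// mulrDl mul1r lerD2l -mulrA ler_wpM2l//.
  exact: sp.
rewrite etaE; have [ts|/ltW st] := leP t0 s.
  have kk := key t0 s (ltW t00) ts sT; rewrite HB ?(ltW t00)//.
  have hr r : t0 <= r <= s -> `|r - t0| < del.
    move=> /andP[r1 r2]; apply: le_lt_trans sd.
    by rewrite !ger0_norm ?subr_ge0// lerD2r.
  have := kk hr; move: q1'; rewrite -/z (ger0_norm (_ : 0 <= s - t0)) ?subr_ge0//.
  move: (F s - F t0) (Rintegral _ _ _) (dot _ _) (P * _) => a I w p k1 k2.
  have -> : a - I = (a - p - w) - (I - (p + w)) by ring.
  apply: le_trans (ler_normB _ _) _; apply: le_trans (lerD k1 k2) _.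
  by rewrite le_eqVlt; apply/orP; left; apply/eqP; ring.
have kk := key s t0 s0 st t0T; rewrite -normrN opprB HB//.
have hr r : s <= r <= t0 -> `|r - t0| < del.
  move=> /andP[r1 r2]; apply: le_lt_trans sd.
  by rewrite distrC [`|s - _|]distrC !ger0_norm ?subr_ge0// lerB.
have := kk hr; move: q1'; rewrite -/z -[z - Y s x]opprB dotNl.
rewrite [`|s - t0|]distrC (ger0_norm (_ : 0 <= t0 - s)) ?subr_ge0//.
move: (F s) (F t0) (Rintegral _ _ _) (dot _ _) => a b I w k1 k2.
have -> : b - a - I = - (a - b - P * (s - t0) - w) - (I - (P * (t0 - s) + - w)) by ring.
apply: le_trans (ler_normB _ _) _; rewrite normrN; apply: le_trans (lerD k1 k2) _.
by rewrite le_eqVlt; apply/orP; left; apply/eqP; ring.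
Qed.

Lemma chain_rule_along_flow : exists G : R -> R,
  [/\ bmf (T := measurableTypeR R) G,
      forall r, 0 <= r <= T -> G r = Phit r (Y r x) + dot (v r (Y r x)) (gradPhi r (Y r x)) &
      Phi T (Y T x) - Phi 0 x = \int[leb]_(r in `[0, T]) G r].
Proof.
exists Gv; split => //; first by move=> r hr; rewrite /Gv /y !tcE.
have F0 : F 0 = Phi 0 x by rewrite /F (fl_init fl Ox).
have H0 : H 0 = F 0 by rewrite /H set_itv1 Rintegral_set1 subr0.
suff e : H T = H 0.
  rewrite -F0 -H0 -e /H /F.
  by move: (Phi _ _) (Rintegral _ _ _) => a b; rewrite opprB addrC subrK.
(* The derivatives of [Phi] are given at positive times only, so constancy is first obtained on
   [tau, T]; continuity of [Phi] at time 0 then allows [tau] to be small. *)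
have const tau : 0 < tau -> tau <= T -> H T = H tau.
  move=> tau0 tauT; have := @zero_derivative_constant _ (fun s => H (tau + s)) (T - tau).
  rewrite subr_ge0 addr0 subrKC; apply => // t /andP[t0 tT] e e0.
  have tT' : tau + t <= T by lra.
  have [del d0 hd] := step (ltr_pwDl tau0 t0) tT' e0.
  exists del => // s /andP[s0 sT].
  have -> : s - t = tau + s - (tau + t) by ring.
  by apply: hd; apply/andP; split; lra.
have [T00|T0'] := leP T 0; first by have -> : T = 0 by apply/eqP; rewrite eq_le T00.
have [M M0 hM] := rf_bound rf T.
have [C hC] := bG.2.
have C0 : 0 <= C := le_trans (normr_ge0 _) (hC 0).
have M1 : 0 < M + 1 by rewrite ltr_wpDl.
have A0 : cyl (0, x) by split; [exact: lexx|exact: subset_closure].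
apply/eqP; rewrite -subr_eq0 -normr_le0; apply/ler_addgt0Pl => e e0.
rewrite addr0.
have e20 : 0 < e / 2 by rewrite divr_gt0.
have [del d0 hd] := (within_continuous_distP _ _).1 (C1_fun C1) _ A0 _ e20.
(* Small enough for [Phi] to vary by less than [e / 2] along the trajectory up to time [tau], and
   for the integral of [Gv], at most [C * tau], not to exceed [e / 2]. *)
pose tau := Num.min (Num.min T (del / 2)) (Num.min (del / (M + 1) / 2) (e / 2 / (C + 1))).
have tau0 : 0 < tau by rewrite !lt_min T0' !divr_gt0// ltr_wpDl.
have [tT td td2 te] : [/\ tau <= T, tau <= del / 2, tau <= del / (M + 1) / 2 & tau <= e / 2 / (C + 1)].
  by split; rewrite /tau !ge_min lexx ?orbT.
rewrite (const tau tau0 tT) HB ?(ltW tau0)//.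
have i1 : `|\int[leb]_(r in `[0, tau]) Gv r| <= C * tau.
  have := bint_norm_le (mI 0 tau) (leb_itv_fin 0 tau) bG (fun r _ => hC r).
  by rewrite fine_leb_itv ?(ltW tau0)// subr0.
have i2 : C * tau <= e / 2.
  apply: (@le_trans _ _ ((C + 1) * tau)); first by rewrite ler_wpM2r ?(ltW tau0)// lerDl.
  by rewrite mulrC -ler_pdivlMr// ltr_wpDl.
have i3 : `|F tau - F 0| < e / 2.
  rewrite F0; have cy : cyl (tau, Y tau x).
    by split; [exact: ltW|apply: subset_closure; exact: (fl_Y fl (ltW tau0) Ox)].
  apply: (hd (tau, Y tau x) cy); rewrite prod_dist_lt; apply/andP; split.
    by rewrite subr0 gtr0_norm//; apply: le_lt_trans td _; rewrite ltr_pdivrMr// ltr_pMr// ltr1n.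
  have a1 : (0 : R) <= 0 <= T by exact/andP.
  have a2 : 0 <= tau <= T by rewrite (ltW tau0).
  have := flow_speed fl M0 hM a1 a2 Ox; rewrite (fl_init fl Ox) subr0 gtr0_norm// => sp.
  apply: (@le_lt_trans _ _ ((M + 1) * tau)).
    apply: le_trans sp _.
    by rewrite ler_wpM2r ?(ltW tau0)// lerDl.
  rewrite mulrC -ltr_pdivlMr//; apply: le_lt_trans td2 _.
  by rewrite ltr_pdivrMr// ltr_pMr ?divr_gt0// ltr1n.
apply: le_trans (ler_normB _ _) _; apply: le_trans (lerD (ltW i3) (le_trans i1 i2)) _.
by rewrite -splitr.
Qed.

End chain_rule_along_flow.

(** * Stability *)

Section flow_representative.
Context {R : realType} {m : nat}.
Notation leb := (@lebesgue_measure R).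
Notation mu := (lebesgue_rV m).
Variables (Omega : set 'rV[R]_m).
Variables (u v : R -> 'rV[R]_m -> 'rV[R]_m) (X : R -> R -> 'rV[R]_m -> 'rV[R]_m).

(** On [Omega], [v] and [u] differ only at negligible times, so the integral equation is
    unaffected. *)
Lemma regular_flow_characteristics : flow Omega u X ->
  {ae leb, forall t : measurableTypeR R, 0 <= t -> forall x, Omega x -> v t x = u t x} ->
  regular_flow Omega v (fun t x => X t 0 x) (fun t y => X 0 t y).
Proof.
move=> fX uv; have sub := @subset_closure _ Omega.
have fd s t x : 0 <= s -> 0 <= t -> Omega x -> Omega (X s t x).
  by move=> s0 t0 Ox; rewrite -(flow_domain fX s0 t0); exists x.
have lip s t : 0 <= s -> 0 <= t -> exists2 L : R, 0 <= L &
    forall x y, Omega x -> Omega y -> `|X s t x - X s t y| <= L * `|x - y|.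
  move=> s0 t0; have [M [_ hM]] := flow_lipschitz fX s0 t0.
  exists (Num.max (M + 1) 0) => [|x y Ox Oy]; first by rewrite le_max lexx orbT.
  have M1 : M < M + 1 by rewrite ltrDl.
  have := hM _ M1 (x, y) (conj (sub _ Ox) (sub _ Oy)) => /= h.
  by apply: le_trans h _; rewrite ler_wpM2r// le_max lexx.
split.
- by move=> x Ox; exact: (flow_init fX (lexx 0) (sub _ Ox)).
- by move=> t x t0; exact: fd.
- by move=> t x t0; exact: fd.
- by move=> t x t0 Ox; exact: (flow_inverse fX (lexx 0) t0 (sub _ Ox)).
- by move=> t x t0 Ox; exact: (flow_inverse fX t0 (lexx 0) (sub _ Ox)).
- move=> x a b Ox a0 ab i; rewrite (flow_ode fX (lexx 0) (sub _ Ox)); last by rewrite a0.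
  apply: ae_eq_Rintegral.
  move: uv; apply: filterS => r hr; rewrite /= in_itv /= => /andP[ar _].
  have r0 := le_trans a0 ar.
  by rewrite hr//; exact: fd.
- by move=> t t0; exact: lip.
- by move=> t t0; exact: lip.
Qed.

End flow_representative.

Section L2_norm.
Context {R : realType} {m : nat}.
Notation mu := (lebesgue_rV m).
Variable Omega : set 'rV[R]_m.

Lemma L2norm_sqr f : (L2norm Omega f ^+ 2 = \int[mu]_(x in Omega) (f x ^+ 2)%:E)%E.
Proof.
have n0 : (0 <= L2norm Omega f)%E by exact: Lnorm_ge0.
have -> : (L2norm Omega f ^+ 2 = L2norm Omega f `^ 2)%E.
  move: n0; case: (L2norm _ _) => [r|_|//].
    by rewrite lee_fin => r0; rewrite -EFin_expe poweR_EFin powR_mulrn.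
  by rewrite poweRyr// expe2 mulyy.
rewrite /L2norm poweR_Lnorm// [RHS]integral_mkcond; apply: eq_integral => x _.
rewrite /= !patchE; case: ifP => _ /=.
  by rewrite powR_mulrn// real_normK// num_real.
by rewrite normr0 powR0.
Qed.

(** The complement of the essential support is an uncountable union of open sets on which [f]
    vanishes almost everywhere; the countably many rational balls contained in one of them cover it,
    which keeps the exceptional set null. *)
Lemma ess_supp_sub_null f (A : set 'rV[R]_m) : ess_supp Omega f `<=` A ->
  {ae mu, forall x, Omega x -> ~ A x -> f x = 0}.
Proof.
move=> sA.
pose good V := [/\ open V, V `<=` Omega & {ae mu, forall x, V x -> f x = 0}].
pose B (p : 'rV[rat]_m * nat) : set 'rV[R]_m :=
  [set y | `|y - (rat_rV p.1 : 'rV[R]_m)| < p.2.+1%:R^-1].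
have : {ae mu, forall x, forall k : nat, forall p : 'rV[rat]_m * nat, unpickle k = Some p ->
    (exists2 V, good V & B p `<=` V) -> B p x -> f x = 0}.
  apply: ae_foralln => k; case uk : (unpickle k : option ('rV[rat]_m * nat)%type) => [p|]; last first.
    by apply: nearW.
  have [[V [oV VO aeV] sV]|nV] := pselect (exists2 V, good V & B p `<=` V); last first.
    by apply: nearW => x p' [<-] /nV.
  by move: aeV; apply: filterS => x hx p' [<-] _ /sV; exact: hx.
apply: filterS => x hx Ox nAx.
have : ~ ess_supp Omega f x by move/sA.
move=> ns; have [V gV Vx] : (\bigcup_(V in [set V | good V]) V) x.
  by apply: contrapT => nU; apply: ns; split.
have [oV _ _] := gV.
move: Vx; rewrite [X in X x](open_rat_balls oV) => -[p sp Bx].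
apply: (hx (pickle p) p) => //; first by rewrite pickleK.
by exists V.
Qed.

End L2_norm.

(** Replacing [f] by the minimum of [f] and [g] changes nothing almost everywhere and makes the
    inequality hold everywhere. *)
Lemma bint_ae_le d (T : measurableType d) (R : realType) (mu : {measure set T -> \bar R})
    (D : set T) (f g : T -> R) : measurable D -> (mu D < +oo)%E -> bmf f -> bmf g ->
  {ae mu, forall x, D x -> f x <= g x} -> \int[mu]_(x in D) f x <= \int[mu]_(x in D) g x.
Proof.
move=> mD finD bf bg fg.
have bm : bmf (fun x => Num.min (f x) (g x)).
  split; first by apply: measurable_minr; [exact: bf.1|exact: bg.1].
  have [C hC] := bf.2; have [E hE] := bg.2; exists (Num.max C E) => x.
  by rewrite le_max; case: (leP (f x) (g x)) => _; [rewrite hC|rewrite hE orbT].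
rewrite (_ : \int[mu]_(x in D) f x = \int[mu]_(x in D) Num.min (f x) (g x)).
  by apply: (bint_le mD finD bm bg) => x _; rewrite ge_min lexx orbT.
by apply: ae_eq_Rintegral; move: fg; apply: filterS => x h Dx; rewrite min_l// h.
Qed.

Section essential_supremum.
Context {R : realType} {m : nat}.
Notation leb := (@lebesgue_measure R).
Notation mu := (lebesgue_rV m).

Lemma ess_sup_on_ge (A : R -> set 'rV[R]_m) f :
  {ae (leb \x mu)%E, forall p : measurableTypeR R * 'rV[R]_m, 0 <= p.1 -> A p.1 p.2 ->
    ((f p.1 p.2)%:E <= ess_sup_on A f)%E}.
Proof.
have := @ess_sup_ge _ _ R (leb \x mu)%E ((fun p : measurableTypeR R * 'rV[R]_m => (f p.1 p.2)%:E) \_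
      [set p : measurableTypeR R * 'rV[R]_m | (0 : R) <= p.1 /\ A p.1 p.2]).
apply: filterS => p hp p0 Ap; apply: le_trans hp.
by rewrite patchE mem_set.
Qed.

(** The lower bound of an essential supremum needs a space of positive measure, here witnessed by
    the product of [0, 1] and the unit ball. *)
Lemma ess_sup_on_ge0 (A : R -> set 'rV[R]_m) f : (forall t x, 0 <= f t x) ->
  (0 <= ess_sup_on A f)%E.
Proof.
move=> f0; apply: ess_sup_gee; last first.
  by apply: nearW => p; rewrite patchE; case: ifP => // _; rewrite lee_fin.
have mB : measurable [set z : 'rV[R]_m | `|z - 0| < 1] by exact: measurable_rVball.
apply: (@lt_le_trans _ _ ((leb \x mu)%E (`[0%R, 1%R]%classic `*` [set z : 'rV[R]_m | `|z - 0| < 1]%R))).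
  rewrite (product_measure1E leb mu)//; apply: mule_gt0.
    rewrite [X in (_ < X)%E](_ : _ = (1 - 0)%:E); last exact: (@leb_itv R 0 1 ler01).
    by rewrite lte_fin subr0.
  by rewrite lebesgue_rVball// lte_fin exprn_gt0// mulr_gt0.
by apply: le_measure; rewrite ?inE//; exact: measurableX.
Qed.

End essential_supremum.

Section lyapunov.
Context {R : realType} {m : nat}.
Notation leb := (@lebesgue_measure R).
Variables (Omega : set 'rV[R]_m) (oO : open Omega).
Variables (Phi Phit : R -> 'rV[R]_m -> R) (gradPhi : R -> 'rV[R]_m -> 'rV[R]_m).
Hypothesis C1 : C1_closure Omega Phi Phit gradPhi.
Variables (v Y Z : R -> 'rV[R]_m -> 'rV[R]_m) (d : R -> 'rV[R]_m -> R) (Dm : R).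
Hypotheses (rf : regular_field Omega v d Dm) (fl : regular_flow Omega v Y Z).
Variable sg : R -> 'rV[R]_m -> R.
Hypothesis bsg : bmf (fun p : measurableTypeR R * 'rV[R]_m => sg p.1 p.2).

Lemma flow_path_bmf (f : R -> 'rV[R]_m -> R) x :
  bmf (fun p : measurableTypeR R * 'rV[R]_m => f p.1 p.2) ->
  bmf (T := measurableTypeR R) (fun r => f r (extend Omega Y r x)).
Proof.
move=> bf.
have mh : measurable_fun setT (fun r : measurableTypeR R => (r, extend Omega Y r x)).
  apply/measurable_fun_pairP; split; first exact: measurable_id.
  exact: (measurableT_comp (measurable_flow oO rf fl) (pair2_measurable x)).
exact: (bmf_comp bf mh).
Qed.

(** The dissipation inequality is integrated in time; by the chain rule the material derivative
    contributes [Phi t (Y t x) - Phi 0 x]. *)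
Lemma lyapunov_exponent x t (c ell alpha : R) : Omega x -> 0 <= t ->
  {ae leb, forall r : measurableTypeR R, 0 <= r <= t ->
     - (d r (Y r x) + c * sg r (Y r x)) <=
     - 2 * alpha - ell * (Phit r (Y r x) + dot (v r (Y r x)) (gradPhi r (Y r x)))} ->
  - log_jacobian Omega Y d t x - c * \int[leb]_(r in `[0, t]) sg r (extend Omega Y r x) <=
  - 2 * alpha * t + ell * (Phi 0 x - Phi t (Y t x)).
Proof.
move=> Ox t0 h.
have [G [bG GE GI]] := chain_rule_along_flow oO C1 rf fl Ox t0.
have mI : measurable (`[0, t]%classic : set (measurableTypeR R)) by exact: measurable_itv.
have finI := leb_itv_fin 0 t.
have b1 := flow_path_bmf x (bmf_d rf).
have b2 := flow_path_bmf x bsg.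
have b2c := bmfZ c b2.
have b12 := bmfN (bmfD b1 b2c).
have bell := bmfZ ell bG.
have bal : bmf (T := measurableTypeR R) (fun=> - 2 * alpha) by exact: bmf_cst.
have bR := bmfB bal bell.
have le : \int[leb]_(r in `[0, t]) - (d r (extend Omega Y r x) + c * sg r (extend Omega Y r x)) <=
    \int[leb]_(r in `[0, t]) (- 2 * alpha - ell * G r).
  apply: (bint_ae_le mI finI b12 bR); move: h; apply: filterS => r hr.
  rewrite /= in_itv /= => rt; have /andP[r0 _] := rt.
  by rewrite extendE// GE//; exact: hr.
rewrite (bintN mI finI (bmfD b1 b2c)) (bintD mI finI b1 b2c) (bintZ mI finI c b2) in le.
rewrite (bintB mI finI bal bell) (bintZ mI finI ell bG) (bint_cst leb mI) fine_leb_itv// subr0 in le.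
rewrite -GI in le; move: le; rewrite /log_jacobian /flow_div.
move: (Rintegral _ _ _) (Rintegral _ _ _) => a b le.
apply: le_trans (le_trans _ le) _; first by rewrite opprD.
by rewrite le_eqVlt; apply/orP; left; apply/eqP; ring.
Qed.

End lyapunov.

(** In dimension 0 the whole space is a point, hence bounded; with one coordinate, a constant vector
    with large entries leaves [A]. *)
Lemma bounded_not_full (R : realType) m (A : set 'rV[R]_m) : (0 < m)%N -> bounded_set A ->
  exists p, ~ A p.
Proof.
move=> m0 [M [_ hM]].
pose c := Num.max 0 (M + 1); exists (const_mx (c + 1)) => Ac.
have Mc : M < c by rewrite lt_max ltrDl ltr01 orbT.
have h : `|const_mx (c + 1) : 'rV[R]_m| <= c := hM c Mc _ Ac.
move: h; rewrite leNgt => /negP; apply.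
have c0 : 0 <= c by rewrite le_max lexx.
apply: (lt_le_trans _ (rV_coord_le _ (Ordinal m0))); rewrite mxE ger0_norm ?addr_ge0//.
by rewrite ltrDl.
Qed.

Section stability.
Context {R : realType} {m : nat}.
Notation leb := (@lebesgue_measure R).
Notation mu := (lebesgue_rV m).
Variables (Omega : set 'rV[R]_m) (oO : open Omega) (finO : (mu Omega < +oo)%E).
Hypotheses (bO : bounded_set Omega) (nfull : exists p, ~ Omega p).
Variables (v Y Z : R -> 'rV[R]_m -> 'rV[R]_m) (d : R -> 'rV[R]_m -> R) (Dm : R).
Hypotheses (rf : regular_field Omega v d Dm) (fl : regular_flow Omega v Y Z).

Let mO : measurable Omega. Proof. exact: open_measurable_rV. Qed.

(** [w ^+ 2] is at most [C] times the inverse Jacobian, which the change of variables absorbs,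
    leaving the integral of [e0 ^+ 2]. As [e0] equals a Borel [g] only almost everywhere, the
    comparison fails on a null set, which is pulled back by [Z t]. *)
Lemma weighted_decay (e0 w f : 'rV[R]_m -> R) (t C : R) : 0 <= t -> 0 <= C ->
  Defs.ae_measurable_fun mu Omega e0 ->
  ae_eq mu Omega f (fun y => e0 (Z t y) * w (Z t y)) ->
  {ae mu, forall x, Omega x -> e0 x != 0 -> w x ^+ 2 <= C * expR (- log_jacobian Omega Y d t x)} ->
  (\int[mu]_(y in Omega) (f y ^+ 2)%:E <= C%:E * \int[mu]_(y in Omega) (e0 y ^+ 2)%:E)%E.
Proof.
move=> t0 C0 [g mg e0g] fe hw.
pose J x := expR (- log_jacobian Omega Y d t x).
have [N [mN N0 sN]] : {ae mu, forall x, Omega x -> (e0 x * w x) ^+ 2 <= C * (g x ^+ 2 * J x)}.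
  move: e0g hw; apply: filterS2 => x h1 h2 Ox; rewrite -(h1 Ox).
  have [->|n0] := eqVneq (e0 x) 0; first by rewrite !mul0r expr0n mul0r mulr0.
  by rewrite exprMn [C * _]mulrCA ler_wpM2l ?sqr_ge0//; exact: h2.
have g2 y : 0 <= g y ^+ 2 by exact: sqr_ge0.
have mg2 : measurable_fun setT (fun y => g y ^+ 2) by exact: measurable_funX.
pose h y := g (extend Omega Z t y) ^+ 2 * J (extend Omega Z t y).
have h0 y : 0 <= h y by rewrite mulr_ge0// expR_ge0.
have mh : measurable_fun setT h.
  have mZ : measurable_fun setT (extend Omega Z t).
    exact: (measurableT_comp (measurable_inverse_flow oO rf fl) (pair1_measurable t)).
  apply: (measurableT_comp (f := fun x => g x ^+ 2 * J x)) mZ.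
  apply: measurable_funM => //; apply: (bmf_expR _).1; apply: bmfN.
  exact: (bmf_log_jacobian oO rf fl).
apply: (@le_trans _ _ (\int[mu]_(y in Omega) (C%:E * (h y)%:E))%E).
  apply: ae_le_ge0_integral.
  - by move=> y _; rewrite lee_fin sqr_ge0.
  - by move=> y _; rewrite -EFinM lee_fin mulr_ge0.
  - move: fe (null_inverse_flow_preimage oO finO bO nfull rf fl mN N0 t0).
    apply: filterS2 => y fy Ny Oy; rewrite fy// -EFinM lee_fin /h extendE//.
    have OZ := fl_Z fl t0 Oy.
    by apply: contrapT => nle; apply: (Ny Oy); apply: sN => /= /(_ OZ).
have mhE : measurable_fun Omega (EFin \o h).
  by apply/measurable_EFinP; apply: measurable_funS (@measurableT _ _) _ mh.
rewrite (ge0_integralZl mu mO mhE)//; last by move=> y _; rewrite lee_fin.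
rewrite /h (ge0_change_of_variables oO finO bO nfull rf fl mg2 g2 t0).
rewrite lee_wpmul2l//.
rewrite (@ae_eq_ge0_integral _ _ _ mu Omega (fun y => (e0 y ^+ 2)%:E) (fun y => (g y ^+ 2)%:E))//.
- by move=> y _; rewrite lee_fin sqr_ge0.
- by move=> y _; rewrite lee_fin.
- by move: e0g; apply: filterS => y hy Oy; rewrite hy.
Qed.

End stability.

Theorem mainTheorem3 (R : realType) (m : nat) (m_ge1 : (1 <= m)%N)
  (Omega : set 'rV[R]_m) (Omega_dom : bounded_C2_domain Omega)
  (n : 'rV[R]_m -> 'rV[R]_m)
  (n_normal : forall p, boundary Omega p -> outward_unit_normal Omega p (n p))
  (u : R -> 'rV[R]_m -> 'rV[R]_m) (Du : R -> 'rV[R]_m -> 'M[R]_m)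
  (u_velocity : velocity_field Omega n u Du)
  (sigma : R -> 'rV[R]_m -> R) (sigma_loc : localization Omega sigma)
  (X : R -> R -> 'rV[R]_m -> 'rV[R]_m) (X_flow : flow Omega u X)
  (K : R -> set 'rV[R]_m)
  (K_sub : forall t, 0 <= t -> K t `<=` Omega)
  (K_meas : forall t, 0 <= t -> ae_measurable (lebesgue_rV m) (K t))
  (K_inv : forall s t, 0 <= s <= t -> X t s @` K s `<=` K t)
  (Phi Phit : R -> 'rV[R]_m -> R) (gradPhi : R -> 'rV[R]_m -> 'rV[R]_m)
  (Phi_C1 : C1_closure Omega Phi Phit gradPhi)
  (a_d : R) (Vd_neq0 : forall t, 0 <= t -> sublevel Omega Phi a_d t !=set0)
  (gamma Phi_min Phi_max sigma_min : R)
  (gamma_gt0 : 0 < gamma) (Phi_max_gt : a_d < Phi_max)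
  (sigma_min_gt0 : 0 < sigma_min)
  (u' : R -> 'rV[R]_m -> 'rV[R]_m) (sigma' : R -> 'rV[R]_m -> R)
  (u'_rep : spacetime_ae_eq Omega u' u)
  (sigma'_rep : spacetime_ae_eq Omega sigma' sigma)
  (Phi_bounds : forall t x, 0 <= t -> K t x -> Phi_min <= Phi t x <= Phi_max)
  (Phi_decrease : forall t x, 0 <= t ->
    (K t `\` sublevel Omega Phi a_d t) x ->
    material_derivative u' Phit gradPhi t x <= - gamma)
  (sigma_bound : forall t x, 0 <= t ->
    (sublevel Omega Phi a_d t `&` K t) x -> sigma_min <= sigma' t x) :
  let M_K : \bar R := ess_sup_on K (fun t x => Num.max (- div Du t x) 0) in
  let L_K : \bar R := ess_sup_on (fun t => K t `&` sublevel Omega Phi a_d t)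
    (fun t x => Num.max (material_derivative u Phit gradPhi t x) 0) in
  (L_K < +oo)%E ->
  forall ell : R, 0 < ell -> (M_K < (ell * gamma)%:E)%E ->
  forall kappa : R, 0 < kappa ->
  (ell%:E * L_K + M_K < (2 * kappa * sigma_min)%:E)%E ->
  forall alpha : R, 0 < alpha ->
  (alpha%:E < (2^-1)%:E *
    Order.min ((ell * gamma)%:E - M_K)
              ((2 * kappa * sigma_min)%:E - ell%:E * L_K - M_K))%E ->
  exists2 C : R, 0 < C &
    forall (e0 : 'rV[R]_m -> R) (e : R -> 'rV[R]_m -> R),
      L2 Omega e0 -> ess_supp Omega e0 `<=` K 0 ->
      mild_solution Omega Du sigma kappa X e0 e ->
      forall t, 0 <= t ->
        (L2norm Omega (e t) ^+ 2 <=
         (C * expR (- 2 * alpha * t))%:E * L2norm Omega e0 ^+ 2)%E.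
Proof.
move=> M_K L_K Lfin ell ell0 hM kappa kappa0 hL alpha alpha0 halpha.
have [oO _ [p0 Op0] bO _] := Omega_dom.
have mO : measurable Omega by exact: open_measurable_rV.
have finO : (lebesgue_rV m Omega < +oo)%E by exact: lebesgue_rV_bounded.
have nfull := bounded_not_full m_ge1 bO.
have [v [d [Dm [rf vu dE]]]] := velocity_representative oO finO nfull u_velocity.
have fl := regular_flow_characteristics X_flow vu.
have [[[sg' msg sgE] [S hS]] sig0] := sigma_loc.
have S0 : 0 <= Num.max S 0 by rewrite le_max lexx orbT.
(* A bounded Borel version of [sigma]: the clamp turns the essential bound into one valid
   everywhere, and [Num.max S 0] is used because [S] comes without a sign. *)
pose sg (r : R) (x : 'rV[R]_m) : R := clamp (Num.max S 0) (sg' (r, x)).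
have bsg : bmf (fun p : measurableTypeR R * 'rV[R]_m => sg p.1 p.2).
  rewrite (_ : (fun p => _) = (fun p => clamp (Num.max S 0) (sg' p))); last by apply/funext => -[].
  exact: bmf_clamp.
have M0 : (0 <= M_K)%E by apply: ess_sup_on_ge0 => r x; rewrite le_max lexx orbT.
have L0 : (0 <= L_K)%E by apply: ess_sup_on_ge0 => r x; rewrite le_max lexx orbT.
have Mfin : (M_K < +oo)%E by exact: lt_trans hM (ltry _).
have hMge := ess_sup_on_ge K (fun t x => Num.max (- div Du t x) 0).
have hLge := ess_sup_on_ge (fun t => K t `&` sublevel Omega Phi a_d t)
  (fun t x => Num.max (material_derivative u Phit gradPhi t x) 0).
rewrite -/M_K in hMge; rewrite -/L_K in hLge.
have [M ME] : exists M, M_K = M%:E by exists (fine M_K); rewrite fineK// ge0_fin_numE.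
have [L LE] : exists L, L_K = L%:E by exists (fine L_K); rewrite fineK// ge0_fin_numE.
rewrite ME LE in hMge hLge halpha hL hM.
(* [a1] is the margin of dissipation off the sublevel set, [a2] the one on it. *)
have {halpha} [a1 a2] : 2 * alpha < ell * gamma - M /\ 2 * alpha < 2 * kappa * sigma_min - ell * L - M.
  move: halpha; rewrite -!EFinM -!EFinB -EFin_min -EFinM lte_fin mulrC ltr_pdivlMr//.
  by rewrite lt_min mulrC => /andP.
have kap0 : 0 < 2 * kappa by rewrite mulr_gt0.
(* The almost-everywhere information is gathered in one space-time statement, to be transported
   along the flow once. The equality of [v] and [u] stays a premise: it holds on all of [Omega] at
   almost every time, so it is supplied directly on the trajectory. *)
have good : {ae (lebesgue_measure \x lebesgue_rV m)%E,
    forall p : measurableTypeR R * 'rV[R]_m, 0 <= p.1 -> Omega p.2 ->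
    [/\ d p.1 p.2 = div Du p.1 p.2, sigma p.1 p.2 = sg p.1 p.2 &
      K p.1 p.2 -> v p.1 p.2 = u p.1 p.2 ->
      - (d p.1 p.2 + 2 * kappa * sg p.1 p.2) <=
      - 2 * alpha - ell * (Phit p.1 p.2 + dot (v p.1 p.2) (gradPhi p.1 p.2))]}.
  have F := @ae_filter_ringOfSetsType _ _ R (lebesgue_measure \x lebesgue_rV m)%E.
  have sgE2 : {ae (lebesgue_measure \x lebesgue_rV m)%E,
      forall p : measurableTypeR R * 'rV[R]_m, 0 <= p.1 -> Omega p.2 ->
      sigma p.1 p.2 = sg p.1 p.2 /\ 0 <= sigma p.1 p.2}.
    move: sgE hS sig0; apply: (@filterS3 _ _ F) => -[r x] /= k1 k2 k3 r0 Ox; split; last exact: k3.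
    rewrite /sg -k1// clampE// le_max k2//.
  have K12 : {ae (lebesgue_measure \x lebesgue_rV m)%E,
      forall p : measurableTypeR R * 'rV[R]_m, 0 <= p.1 -> Omega p.2 ->
      u' p.1 p.2 = u p.1 p.2 /\ sigma' p.1 p.2 = sigma p.1 p.2}.
    by move: u'_rep sigma'_rep; apply: (@filterS2 _ _ F) => -[r x] /= k1 k2 r0 Ox; rewrite k1 ?k2.
  have KML : {ae (lebesgue_measure \x lebesgue_rV m)%E,
      forall p : measurableTypeR R * 'rV[R]_m, 0 <= p.1 -> K p.1 p.2 ->
      - div Du p.1 p.2 <= M /\ (Phi p.1 p.2 <= a_d -> material_derivative u Phit gradPhi p.1 p.2 <= L)}.
    move: hMge hLge; apply: (@filterS2 _ _ F) => -[r x] /= k1 k2 r0 Kx; split.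
      by have := k1 r0 Kx; rewrite lee_fin ge_max => /andP[].
    move=> Pa; have := k2 r0 (conj Kx (conj (K_sub r r0 x Kx) Pa)).
    by rewrite lee_fin ge_max => /andP[].
  have dE' : {ae (lebesgue_measure \x lebesgue_rV m)%E,
      forall p : measurableTypeR R * 'rV[R]_m, (0 <= p.1 /\ Omega p.2) -> d p.1 p.2 = div Du p.1 p.2}.
    exact: dE.
  have dsg : {ae (lebesgue_measure \x lebesgue_rV m)%E,
      forall p : measurableTypeR R * 'rV[R]_m, 0 <= p.1 -> Omega p.2 ->
      [/\ d p.1 p.2 = div Du p.1 p.2, sigma p.1 p.2 = sg p.1 p.2 & 0 <= sigma p.1 p.2]}.
    move: dE' sgE2; apply: (@filterS2 _ _ F) => -[r x] /= k1 k2 r0 Ox.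
    by have [] := k2 r0 Ox; rewrite k1.
  move: dsg K12 KML; apply: (@filterS3 _ _ F) => -[r x] /= k1 k2 k3 r0 Ox.
  have [dd ss s0] := k1 r0 Ox; split => // Kx vx.
  have [uu su] := k2 r0 Ox; have [kM kL] := k3 r0 Kx.
  rewrite vx -ss dd.
  have -> : Phit r x + dot (u r x) (gradPhi r x) = material_derivative u' Phit gradPhi r x.
    by rewrite /material_derivative uu.
  have uE : material_derivative u' Phit gradPhi r x = material_derivative u Phit gradPhi r x.
    by rewrite /material_derivative uu.
  (* Below [a_d] the damping pays for compression and for a growth of [Phi] at rate at most [L].
     Above it only the sign of [sigma] is used, and the decrease of [Phi] pays. *)
  have [Pa|Pa] := leP (Phi r x) a_d.
    have h1 := sigma_bound r x r0 (conj (conj (K_sub r r0 x Kx) Pa) Kx); rewrite su in h1.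
    have h2 := kL Pa; rewrite uE.
    have h3 : 2 * kappa * sigma_min <= 2 * kappa * sigma r x by rewrite ler_wpM2l// ltW.
    have h4 : ell * material_derivative u Phit gradPhi r x <= ell * L by rewrite ler_wpM2l// ltW.
    move: h3 h4 a2 kM; move: (2 * kappa * _) (2 * kappa * _) (ell * _) (ell * _) (div _ _ _).
    by move=> q1 q2 q3 q4 q5; lra.
  have nV : (K r `\` sublevel Omega Phi a_d r) x by split => // -[_]; rewrite leNgt Pa.
  have h2 := Phi_decrease r x r0 nV.
  have h3 : 0 <= 2 * kappa * sigma r x by rewrite mulr_ge0// ltW.
  have h4 : ell * material_derivative u' Phit gradPhi r x <= - (ell * gamma).
    by rewrite -mulrN ler_wpM2l// ltW.
  move: h3 h4 a1 kM; move: (2 * kappa * _) (ell * _) (ell * _) (div _ _ _).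
  by move=> q1 q2 q3 q4; lra.
exists (expR (ell * (Phi_max - Phi_min))); first exact: expR_gt0.
move=> e0 e [me0 fe0] supp sol t t0.
have et := mild_evolution sol t0.
rewrite !L2norm_sqr.
(* The constant is the product of [expR (ell * (Phi_max - Phi_min))] and [expR (- 2 * alpha * t)];
   what remains is a bound on the squared growth factor at almost every point where [e0] is
   nonzero. *)
apply: (weighted_decay oO finO bO nfull rf fl t0 (mulr_ge0 (expR_ge0 _) (expR_ge0 _)) me0 et).
have off := ess_supp_sub_null supp.
have path := ae_along_flow oO finO bO nfull rf fl good t0.
move: off path; apply: filterS2 => x offx pathx Ox n0.
(* A nonzero value of [e0] places [x] in [K 0], off a null set; invariance then keeps the whole
   trajectory in [K], where the hypotheses on [Phi] and [sigma] apply. *)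
have Kx : K 0 x.
  by apply: contrapT => nK; move: n0; rewrite (offx Ox nK) eqxx.
have KX r : 0 <= r -> K r (X r 0 x).
  by move=> r0; apply: (K_inv 0 r); [rewrite lexx r0|exists x].
have OX r : 0 <= r -> Omega (X r 0 x) by move=> r0; exact: (fl_Y fl r0 Ox).
have px := pathx Ox.
(* Along the trajectory [div Du] and [sigma] agree with [d] and [sg] at almost every time, which is
   enough for the exponents to coincide. *)
have growthE : growth Du sigma kappa X t 0 x = expR (- log_jacobian Omega (fun t x => X t 0 x) d t x
    - kappa * \int[lebesgue_measure]_(r in `[0, t]) sg r (extend Omega (fun t x => X t 0 x) r x)).
  have mI : measurable (`[0, t]%classic : set (measurableTypeR R)) by exact: measurable_itv.
  have finI := leb_itv_fin 0 t.
  have b1 := flow_path_bmf oO rf fl x (bmf_d rf).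
  have b2 := flow_path_bmf oO rf fl x bsg.
  rewrite /growth; congr expR; rewrite -opprD; congr (- _).
  rewrite -(bintZ mI finI kappa b2) -(bintD mI finI b1 (bmfZ kappa b2)).
  apply: ae_eq_Rintegral; move: px; apply: filterS => r h1; rewrite /= in_itv /= => rt.
  have /andP[r0 _] := rt; have [h2 h3 _] := h1 rt r0 (OX r r0).
  by rewrite extendE// -h2 -h3.
have diss : {ae (@lebesgue_measure R), forall r : measurableTypeR R, 0 <= r <= t ->
     - (d r (X r 0 x) + 2 * kappa * sg r (X r 0 x)) <=
     - 2 * alpha - ell * (Phit r (X r 0 x) + dot (v r (X r 0 x)) (gradPhi r (X r 0 x)))}.
  move: px vu; apply: filterS2 => r h1 h2 rt; have /andP[r0 _] := rt.
  have [_ _] := h1 rt r0 (OX r r0); apply; first exact: KX.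
  exact: (h2 r0 _ (OX r r0)).
have := lyapunov_exponent oO Phi_C1 rf fl bsg Ox t0 diss.
rewrite growthE.
have B0 := Phi_bounds _ _ (lexx 0) Kx.
have Bt := Phi_bounds _ _ t0 (KX t t0).
move: (log_jacobian _ _ _ _ _) (Rintegral _ _ _) => lj I hlj.
rewrite -expRM_natl -!expRD ler_expR.
have /andP[_ B1] := B0; have /andP[B2 _] := Bt.
have B3 : ell * (Phi 0 x - Phi t (X t 0 x)) <= ell * (Phi_max - Phi_min).
  by rewrite ler_wpM2l ?(ltW ell0)// lerB.
move: hlj B3; move: (ell * _) (ell * _) => q1 q2.
(* Squaring doubles the exponent. One copy of [lj] goes with the damping, as in [lyapunov_exponent];
   the other is the inverse Jacobian allowed by [weighted_decay]. *)
have -> : 2 * (- lj - kappa * I) = (- lj - 2 * kappa * I) - lj by ring.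
by move: (- lj - 2 * kappa * I) (- 2 * alpha * t) => q3 q4 h1 h2; lra.
Qed.
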